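(* Let $\Bbbk$ be an algebraically closed field and $n\geq 2$. The basic generalized tilting $B_n$-modules are, up to isomorphism, exactly the modules $$P(1)\oplus P(2)\oplus\dots\oplus P(n-1)\oplus X,$$ where $X\in\mathbf{D}$.
   Context: Modules are finite-dimensional right modules. The algebra $B_n$ ($n\geq 2$): consider the quiver with vertices $1,2,\dots,n$ and, for each $1\leq i\leq n-1$, one arrow $i\to i+1$ and one arrow $i+1\to i$. Then $B_n$ is the quotient of the path algebra over $\Bbbk$ of this quiver by the ideal generated by the relations: any path of length three is zero; any path of length two which is not a cycle is zero; for each vertex $v$, all length two cycles which start and terminate at $v$ are equal; the length two cycle at the vertex $n$ is zero. $L(i)$ is the simple $B_n$-module associated to the vertex $i$ and $P(i)$ is its indecomposable projective cover. Set $\Delta(1)=\nabla(1)=L(1)$. For $2\leq i\leq n$, $\Delta(i)$ is the (unique up to isomorphism) uniserial $B_n$-module of length two with top $L(i)$ and socle $L(i-1)$, and $\nabla(i)$ is the (unique up to isomorphism) uniserial $B_n$-module of length two with top $L(i-1)$ and socle $L(i)$. (These are the standard and costandard modules for the quasi-hereditary structure on $B_n$ with respect to $L(1)<L(2)<\dots<L(n)$.) Set $$\mathbf{D}=\{\Delta(n),\Delta(n-1),\dots,\Delta(1)=\nabla(1),\nabla(2),\dots,\nabla(n)\}.$$ A module $T$ over a finite-dimensional algebra $\Lambda$ is a generalized tilting module if: $T$ has finite projective dimension; $\mathrm{Ext}^i_\Lambda(T,T)=0$ for all $i>0$; and the right regular module $\Lambda_\Lambda$ has a finite coresolution by modules in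 $\mathrm{add}(T)$, i.e. there is an exact sequence $0\to\Lambda_\Lambda\to T_0\to\dots\to T_m\to 0$ with all $T_i\in\mathrm{add}(T)$. A module is basic if it is isomorphic to a direct sum of pairwise non-isomorphic indecomposable modules. *)

(* Defs.v *)
From HB Require Import structures.
From mathcomp Require Import all_boot all_order all_algebra all_field.
From mathcomp Require Import finmap.
From mathcomp.multinomials Require Import monalg.

Set Implicit Arguments.
Unset Strict Implicit.
Unset Printing Implicit Defensive.

Import GRing.Theory.
Local Open Scope ring_scope.

Record quiver := Quiver {
  vertex : finType;
  arrow : finType;
  src : arrow -> vertex;
  tgt : arrow -> vertex
}.

Section Paths.
Variable Q : quiver.

Fixpoint walk (v : vertex Q) (s : seq (arrow Q)) : bool :=
  if s is a :: s' then (src a == v) && walk (tgt a) s' else true.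

Definition walk_end (v : vertex Q) (s : seq (arrow Q)) : vertex Q :=
  last v [seq tgt a | a <- s].

(* The start vertex is part of the data, so that there is one path of length  *)
(* zero at each vertex. Arrows are listed in the order in which they are      *)
(* traversed.                                                                 *)
Record qpath := QPath {
  qval : vertex Q * seq (arrow Q);
  _ : walk qval.1 qval.2
}.
HB.instance Definition _ := [isSub for qval].
HB.instance Definition _ := [Choice of qpath by <:].

Definition pstart (p : qpath) : vertex Q := (val p).1.
Definition parrows (p : qpath) : seq (arrow Q) := (val p).2.
Definition pend (p : qpath) : vertex Q := walk_end (pstart p) (parrows p).
Definition plen (p : qpath) : nat := size (parrows p).

Definition vpath (v : vertex Q) : qpath := @QPath (v, [::]) isT.

Lemma apath_subproof (a : arrow Q) : walk (src a) [:: a].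
Proof. by rewrite /= eqxx. Qed.
Definition apath (a : arrow Q) : qpath := @QPath (src a, [:: a]) (apath_subproof a).

Definition pcat (p q : qpath) : option qpath :=
  if pend p == pstart q then insub (pstart p, parrows p ++ parrows q) else None.

Lemma walk_cat v s t : walk v (s ++ t) = walk v s && walk (walk_end v s) t.
Proof. by elim: s v => //= a s IH v; rewrite IH andbA. Qed.

Lemma walk_end_cat v s t : walk_end v (s ++ t) = walk_end (walk_end v s) t.
Proof. by rewrite /walk_end map_cat last_cat. Qed.

Lemma pcat_some p q : pend p == pstart q ->
  exists2 r, pcat p q = Some r & val r = (pstart p, parrows p ++ parrows q).
Proof.
move=> epq; rewrite /pcat epq; case: insubP => [r _ er|]; first by exists r.
rewrite /= walk_cat; case: p q epq => [[v s] /= ws] [[w t] /= wt].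
by rewrite /pend /= => /eqP e; rewrite ws /= -/(walk_end v s) e wt.
Qed.

Lemma pcatA p q r :
  obind (pcat p) (pcat q r) = obind (fun u => pcat u r) (pcat p q).
Proof.
case epq: (pend p == pstart q).
  have [u -> eu] := pcat_some epq; rewrite /=.
  have su : pstart u = pstart p by rewrite /pstart eu.
  have au : parrows u = parrows p ++ parrows q by rewrite /parrows eu.
  have endu : pend u = pend q.
    by rewrite /pend su au walk_end_cat -/(pend p) (eqP epq).
  case eqr: (pend q == pstart r).
    have [w -> ew] := pcat_some eqr; rewrite /= /pcat endu eqr.
    have -> : pstart w = pstart q by rewrite /pstart ew.
    have -> : parrows w = parrows q ++ parrows r by rewrite /parrows ew.
    by rewrite epq su au catA.
  by rewrite /pcat endu eqr.
have -> : pcat p q = None by rewrite /pcat epq.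
rewrite /=; case eqr: (pend q == pstart r); last by rewrite /pcat eqr.
have [w -> ew] := pcat_some eqr; rewrite /= /pcat.
have -> : pstart w = pstart q by rewrite /pstart ew.
by rewrite epq.
Qed.

Lemma pcat_vl v p : pcat (vpath v) p = if v == pstart p then Some p else None.
Proof.
rewrite /pcat; have -> : pend (vpath v) = v by [].
case: eqP => // ->; rewrite [X in insub X](_ : _ = val p) ?valK //.
by case: p => [[]].
Qed.

Lemma pcat_vr p v : pcat p (vpath v) = if v == pend p then Some p else None.
Proof.
rewrite /pcat; have -> : pstart (vpath v) = v by [].
rewrite eq_sym; case: eqP => // _; rewrite cats0 [X in insub X](_ : _ = val p) ?valK //.
by case: p => [[]].
Qed.

End Paths.

(* Finitely supported functions on the set of paths; this is a synonym,       *)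
(* distinct from {malg k[qpath Q]}, because it carries the concatenation      *)
(* product instead of the product of a monoid algebra.                        *)
Definition path_alg (k : fieldType) (Q : quiver) : Type := {malg k[qpath Q]}.
HB.instance Definition _ k Q := GRing.Lmodule.on (@path_alg k Q).

Section PathAlgebra.
Variables (k : fieldType) (Q : quiver).
Local Notation kQ := (path_alg k Q).

Definition pelt (p : qpath Q) : kQ := mkmalgU p 1.

Definition pmul (p q : qpath Q) : kQ := if pcat p q is Some r then pelt r else 0.

Definition path_alg_mul (x y : kQ) : kQ :=
  \sum_(p <- msupp x) \sum_(q <- msupp y) (mcoeff p x * mcoeff q y) *: pmul p q.

Definition path_alg_one : kQ := \sum_(v : vertex Q) pelt (vpath v).

Definition plin (f : qpath Q -> kQ) (x : kQ) : kQ :=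
  \sum_(p <- msupp x) mcoeff p x *: f p.

Lemma plinEw f (x : kQ) (d : {fset qpath Q}) : (msupp x `<=` d)%fset ->
  plin f x = \sum_(p <- d) mcoeff p x *: f p.
Proof.
move=> sd; rewrite /plin; apply: big_fset_incl => // p _ px.
by rewrite mcoeff_outdom ?scale0r.
Qed.

Lemma plin_linear f : linear (plin f).
Proof.
move=> c x y; pose d := (msupp x `|` msupp y)%fset.
rewrite (@plinEw f x d) ?fsubsetUl // (@plinEw f y d) ?fsubsetUr //.
rewrite (@plinEw f _ d); last first.
  apply: fsubset_trans (msuppD_le _ _) _.
  exact: fsetSU (msuppZ_le _ _).
rewrite scaler_sumr -big_split /=; apply: eq_bigr => p _.
by rewrite mcoeffD mcoeffZ scalerDl scalerA.
Qed.

HB.instance Definition _ f := GRing.isLinear.Build k kQ kQ _ (plin f) (plin_linear f).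

Lemma plin_pelt f p : plin f (pelt p) = f p.
Proof.
rewrite (@plinEw f _ [fset p]%fset) ?msuppU_le //.
by rewrite big_seq_fset1 mcoeffUU scale1r.
Qed.

Lemma plinE (x : kQ) : plin pelt x = x.
Proof.
rewrite [RHS]monalgE; apply: eq_bigr => p _.
by apply/malgP => q; rewrite mcoeffZ !mcoeffU; case: eqP; rewrite ?mulr1 ?mulr0.
Qed.

Lemma path_alg_mulE x y :
  path_alg_mul x y = plin (fun p => plin (pmul p) y) x.
Proof.
apply: eq_bigr => p _; rewrite scaler_sumr.
by apply: eq_bigr => q _; rewrite scalerA.
Qed.

Lemma plin_fun_linear (y : kQ) (f : kQ -> qpath Q -> kQ) :
  (forall p, linear (f^~ p)) -> linear (fun x => plin (f x) y).
Proof.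
move=> lf c x x'; rewrite scaler_sumr -big_split /=; apply: eq_bigr => p _.
by rewrite lf scalerDr !scalerA mulrC.
Qed.

Lemma path_alg_mul_linl y : linear (path_alg_mul^~ y).
Proof. by move=> c x x'; rewrite !path_alg_mulE linearP. Qed.

Lemma path_alg_mul_linr x : linear (path_alg_mul x).
Proof.
move=> c y y'; rewrite !path_alg_mulE.
apply: (@plin_fun_linear x (fun y p => plin (pmul p) y)) => p.
exact: linearP.
Qed.

HB.instance Definition _ x :=
  GRing.isLinear.Build k kQ kQ _ (path_alg_mul x) (path_alg_mul_linr x).

Lemma path_alg_mul_pelt p q : path_alg_mul (pelt p) (pelt q) = pmul p q.
Proof. by rewrite path_alg_mulE !plin_pelt. Qed.

Lemma linear_eq_path (f g : kQ -> kQ) : linear f -> linear g ->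
  (forall p, f (pelt p) = g (pelt p)) -> f =1 g.
Proof.
move=> lf lg e x; rewrite -(plinE x) /plin.
have f0 : f 0 = 0 by have := lf (-1) 0 0; rewrite scaler0 addr0 scaleN1r addNr.
have g0 : g 0 = 0 by have := lg (-1) 0 0; rewrite scaler0 addr0 scaleN1r addNr.
by elim: (enum_fset _) => [|p s IH]; rewrite ?big_nil ?f0 ?g0 // big_cons lf lg e IH.
Qed.

Lemma path_alg_mulA : associative path_alg_mul.
Proof.
move=> x y z; have lin3 := path_alg_mul_linl; have lin2 := path_alg_mul_linr.
apply: (@linear_eq_path (fun x => path_alg_mul x (path_alg_mul y z))
  (fun x => path_alg_mul (path_alg_mul x y) z)); first exact: lin3.
  by move=> c u v; rewrite !lin3.
move=> p; apply: (@linear_eq_path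
  (fun y => path_alg_mul (pelt p) (path_alg_mul y z))
  (fun y => path_alg_mul (path_alg_mul (pelt p) y) z)).
- by move=> c u v; rewrite lin3 lin2.
- by move=> c u v; rewrite lin2 lin3.
move=> q; apply: (@linear_eq_path
  (fun z => path_alg_mul (pelt p) (path_alg_mul (pelt q) z))
  (fun z => path_alg_mul (path_alg_mul (pelt p) (pelt q)) z)).
- by move=> c u v; rewrite !lin2.
- exact: lin2.
move=> r; rewrite !path_alg_mul_pelt.
have mul0r : forall u, path_alg_mul 0 u = 0.
  by move=> u; rewrite /path_alg_mul msupp0 big_nil.
have mulr0 : forall u, path_alg_mul u 0 = 0 by move=> u; rewrite linear0.
have := pcatA p q r; rewrite /pmul.
case: (pcat q r) => [u|]; case: (pcat p q) => [w|] /=;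
  rewrite ?path_alg_mul_pelt ?mul0r ?mulr0 /pmul //.
- by move=> ->.
- by move=> ->.
- by move=> <-.
Qed.

Lemma path_alg_mul1 : left_id path_alg_one path_alg_mul.
Proof.
apply: linear_eq_path => [||p]; [exact: path_alg_mul_linr|by []|].
have lin := path_alg_mul_linl (pelt p).
rewrite /path_alg_one (bigD1 (pstart p)) //= -[pelt (vpath _)]scale1r lin scale1r.
rewrite path_alg_mul_pelt /pmul pcat_vl eqxx.
suff -> : path_alg_mul (\sum_(v | v != pstart p) pelt (vpath v)) (pelt p) = 0.
  by rewrite addr0.
elim/big_ind: _ => [|u v hu hv|v nv].
- by rewrite /path_alg_mul msupp0 big_nil.
- by rewrite -[u]scale1r lin hu hv scaler0 addr0.
by rewrite path_alg_mul_pelt /pmul pcat_vl (negbTE nv).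
Qed.

Lemma path_algM1 : right_id path_alg_one path_alg_mul.
Proof.
apply: linear_eq_path => [||p]; [exact: path_alg_mul_linl|by []|].
rewrite /path_alg_one linear_sum (bigD1 (pend p)) //= path_alg_mul_pelt.
rewrite /pmul pcat_vr eqxx big1 ?addr0 // => v nv.
by rewrite path_alg_mul_pelt /pmul pcat_vr (negbTE nv).
Qed.

Lemma path_alg_mulDl : left_distributive path_alg_mul +%R.
Proof. by move=> x y z; rewrite -[x]scale1r path_alg_mul_linl !scale1r. Qed.

Lemma path_alg_mulDr : right_distributive path_alg_mul +%R.
Proof. by move=> x y z; rewrite linearD. Qed.

HB.instance Definition _ := GRing.Zmodule_isPzRing.Build kQ
  path_alg_mulA path_alg_mul1 path_algM1 path_alg_mulDl path_alg_mulDr.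

End PathAlgebra.

(* Closure under scalars is not needed as a constructor: in a path algebra    *)
(* the multiples of 1 are among the factors [a].                              *)
Inductive ideal_gen (A : pzRingType) (R : A -> Prop) : A -> Prop :=
| ideal_gen0 : ideal_gen R 0
| ideal_genD x y : ideal_gen R x -> ideal_gen R y -> ideal_gen R (x + y)
| ideal_genM a r b : R r -> ideal_gen R (a * r * b).

(* [pi] identifies [B] with the quotient of the path algebra of [Q] by the    *)
(* ideal generated by [R].                                                    *)
Definition path_alg_quotient (k : fieldType) (Q : quiver)
    (R : path_alg k Q -> Prop) (B : falgType k)
    (pi : {rmorphism path_alg k Q -> B}) : Prop :=
  [/\ scalable pi,
      forall b, exists x, pi x = b
    & forall x, pi x = 0 <-> ideal_gen R x].

(* The double quiver of type A_n. Vertex i of the usual labelling 1, ..., n   *)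
(* is the ordinal i - 1.                                                      *)
Definition zigzag_adj (n : nat) (e : 'I_n * 'I_n) : bool :=
  (e.2 == e.1.+1 :> nat) || (e.1 == e.2.+1 :> nat).

Definition zigzag (n : nat) : quiver :=
  @Quiver 'I_n {e : 'I_n * 'I_n | zigzag_adj e}
    (fun a => (val a).1) (fun a => (val a).2).

Inductive zigzag_rel (k : fieldType) (n : nat) : path_alg k (zigzag n) -> Prop :=
| zigzag_len3 (p : qpath (zigzag n)) : plen p = 3%N -> zigzag_rel (pelt k p)
| zigzag_noncycle (p : qpath (zigzag n)) : plen p = 2%N ->
    pstart p <> pend p -> zigzag_rel (pelt k p)
| zigzag_cycles (p q : qpath (zigzag n)) : plen p = 2%N -> plen q = 2%N ->
    pstart p = pend p -> pstart q = pend q -> pstart p = pstart q ->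
    zigzag_rel (pelt k p - pelt k q)
| zigzag_last (p : qpath (zigzag n)) : plen p = 2%N -> pstart p = pend p ->
    (pstart p : 'I_n) = n.-1 :> nat -> zigzag_rel (pelt k p).

Record rmodule (k : fieldType) (A : falgType k) := RModule {
  rmod_sort :> vectType k;
  act : rmod_sort -> A -> rmod_sort;
  act_linearl : forall a, linear (act^~ a);
  act_linearr : forall m, linear (act m);
  act1 : forall m, act m 1 = m;
  actM : forall m a b, act m (a * b) = act (act m a) b
}.
Arguments act {k A r} m a : rename.

Section Modules.
Variables (k : fieldType) (A : falgType k).
Local Notation rmodule := (rmodule A).
Implicit Types M N L P T X : rmodule.

Definition rhom M N (f : 'Hom(M, N)) : Prop :=
  forall m a, f (act m a) = act (f m) a.

Definition riso M N : Prop :=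
  exists f : 'Hom(M, N), [/\ rhom f, lker f = 0%VS & limg f = fullv].

Fact regular_linearl (a : A) : linear (fun x : A => x * a).
Proof. by move=> c x y; rewrite mulrDl scalerAl. Qed.

Fact regular_linearr (x : A) : linear (fun a : A => x * a).
Proof. by move=> c a b; rewrite mulrDr scalerAr. Qed.

Definition regular : rmodule :=
  @RModule k A A (fun x a => x * a)
    regular_linearl regular_linearr (@mulr1 A) (@mulrA A).

Fact rzero_linearl (a : A) : linear (fun m : 'rV[k]_0 => m).
Proof. by []. Qed.

Fact rzero_linearr (m : 'rV[k]_0) : linear (fun _ : A => m).
Proof. by move=> c a b; apply/rowP => -[]. Qed.

Definition rzero : rmodule :=
  @RModule k A 'rV[k]_0 (fun m _ => m)
    rzero_linearl rzero_linearr (fun=> erefl) (fun _ _ _ => erefl).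

Section DirectSum.
Variables M N : rmodule.

Definition rdsum_act (m : (M * N)%type) (a : A) : (M * N)%type :=
  (act m.1 a, act m.2 a).

Fact rdsum_linearl (a : A) : linear (rdsum_act^~ a).
Proof. by move=> c x y; rewrite /rdsum_act !act_linearl. Qed.

Fact rdsum_linearr m : linear (rdsum_act m).
Proof. by move=> c a b; rewrite /rdsum_act !act_linearr. Qed.

Fact rdsum_act1 m : rdsum_act m 1 = m.
Proof. by case: m => m m'; rewrite /rdsum_act !act1. Qed.

Fact rdsum_actM m a b : rdsum_act m (a * b) = rdsum_act (rdsum_act m a) b.
Proof. by rewrite /rdsum_act !actM. Qed.

Definition rdsum : rmodule :=
  @RModule k A (M * N)%type rdsum_act
    rdsum_linearl rdsum_linearr rdsum_act1 rdsum_actM.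

End DirectSum.

Definition rnull M : Prop := \dim {:M} = 0%N.

Definition submod M (U : {vspace M}) : Prop :=
  forall m a, m \in U -> act m a \in U.

Definition simple_submod M (U : {vspace M}) : Prop :=
  [/\ submod U, U <> 0%VS
    & forall V, submod V -> (V <= U)%VS -> V = 0%VS \/ V = U].

Definition maximal_submod M (U : {vspace M}) : Prop :=
  [/\ submod U, U <> fullv
    & forall V, submod V -> (U <= V)%VS -> V = U \/ V = fullv].

Definition is_radical M (U : {vspace M}) : Prop :=
  forall m, m \in U <-> (forall V, maximal_submod V -> m \in V).

(* The sum of all simple submodules, as the least subspace containing them. *)
Definition is_socle M (U : {vspace M}) : Prop :=
  (forall V, simple_submod V -> (V <= U)%VS) /\
  (forall W, (forall V, simple_submod V -> (V <= W)%VS) -> (U <= W)%VS).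

(* A surjection with kernel [U] encodes an isomorphism from the quotient of   *)
(* [M] by [U] to [L].                                                         *)
Definition has_top M L : Prop :=
  exists f : 'Hom(M, L), [/\ rhom f, limg f = fullv & is_radical (lker f)].

Definition has_socle M L : Prop :=
  exists f : 'Hom(L, M), [/\ rhom f, lker f = 0%VS & is_socle (limg f)].

Definition uniserial M : Prop :=
  forall U V : {vspace M}, submod U -> submod V -> (U <= V)%VS \/ (V <= U)%VS.

Definition has_length M (l : nat) : Prop :=
  exists U : nat -> {vspace M},
    [/\ U 0%N = 0%VS, U l = fullv, forall i, (i <= l)%N -> submod (U i)
      & forall i, (i < l)%N -> [/\ (U i <= U i.+1)%VS, U i <> U i.+1
          & forall V, submod V -> (U i <= V)%VS -> (V <= U i.+1)%VS ->
              V = U i \/ V = U i.+1]].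

Definition indecomposable M : Prop :=
  ~ rnull M /\ (forall N N', riso M (rdsum N N') -> rnull N \/ rnull N').

Definition basic M : Prop :=
  exists (r : nat) (X : 'I_r -> rmodule),
    [/\ forall i, indecomposable (X i),
        forall i j, i <> j -> ~ riso (X i) (X j)
      & riso M (\big[rdsum/rzero]_(i < r) X i)].

Definition in_add T N : Prop :=
  exists (N' : rmodule) (r : nat),
    riso (rdsum N N') (\big[rdsum/rzero]_(i < r) T).

(* The test modules are finite-dimensional, like all modules here. *)
Definition projective P : Prop :=
  forall M N (g : 'Hom(M, N)) (f : 'Hom(P, N)),
    rhom g -> limg g = fullv -> rhom f ->
    exists2 h : 'Hom(P, M), rhom h & f = (g \o h)%VF.

(* The kernel of the epimorphism onto [L] is required to be superfluous. *)
Definition projective_cover P L : Prop :=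
  projective P /\
  exists f : 'Hom(P, L), [/\ rhom f, limg f = fullv
    & forall U, submod U -> (U + lker f)%VS = fullv -> U = fullv].

Definition projective_resolution M (P : nat -> rmodule)
    (d : forall i, 'Hom(P i.+1, P i)) (aug : 'Hom(P 0%N, M)) : Prop :=
  [/\ forall i, projective (P i),
      forall i, rhom (d i),
      rhom aug
    & [/\ limg aug = fullv, limg (d 0%N) = lker aug
        & forall i, limg (d i.+1) = lker (d i)]].

Definition finite_projdim M : Prop :=
  exists (P : nat -> rmodule) (d : forall i, 'Hom(P i.+1, P i))
    (aug : 'Hom(P 0%N, M)) (r : nat),
    projective_resolution d aug /\ (forall i, (r < i)%N -> rnull (P i)).

(* Ext^{i+1}(M, N) = 0: for a projective resolution of M, the cohomology of   *)
(* the complex Hom(P_*, N) at Hom(P_{i+1}, N) vanishes.                       *)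
Definition ext_succ_eq0 (i : nat) M N : Prop :=
  forall (P : nat -> rmodule) (d : forall i, 'Hom(P i.+1, P i))
    (aug : 'Hom(P 0%N, M)), projective_resolution d aug ->
  forall f : 'Hom(P i.+1, N), rhom f -> (f \o d i.+1)%VF = 0 ->
  exists2 g : 'Hom(P i, N), rhom g & f = (g \o d i)%VF.

Definition finite_add_coresolution T M : Prop :=
  exists (C : nat -> rmodule) (d : forall i, 'Hom(C i, C i.+1))
    (coaug : 'Hom(M, C 0%N)) (r : nat),
    [/\ forall i, (i <= r)%N -> in_add T (C i),
        forall i, (r < i)%N -> rnull (C i),
        forall i, rhom (d i),
        rhom coaug
      & [/\ lker coaug = 0%VS, limg coaug = lker (d 0%N)
          & forall i, limg (d i) = lker (d i.+1)]].

Definition generalized_tilting T : Prop :=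
  [/\ finite_projdim T,
      forall i, ext_succ_eq0 i T T
    & finite_add_coresolution T regular].

End Modules.

Section QuiverModules.
Variables (k : fieldType) (Q : quiver) (B : falgType k).
Variable pi : {rmorphism path_alg k Q -> B}.

Definition vertex_simple (i : vertex Q) (L : rmodule B) : Prop :=
  [/\ \dim {:L} = 1%N,
      forall m : L, act m (pi (pelt k (vpath i))) = m
    & forall (m : L) (a : arrow Q), act m (pi (pelt k (apath a))) = 0].

End QuiverModules.

Definition uniserial2 (k : fieldType) (B : falgType k) (M L L' : rmodule B) : Prop :=
  [/\ uniserial M, has_length M 2%N, has_top M L & has_socle M L'].

(* Main.v *)
Require Import Defs.
From HB Require Import structures.
From mathcomp Require Import all_boot all_order all_algebra all_field.
From mathcomp Require Import finmap zify ring.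
From mathcomp.multinomials Require Import monalg.
From Stdlib Require Import Classical.

(* Number the members of D as D_0 = Delta(n) = P(n), ..., D_{n-1} = Delta(1),  *)
(* ..., D_{2n-2} = nabla(n). Each D_k embeds into a projective-injective P(v),  *)
(* v < n, with cokernel D_{k+1}. Along 0 -> K -> F -> X -> 0 with F projective  *)
(* and injective, Ext^i(K, K) = Ext^i(X, X) for i > 0, so every D_k inherits    *)
(* self-orthogonality from D_0. Conversely let X be self-orthogonal of finite   *)
(* projective dimension d. If d > 0, the last term of a minimal resolution of X *)
(* embeds into the previous one without splitting, hence involves P(n), and     *)
(* Ext^d(X, L(n)) <> 0; as Ext^d(X, -) is right exact, X cannot map onto L(n).  *)
(* Thus either X is projective or it is covered by a projective-injective       *)
(* module, and then induction on d applies to the kernel of the cover: X is     *)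
(* projective-injective or has some D_k as a summand. Finally Ext^{b-a}(D_b,    *)
(* D_a) <> 0 for a < b, so a self-orthogonal module involves at most one D_k.   *)

Set Implicit Arguments.
Unset Strict Implicit.
Unset Printing Implicit Defensive.

Import GRing.Theory.
Local Open Scope ring_scope.

(** Everything rests on the chain of exact sequences [DK x] -> [P (socK x)] -> [DK x.+1] of
    [DK_ses], whose middle terms are projective and injective ([P_injmod]). The chain starts at P(n)
    ([DK0_riso]) and ends at the injective module nabla(n) ([DK_last_injmod]).

    A sum of all P(v), v < n, with one [DK x] is tilting ([tilting_sum]). The chain gives a
    projective resolution of [DK x] and, read from the left, a coresolution of P(n), hence of the
    regular module. Self-orthogonality is carried from P(n) along the chain, since a
    projective-injective middle term shifts both arguments of Ext ([self_orthogonal_cosyz]).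

    Conversely let T be basic and tilting ([tilting_classified]). By [self_orthogonal_summand],
    which rests on [projinj_cover], [pd1_top_split] and [DK_step], every indecomposable summand of T
    is some P(v) with v < n or some [DK x]. Each P(v) with v < n does occur: it is injective and
    embeds in the regular module, hence in the first term of the coresolution, where it splits off.
    At most one [DK x] occurs, by [DK_ext] and [DK_unique]. At least one occurs, for otherwise the
    coresolution would consist of projective-injective modules and split, making the regular module
    injective, although its summand P(n) is not.

    Krull-Schmidt arguments are made with [local] and [retract], and Ext is handled through syzygies
    ([ext_eq0]), independently of a resolution. *)

Section LinearMaps.
Variables (k : fieldType).
Implicit Types U V W : vectType k.

Section ExLfun.
Variables (U V : vectType k) (f : U -> V) (lf : linear f).
HB.instance Definition _ := GRing.isLinear.Build k U V _ f lf.

(** Most homomorphisms below are given by a formula with a linearity proof; this turns such a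
    function into a linear map without declaring an instance for each. *)
Lemma ex_lfun : {g : 'Hom(U, V) | g =1 f}.
Proof. by exists (linfun f) => x; rewrite lfunE. Qed.

End ExLfun.

Lemma linear_addf U V (f g : U -> V) : linear f -> linear g -> linear (fun x => f x + g x).
Proof. by move=> lf lg c x y; rewrite lf lg scalerDr addrACA. Qed.

Lemma linear_sumf U V (I : Type) (r : seq I) (f : I -> U -> V) :
  (forall i, linear (f i)) -> linear (fun x => \sum_(i <- r) f i x).
Proof.
move=> lf c x y; rewrite scaler_sumr -big_split /=; apply: eq_bigr => i _; exact: lf.
Qed.

Lemma linear_scalef U V (f : U -> k^o) (v : V) : linear f -> linear (fun x => (f x : k) *: v).
Proof. by move=> lf c x y; rewrite lf scalerDl -scalerA. Qed.

Lemma lker_inj U V (f : 'Hom(U, V)) : lker f = 0%VS <-> injective f.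
Proof.
by split=> [/eqP/lker0P//|/lker0P/eqP].
Qed.

Lemma limg_surj U V (f : 'Hom(U, V)) : limg f = fullv <-> (forall y, exists x, f x = y).
Proof.
split=> [e y|s].
  have : y \in limg f by rewrite e memvf.
  by case/memv_imgP => x _ ->; exists x.
apply/vspaceP => y; rewrite memvf; have [x <-] := s y.
by rewrite memv_img ?memvf.
Qed.

(** Exactness in terms of elements, the form used in all diagram chases. *)
Lemma limg_lkerP U V W (f : 'Hom(U, V)) (g : 'Hom(V, W)) :
  limg f = lker g <-> (forall y, g y = 0 <-> exists x, y = f x).
Proof.
split=> [e y|s].
  split=> [gy|[x ->]].
    have : y \in limg f by rewrite e memv_ker gy.
    by case/memv_imgP => x _ ->; exists x.
  by apply/eqP; rewrite -memv_ker -e memv_img ?memvf.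
apply/vspaceP => y; rewrite memv_ker; apply/idP/eqP.
  by case/memv_imgP => x _ ->; apply/s; exists x.
by move/s => [x ->]; rewrite memv_img ?memvf.
Qed.

End LinearMaps.

(** * Modules over a finite-dimensional algebra *)

Section ModuleTheory.
Variables (k : fieldType) (A : falgType k).
Local Notation rmodule := (rmodule A).
Implicit Types M N K P Q X I J : rmodule.

Lemma actD M (m m' : M) (a : A) : act (m + m') a = act m a + act m' a.
Proof. by have := act_linearl a 1 m m'; rewrite !scale1r. Qed.

Lemma actDr M (m : M) (a b : A) : act m (a + b) = act m a + act m b.
Proof. by have := act_linearr m 1 a b; rewrite !scale1r. Qed.

Lemma act0 M (a : A) : act (0 : M) a = 0.
Proof. by apply: (addrI (act (0 : M) a)); rewrite -actD !addr0. Qed.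

Lemma actr0 M (m : M) : act m (0 : A) = 0.
Proof. by apply: (addrI (act m (0 : A))); rewrite -actDr !addr0. Qed.

Lemma actZ M c (m : M) (a : A) : act (c *: m) a = c *: act m a.
Proof. by have := act_linearl a c m 0; rewrite act0 !addr0. Qed.

Lemma actZr M c (m : M) (a : A) : act m (c *: a) = c *: act m a.
Proof. by have := act_linearr m c a 0; rewrite actr0 !addr0. Qed.

Lemma actN M (m : M) (a : A) : act (- m) a = - act m a.
Proof. by rewrite -scaleN1r actZ scaleN1r. Qed.

Lemma act_sumr M (m : M) (I : Type) (r : seq I) (C : pred I) (F : I -> A) :
  act m (\sum_(i <- r | C i) F i) = \sum_(i <- r | C i) act m (F i).
Proof. by apply: (big_morph (act m)); [exact: actDr | exact: actr0]. Qed.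

Lemma act_suml M (a : A) (I : Type) (r : seq I) (C : pred I) (F : I -> M) :
  act (\sum_(i <- r | C i) F i) a = \sum_(i <- r | C i) act (F i) a.
Proof. by apply: (big_morph (act^~ a)) => [x y|]; [exact: actD | exact: act0]. Qed.

Lemma rhom_id M : rhom (\1%VF : 'Hom(M, M)).
Proof. by move=> m a; rewrite !id_lfunE. Qed.

Lemma rhom_comp M N X (g : 'Hom(N, X)) (f : 'Hom(M, N)) :
  rhom g -> rhom f -> rhom (g \o f)%VF.
Proof. by move=> hg hf m a; rewrite !comp_lfunE hf hg. Qed.

Lemma rhom0 M N : rhom (0 : 'Hom(M, N)).
Proof. by move=> m a; rewrite !zero_lfunE act0. Qed.

Lemma rhomD M N (f g : 'Hom(M, N)) : rhom f -> rhom g -> rhom (f + g).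
Proof. by move=> hf hg m a; rewrite !add_lfunE hf hg actD. Qed.

Lemma rhomZ M N c (f : 'Hom(M, N)) : rhom f -> rhom (c *: f).
Proof. by move=> hf m a; rewrite !scale_lfunE hf actZ. Qed.

Lemma rhomN M N (f : 'Hom(M, N)) : rhom f -> rhom (- f).
Proof. by move=> hf m a; rewrite !opp_lfunE hf actN. Qed.

Lemma rhomB M N (f g : 'Hom(M, N)) : rhom f -> rhom g -> rhom (f - g).
Proof. by move=> hf /rhomN; apply: rhomD. Qed.

(** The carrier is the subspace type of [U]; the projection [vsproj U] in the action changes nothing
    because [U] is stable. *)
Lemma submodule_ex M (U : {vspace M}) : submod U ->
  exists (K : rmodule) (i : 'Hom(K, M)), [/\ rhom i, injective i,
    forall y, y \in U <-> exists x, y = i x & \dim {:K} = \dim U].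
Proof.
move=> HU.
pose ac (u : subvs_of U) (a : A) : subvs_of U := vsproj U (act (vsval u) a).
have acE u a : vsval (ac u a) = act (vsval u) a.
  by rewrite vsprojK ?HU ?subvsP.
have ll a : linear (ac^~ a).
  by move=> c x y; apply/subvs_inj; rewrite acE !linearP /= !acE actD actZ.
have lr u : linear (ac u).
  by move=> c x y; apply/subvs_inj; rewrite acE linearP /= !acE actDr actZr.
have a1 u : ac u 1 = u by apply/subvs_inj; rewrite acE act1.
have aM u a b : ac u (a * b) = ac (ac u a) b.
  by apply/subvs_inj; rewrite !acE actM.
pose K := @RModule k A (subvs_of U) ac ll lr a1 aM.
have [i ie] := @ex_lfun k K M (@vsval _ _ U) (@vsval_is_linear _ _ U).
exists K, i; split=> [m a|x y|y|].
- by rewrite !ie acE.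
- by rewrite !ie => /subvs_inj.
- split=> [yU|[x ->]]; last by rewrite ie subvsP.
  by exists (vsproj U y); rewrite ie vsprojK.
- by rewrite dimvf.
Qed.

Lemma lker_submod M N (f : 'Hom(M, N)) : rhom f -> submod (lker f).
Proof. by move=> hf m a; rewrite !memv_ker hf => /eqP ->; rewrite act0. Qed.

Lemma limg_submod M N (f : 'Hom(M, N)) : rhom f -> submod (limg f).
Proof.
by move=> hf m a /memv_imgP[x _ ->]; rewrite -hf memv_img ?memvf.
Qed.

Lemma ker_ex M N (f : 'Hom(M, N)) : rhom f ->
  exists (K : rmodule) (i : 'Hom(K, M)), [/\ rhom i, injective i,
    forall y, f y = 0 <-> exists x, y = i x &
    (\dim {:K} + \dim (limg f))%N = \dim {:M}].
Proof.
move=> hf; have [K [i [hi ii im dK]]] := submodule_ex (lker_submod hf).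
exists K, i; split=> // [y|]; last by rewrite dK -(limg_ker_dim f fullv) capfv.
rewrite -im memv_ker; split=> [->|/eqP]; by rewrite ?eqxx.
Qed.

Definition surj M N (f : 'Hom(M, N)) := forall y, exists x, f x = y.

Lemma inj_comp M N X (g : 'Hom(N, X)) (f : 'Hom(M, N)) :
  injective g -> injective f -> injective (g \o f)%VF.
Proof. by move=> ig jf x y; rewrite !comp_lfunE => /ig/jf. Qed.

Lemma injP0 M N (f : 'Hom(M, N)) : (forall x, f x = 0 -> x = 0) -> injective f.
Proof. by move=> h x y e; apply/subr0_eq/h; rewrite linearB /= e subrr. Qed.

Definition ses K P M (i : 'Hom(K, P)) (p : 'Hom(P, M)) :=
  [/\ rhom i, rhom p, injective i, surj p & forall z, p z = 0 <-> exists x, z = i x].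

Lemma ses_comp0 K P M (i : 'Hom(K, P)) (p : 'Hom(P, M)) x : ses i p -> p (i x) = 0.
Proof. by case=> _ _ _ _ e; apply/e; exists x. Qed.

Lemma ses_dim K P M (i : 'Hom(K, P)) (p : 'Hom(P, M)) : ses i p ->
  \dim {:P} = (\dim {:K} + \dim {:M})%N.
Proof.
case=> _ _ ii sp e; rewrite -(limg_ker_dim p fullv) capfv.
rewrite ((limg_surj p).2 sp) -((limg_lkerP i p).2 e) limg_dim_eq //.
by rewrite ((lker_inj i).2 ii) capv0.
Qed.

Lemma ker_ses P M (p : 'Hom(P, M)) : rhom p -> surj p ->
  exists (K : rmodule) (i : 'Hom(K, P)), ses i p.
Proof.
by move=> hp sp; have [K [i [hi ii ki _]]] := ker_ex hp; exists K, i; split.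
Qed.

(** The pseudo-inverse [g^-1] is only a linear section of [g], but since [f] kills the kernel of
    [g], the composite [f \o g^-1] satisfies the required equation and is therefore a
    homomorphism. *)
Lemma fact_surj M N X (g : 'Hom(M, N)) (f : 'Hom(M, X)) :
  rhom g -> rhom f -> surj g -> (forall m, g m = 0 -> f m = 0) ->
  exists2 h : 'Hom(N, X), rhom h & forall m, h (g m) = f m.
Proof.
move=> hg hf sg kgf; pose h := (f \o g^-1)%VF.
have hE m : h (g m) = f m.
  rewrite comp_lfunE; apply/eqP; rewrite -subr_eq0 -linearB /=; apply/eqP/kgf.
  by rewrite linearB /= limg_lfunVK ?subrr // memv_img ?memvf.
by exists h => // y a; have [m <-] := sg y; rewrite -hg !hE hf.
Qed.

Lemma fact_inj K P X (i : 'Hom(K, P)) (f : 'Hom(X, P)) :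
  rhom i -> rhom f -> injective i -> (forall x, exists z, f x = i z) ->
  exists2 h : 'Hom(X, K), rhom h & forall x, i (h x) = f x.
Proof.
move=> hi hf ii fi; pose h := (i^-1 \o f)%VF.
have hE x : i (h x) = f x.
  by rewrite comp_lfunE limg_lfunVK //; have [z ->] := fi x; rewrite memv_img ?memvf.
by exists h => // x a; apply: ii; rewrite hi !hE hf.
Qed.

Lemma projP P M N (g : 'Hom(M, N)) (f : 'Hom(P, N)) :
  projective P -> rhom g -> surj g -> rhom f ->
  exists2 h : 'Hom(P, M), rhom h & forall x, g (h x) = f x.
Proof.
move=> hP hg sg hf; have [h hh ->] := hP _ _ g f hg ((limg_surj g).2 sg) hf.
by exists h => // x; rewrite comp_lfunE.
Qed.

Lemma projI P : (forall M N (g : 'Hom(M, N)) (f : 'Hom(P, N)),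
  rhom g -> surj g -> rhom f ->
  exists2 h : 'Hom(P, M), rhom h & forall x, g (h x) = f x) -> projective P.
Proof.
move=> H M N g f hg sg hf; have [h hh e] := H _ _ g f hg ((limg_surj g).1 sg) hf.
by exists h => //; apply/lfunP => x; rewrite comp_lfunE e.
Qed.

(** * Injective modules, direct summands and isomorphisms *)

Definition injmod (I : rmodule) := forall M N (i : 'Hom(M, N)) (f : 'Hom(M, I)),
  rhom i -> injective i -> rhom f ->
  exists2 h : 'Hom(N, I), rhom h & forall x, h (i x) = f x.

(** A direct summand up to isomorphism, without a chosen complement; [retract_split] supplies
    one. *)
Definition retract M N := exists (i : 'Hom(M, N)) (p : 'Hom(N, M)),
  [/\ rhom i, rhom p & forall x, p (i x) = x].

(* [M] is a direct summand of [N] in the stable category. *)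
Definition sretract M N := exists (i : 'Hom(M, N)) (p : 'Hom(N, M)) (R : rmodule)
  (s : 'Hom(M, R)) (t : 'Hom(R, M)), [/\ projective R, rhom i, rhom p & [/\ rhom s, rhom t
    & forall x, p (i x) + t (s x) = x]].

Lemma retract_refl M : retract M M.
Proof. by exists \1%VF, \1%VF; split=> [||x]; rewrite ?id_lfunE //; apply: rhom_id. Qed.

Lemma retract_trans M N X : retract M N -> retract N X -> retract M X.
Proof.
move=> [i [p [hi hp e]]] [i' [p' [hi' hp' e']]].
exists (i' \o i)%VF, (p \o p')%VF; split; try exact: rhom_comp.
by move=> x; rewrite !comp_lfunE e' e.
Qed.

Lemma riso_sym M N : riso M N -> riso N M.
Proof.
move=> [f [hf kf lf]]; have sf := (limg_surj f).1 lf; have jf := (lker_inj f).1 kf.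
have fV y : f (f^-1%VF y) = y by rewrite limg_lfunVK // lf memvf.
exists f^-1%VF; split.
- by move=> y a; apply: jf; rewrite hf !fV.
- by apply/lker_inj => x y e; rewrite -(fV x) e fV.
- by apply/limg_surj => x; exists (f x); apply: jf; rewrite fV.
Qed.

Lemma riso_inv M N : riso M N -> exists (f : 'Hom(M, N)) (g : 'Hom(N, M)),
  [/\ rhom f, rhom g, forall x, g (f x) = x & forall y, f (g y) = y].
Proof.
move=> [f [hf kf lf]]; have sf := (limg_surj f).1 lf; have jf := (lker_inj f).1 kf.
have fV y : f (f^-1%VF y) = y by rewrite limg_lfunVK // lf memvf.
exists f, f^-1%VF; split=> // [y a|x]; first by apply: jf; rewrite hf !fV.
by apply: jf; rewrite fV.
Qed.

Lemma risoI M N (f : 'Hom(M, N)) (g : 'Hom(N, M)) : rhom f ->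
  (forall x, g (f x) = x) -> (forall y, f (g y) = y) -> riso M N.
Proof.
move=> hf gf fg; exists f; split=> //.
  by apply/lker_inj => x y e; rewrite -(gf x) e gf.
by apply/limg_surj => y; exists (g y).
Qed.

Lemma riso_bij M N (f : 'Hom(M, N)) : rhom f -> injective f -> surj f -> riso M N.
Proof. by move=> hf /lker_inj kf /limg_surj sf; exists f. Qed.

Lemma riso_refl M : riso M M.
Proof. by apply: (@risoI _ _ \1%VF \1%VF); [exact: rhom_id|move=> x; rewrite !id_lfunE..]. Qed.

Lemma riso_trans M N X : riso M N -> riso N X -> riso M X.
Proof.
move=> /riso_inv[f [g [hf hg gf fg]]] /riso_inv[f' [g' [hf' hg' gf' fg']]].
apply: (@risoI _ _ (f' \o f)%VF (g \o g')%VF); first exact: rhom_comp.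
  by move=> x; rewrite !comp_lfunE gf' gf.
by move=> x; rewrite !comp_lfunE fg fg'.
Qed.

Lemma riso_retract M N : riso M N -> retract M N.
Proof. by move=> /riso_inv[f [g [hf hg gf fg]]]; exists f, g. Qed.

Lemma riso_dim M N : riso M N -> \dim {:M} = \dim {:N}.
Proof.
by move=> [f [_ kf lf]]; rewrite -lf limg_dim_eq // kf capv0.
Qed.

Lemma rnullP M : rnull M <-> forall x : M, x = 0.
Proof.
rewrite /rnull; split=> [/eqP|h].
  by rewrite dimv_eq0 => /eqP e x; apply/eqP; rewrite -memv0 -e memvf.
by apply/eqP; rewrite dimv_eq0 -subv0; apply/subvP => x _; rewrite (h x) mem0v.
Qed.

Lemma retract_proj M N : retract M N -> projective N -> projective M.
Proof.
move=> [i [p [hi hp e]]] hN; apply: projI => X Y g f hg sg hf.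
have [h hh eh] := projP hN hg sg (rhom_comp hf hp).
exists (h \o i)%VF => [|x]; first exact: rhom_comp.
by rewrite comp_lfunE eh comp_lfunE e.
Qed.

Lemma retract_injmod M N : retract M N -> injmod N -> injmod M.
Proof.
move=> [i [p [hi hp e]]] hN X Y j f hj ij hf.
have [h hh eh] := hN _ _ j (i \o f)%VF hj ij (rhom_comp hi hf).
exists (p \o h)%VF => [|x]; first exact: rhom_comp.
by rewrite comp_lfunE eh comp_lfunE e.
Qed.

Lemma rzero_eq0 (x : rzero A) : x = 0.
Proof. by apply/rowP => -[]. Qed.

Lemma proj_null P : rnull P -> projective P.
Proof.
move/rnullP => h; apply: projI => M N g f _ _ _; exists 0; first exact: rhom0.
by move=> x; rewrite (h x) !linear0.
Qed.

Lemma injmod_null P : rnull P -> injmod P.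
Proof.
move/rnullP => h M N g f _ _ _; exists 0; first exact: rhom0.
by move=> x; rewrite zero_lfunE [RHS]h.
Qed.

Lemma rnull_rzero : rnull (rzero A).
Proof. exact/rnullP/rzero_eq0. Qed.

Lemma retract_sretract M N : retract M N -> sretract M N.
Proof.
move=> [i [p [hi hp e]]]; exists i, p, (rzero A), 0, 0; split=> //.
  exact/proj_null/rnull_rzero.
by split=> [||x]; rewrite ?rhom0 ?e ?zero_lfunE ?addr0 //; apply: rhom0.
Qed.

(** * Direct sums of two modules *)

Section DirectSums.

Fact rin1_linear M N : linear (fun m : M => (m, 0) : rdsum M N).
Proof. by move=> c x y; congr (_, _); rewrite /= scaler0 addr0. Qed.
Fact rin2_linear M N : linear (fun m : N => (0, m) : rdsum M N).
Proof. by move=> c x y; congr (_, _); rewrite /= scaler0 addr0. Qed.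
Fact rpr1_linear M N : linear (fun m : rdsum M N => m.1).
Proof. by []. Qed.
Fact rpr2_linear M N : linear (fun m : rdsum M N => m.2).
Proof. by []. Qed.

Definition rin1 M N : 'Hom(M, rdsum M N) := sval (ex_lfun (@rin1_linear M N)).
Definition rin2 M N : 'Hom(N, rdsum M N) := sval (ex_lfun (@rin2_linear M N)).
Definition rpr1 M N : 'Hom(rdsum M N, M) := sval (ex_lfun (@rpr1_linear M N)).
Definition rpr2 M N : 'Hom(rdsum M N, N) := sval (ex_lfun (@rpr2_linear M N)).

Lemma rin1E M N x : rin1 M N x = (x, 0). Proof. exact: svalP (ex_lfun _) x. Qed.
Lemma rin2E M N x : rin2 M N x = (0, x). Proof. exact: svalP (ex_lfun _) x. Qed.
Lemma rpr1E M N x : rpr1 M N x = x.1. Proof. exact: svalP (ex_lfun _) x. Qed.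
Lemma rpr2E M N x : rpr2 M N x = x.2. Proof. exact: svalP (ex_lfun _) x. Qed.

Lemma rhom_in1 M N : rhom (rin1 M N).
Proof. by move=> m a; rewrite !rin1E; congr (_, _); rewrite /= act0. Qed.
Lemma rhom_in2 M N : rhom (rin2 M N).
Proof. by move=> m a; rewrite !rin2E; congr (_, _); rewrite /= act0. Qed.
Lemma rhom_pr1 M N : rhom (rpr1 M N).
Proof. by move=> m a; rewrite !rpr1E. Qed.
Lemma rhom_pr2 M N : rhom (rpr2 M N).
Proof. by move=> m a; rewrite !rpr2E. Qed.

Lemma retract_in1 M N : retract M (rdsum M N).
Proof.
exists (rin1 M N), (rpr1 M N); split; [exact: rhom_in1|exact: rhom_pr1|].
by move=> x; rewrite rin1E rpr1E.
Qed.

Lemma retract_in2 M N : retract N (rdsum M N).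
Proof.
exists (rin2 M N), (rpr2 M N); split; [exact: rhom_in2|exact: rhom_pr2|].
by move=> x; rewrite rin2E rpr2E.
Qed.

Definition rcopair M N X (f : 'Hom(M, X)) (g : 'Hom(N, X)) : 'Hom(rdsum M N, X) :=
  (f \o rpr1 M N)%VF + (g \o rpr2 M N)%VF.
Definition rpair M N X (f : 'Hom(X, M)) (g : 'Hom(X, N)) : 'Hom(X, rdsum M N) :=
  (rin1 M N \o f)%VF + (rin2 M N \o g)%VF.

Lemma rcopairE M N X (f : 'Hom(M, X)) (g : 'Hom(N, X)) x :
  rcopair f g x = f x.1 + g x.2.
Proof. by rewrite add_lfunE !comp_lfunE rpr1E rpr2E. Qed.

Lemma rpairE M N X (f : 'Hom(X, M)) (g : 'Hom(X, N)) x : rpair f g x = (f x, g x).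
Proof.
rewrite add_lfunE !comp_lfunE rin1E rin2E.
by congr (_, _); rewrite /= ?addr0 ?add0r.
Qed.

Lemma rhom_copair M N X (f : 'Hom(M, X)) (g : 'Hom(N, X)) :
  rhom f -> rhom g -> rhom (rcopair f g).
Proof.
by move=> hf hg; apply: rhomD; apply: rhom_comp => //; [exact: rhom_pr1|exact: rhom_pr2].
Qed.

Lemma rhom_pair M N X (f : 'Hom(X, M)) (g : 'Hom(X, N)) :
  rhom f -> rhom g -> rhom (rpair f g).
Proof.
by move=> hf hg; apply: rhomD; apply: rhom_comp => //; [exact: rhom_in1|exact: rhom_in2].
Qed.

Lemma pair_addE M N (x y : rdsum M N) : x + y = (x.1 + y.1, x.2 + y.2).
Proof. by []. Qed.

Lemma proj_rdsum P Q : projective P -> projective Q -> projective (rdsum P Q).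
Proof.
move=> hP hQ; apply: projI => M N g f hg sg hf.
have [h1 hh1 e1] := projP hP hg sg (rhom_comp hf (@rhom_in1 P Q)).
have [h2 hh2 e2] := projP hQ hg sg (rhom_comp hf (@rhom_in2 P Q)).
exists (rcopair h1 h2) => [|[x y]]; first exact: rhom_copair.
rewrite rcopairE linearD /= e1 e2 !comp_lfunE -linearD /= rin1E rin2E pair_addE /=.
by rewrite addr0 add0r.
Qed.

Lemma injmod_rdsum P Q : injmod P -> injmod Q -> injmod (rdsum P Q).
Proof.
move=> hP hQ M N g f hg sg hf.
have [h1 hh1 e1] := hP _ _ _ _ hg sg (rhom_comp (@rhom_pr1 P Q) hf).
have [h2 hh2 e2] := hQ _ _ _ _ hg sg (rhom_comp (@rhom_pr2 P Q) hf).
exists (rpair h1 h2) => [|x]; first exact: rhom_pair.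
by rewrite rpairE e1 e2 !comp_lfunE rpr1E rpr2E -surjective_pairing.
Qed.

Lemma retract_rdsum M N M' N' : retract M M' -> retract N N' ->
  retract (rdsum M N) (rdsum M' N').
Proof.
move=> [i [p [hi hp e]]] [i' [p' [hi' hp' e']]].
exists (rpair (i \o rpr1 M N) (i' \o rpr2 M N))%VF,
  (rpair (p \o rpr1 M' N') (p' \o rpr2 M' N'))%VF; split.
- by apply: rhom_pair; apply: rhom_comp => //; [exact: rhom_pr1|exact: rhom_pr2].
- by apply: rhom_pair; apply: rhom_comp => //; [exact: rhom_pr1|exact: rhom_pr2].
- by case=> x y; rewrite !rpairE !comp_lfunE !rpr1E !rpr2E /= e e'.
Qed.

End DirectSums.

(** The complement is the kernel of [p], through [x = i (p x) + (x - i (p x))]. *)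
Lemma retract_split M X (i : 'Hom(M, X)) (p : 'Hom(X, M)) :
  rhom i -> rhom p -> (forall x, p (i x) = x) ->
  exists (K : rmodule) (j : 'Hom(K, X)), [/\ rhom j,
    riso (rdsum M K) X & rnull K -> surj i].
Proof.
move=> hi hp e; have [K [j [hj jj kj _]]] := ker_ex hp.
have pj x : p (j x) = 0 by apply/kj; exists x.
exists K, j; split=> //.
  apply: (@riso_bij _ _ (rcopair i j)); first exact: rhom_copair.
    apply: injP0 => -[x y]; rewrite rcopairE /= => e0.
    have x0 : x = 0 by have := congr1 p e0; rewrite linearD /= e pj addr0 linear0.
    have y0 : y = 0 by apply: jj; rewrite linear0; move: e0; rewrite x0 linear0 add0r.
    by rewrite x0 y0.
  move=> x; have /kj[z ez] : p (x - i (p x)) = 0 by rewrite linearB /= e subrr.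
  by exists (p x, z); rewrite rcopairE /= -ez addrC subrK.
move=> /rnullP K0 x; have /kj[z ez] : p (x - i (p x)) = 0 by rewrite linearB /= e subrr.
by exists (p x); apply/esym/subr0_eq; rewrite ez (K0 z) linear0.
Qed.

Lemma retract_indecomposable M X : indecomposable X -> retract M X -> ~ rnull M ->
  riso M X.
Proof.
move=> [_ iX] [i [p [hi hp e]]] nM.
have [K [j [hj rX nK]]] := retract_split hi hp e.
have [//|/nK si] := iX _ _ (riso_sym rX).
by apply: (riso_bij hi) => // x y exy; rewrite -(e x) exy e.
Qed.

(** * Covers, enough projectives and split sequences *)

(** One summand from [C] for each vector of a basis of [X] is enough. *)
Lemma cover_ex (C : rmodule -> Prop) X : C (rzero A) ->
  (forall M N, C M -> C N -> C (rdsum M N)) ->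
  (forall x : X, exists (G : rmodule) (f : 'Hom(G, X)) (y : G),
     [/\ C G, rhom f & f y = x]) ->
  exists (F : rmodule) (f : 'Hom(F, X)), [/\ C F, rhom f & surj f].
Proof.
move=> C0 CD gen.
have H (s : seq X) : exists (F : rmodule) (f : 'Hom(F, X)),
    [/\ C F, rhom f & {subset s <= limg f}].
  elim: s => [|x s [F [f [CF hf sf]]]].
    by exists (rzero A), 0; split=> //; exact: rhom0.
  have [G [g [y [CG hg gy]]]] := gen x.
  exists (rdsum G F), (rcopair g f); split; [exact: CD|exact: rhom_copair|].
  move=> z; rewrite inE => /predU1P[->|/sf/memv_imgP[w _ ->]].
    have <- : rcopair g f (y, 0) = x by rewrite rcopairE linear0 addr0.
    by rewrite memv_img ?memvf.
  have <- : rcopair g f (0, w) = f w by rewrite rcopairE linear0 add0r.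
  by rewrite memv_img ?memvf.
have [F [f [CF hf sf]]] := H (vbasis fullv).
exists F, f; split=> //; apply/limg_surj/eqP; rewrite eqEsubv subvf /=.
by rewrite -{1}(span_basis (vbasisP {:X})); apply/span_subvP.
Qed.

Lemma rhom_gen X (x : X) : exists2 f : 'Hom(regular A, X), rhom f & forall b, f b = act x b.
Proof.
have lf : linear (fun b : regular A => act x b) by move=> c a b; exact: act_linearr.
have [f fE] := ex_lfun lf; exists f => // b a; rewrite !fE -actM //.
Qed.

Lemma proj_regular : projective (regular A).
Proof.
apply: projI => M N g f hg sg hf.
have [m em] := sg (f (1 : A)); have [h hh hE] := rhom_gen m.
by exists h => // x; rewrite hE hg em -hf /= mul1r.
Qed.

Lemma enough_proj X : exists (F : rmodule) (f : 'Hom(F, X)),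
  [/\ projective F, rhom f & surj f].
Proof.
apply: cover_ex => [|M N|x]; first exact/proj_null/rnull_rzero.
  exact: proj_rdsum.
have [f hf fE] := rhom_gen x; exists (regular A), f, 1; split=> //.
  exact: proj_regular.
by rewrite fE act1.
Qed.

Lemma enough_proj_ses X : exists (K F : rmodule) (i : 'Hom(K, F)) (p : 'Hom(F, X)),
  projective F /\ ses i p.
Proof.
have [F [p [pF hp sp]]] := enough_proj X; have [K [i s]] := ker_ses hp sp.
by exists K, F, i, p.
Qed.

Lemma injmod_retract I N (i : 'Hom(I, N)) : rhom i -> injective i -> injmod I -> retract I N.
Proof.
move=> hi ii iI; have [r hr rE] := iI _ _ i \1%VF hi ii (@rhom_id I).
by exists i, r; split=> // x; rewrite rE id_lfunE.
Qed.

Lemma injmod_ses_split K P M (i : 'Hom(K, P)) (p : 'Hom(P, M)) :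
  ses i p -> injmod K -> retract M P /\ retract K P.
Proof.
move=> s iK; have [hi hp ii sp ex] := s.
have [r hr er] := iK _ _ i \1%VF hi ii (@rhom_id K).
have er' x : r (i x) = x by rewrite er id_lfunE.
have hq : rhom (\1 - (i \o r))%VF by apply: rhomB; [exact: rhom_id|exact: rhom_comp].
have [h hh hE] : exists2 h : 'Hom(M, P), rhom h & forall x, h (p x) = (\1 - (i \o r))%VF x.
  apply: fact_surj => // m /ex[x ->].
  by rewrite add_lfunE opp_lfunE id_lfunE comp_lfunE er' subrr.
split; last by exists i, r.
exists h, p; split=> // x; have [y <-] := sp x.
rewrite hE add_lfunE opp_lfunE id_lfunE comp_lfunE linearB /= (ses_comp0 _ s).
by rewrite subr0.
Qed.

Lemma proj_ses_split K P M (i : 'Hom(K, P)) (p : 'Hom(P, M)) :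
  ses i p -> projective M -> retract M P /\ retract K P.
Proof.
move=> s pM; have [hi hp ii sp ex] := s.
have [h hh hE] := projP pM hp sp (@rhom_id M).
have hE' x : p (h x) = x by rewrite hE id_lfunE.
have hq : rhom (\1 - (h \o p))%VF by apply: rhomB; [exact: rhom_id|exact: rhom_comp].
have [r hr rE] : exists2 r : 'Hom(P, K), rhom r & forall x, i (r x) = (\1 - (h \o p))%VF x.
  apply: fact_inj => // x; have /ex[z ->] : p ((\1 - (h \o p))%VF x) = 0.
    by rewrite add_lfunE opp_lfunE id_lfunE comp_lfunE linearB /= hE' subrr.
  by exists z.
split; first by exists h, p.
exists i, r; split=> // x; apply: ii; rewrite rE.
by rewrite add_lfunE opp_lfunE id_lfunE comp_lfunE (ses_comp0 _ s) linear0 subr0.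
Qed.

(** * Ext and projective dimension through syzygies *)

(** The property is required of the [j]-th syzygies for all choices of presentations. If [F] passes
    to stable summands, one choice at each stage suffices ([syzallS]). *)
Fixpoint syzall (F : rmodule -> Prop) (j : nat) M : Prop :=
  if j is j'.+1 then forall K P (i : 'Hom(K, P)) (p : 'Hom(P, M)),
    projective P -> ses i p -> syzall F j' K
  else F M.

(** Vanishing of Ext^1(M, N), with [N] first so that [ext1_eq0 N] is a property of [M] to which
    [syzall] applies. *)
Definition ext1_eq0 N M : Prop := forall K P (i : 'Hom(K, P)) (p : 'Hom(P, M)),
  projective P -> ses i p -> forall g : 'Hom(K, N), rhom g ->
  exists2 h : 'Hom(P, N), rhom h & forall x, h (i x) = g x.

(* [ext_eq0 j M N] states that Ext^{j+1}(M, N) = 0, independently of the choice *)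
(* of a resolution.                                                             *)
Definition ext_eq0 j M N := syzall (ext1_eq0 N) j M.

Definition pd_le r M := syzall (@projective k A) r M.

(* Schanuel's lemma for stable summands. *)
Lemma sretract_syz M M' K K' P P' (i : 'Hom(K, P)) (p : 'Hom(P, M))
    (i' : 'Hom(K', P')) (p' : 'Hom(P', M')) :
  projective P -> projective P' -> ses i p -> ses i' p' -> sretract M' M ->
  exists (u : 'Hom(K', K)) (v : 'Hom(K, K')) (w : 'Hom(P', K')) (u' : 'Hom(P', P)),
    [/\ rhom u, rhom v, rhom w & [/\ rhom u', forall x, i (u x) = u' (i' x)
     & forall x, v (u x) + w (i' x) = x]].
Proof.
move=> hP hP' s s' [u0 [v0 [R [s0 [t0 [hR hu0 hv0 [hs0 ht0 e0]]]]]]].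
have [hi hp ii sp ex] := s; have [hi' hp' ii' sp' ex'] := s'.
have [u' hu' u'E] := projP hP' hp sp (rhom_comp hu0 hp').
have [v' hv' v'E] := projP hP hp' sp' (rhom_comp hv0 hp).
have [t' ht' t'E] := projP hR hp' sp' ht0.
have [u hu uE] : exists2 u : 'Hom(K', K), rhom u & forall x, i (u x) = (u' \o i')%VF x.
  apply: fact_inj => // [|x]; first exact: rhom_comp.
  have /ex[z ez] : p (u' (i' x)) = 0 by rewrite u'E comp_lfunE (ses_comp0 _ s') linear0.
  by exists z; rewrite comp_lfunE.
have [v hv vE] : exists2 v : 'Hom(K, K'), rhom v & forall x, i' (v x) = (v' \o i)%VF x.
  apply: fact_inj => // [|x]; first exact: rhom_comp.
  have /ex'[z ez] : p' (v' (i x)) = 0 by rewrite v'E comp_lfunE (ses_comp0 _ s) linear0.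
  by exists z; rewrite comp_lfunE.
(* The map [q] lands in the kernel of [p']: there the two subtracted terms become [v0 u0 p'] and
   [t0 s0 p'], which add up to [p'] by [e0]. *)
pose q := (\1 - (v' \o u') - (t' \o (s0 \o p')))%VF : 'Hom(P', P').
have qE x : q x = x - v' (u' x) - t' (s0 (p' x)).
  by rewrite !(add_lfunE, opp_lfunE) id_lfunE !comp_lfunE.
have hq : rhom q.
  apply: rhomB; last by do 2![apply: rhom_comp => //].
  by apply: rhomB; [exact: rhom_id|exact: rhom_comp].
have [w hw wE] : exists2 w : 'Hom(P', K'), rhom w & forall x, i' (w x) = q x.
  apply: fact_inj => // x.
  have /ex'[z ez] : p' (q x) = 0.
    rewrite qE !linearB /= v'E t'E !comp_lfunE u'E comp_lfunE.
    by rewrite -{1}(e0 (p' x)) addrAC addrK subrr.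
  by exists z.
exists u, v, w, u'; split=> //; split=> // x; first by rewrite uE comp_lfunE.
apply: ii'; rewrite linearD /= wE qE (ses_comp0 _ s') !linear0 addr0.
by rewrite vE comp_lfunE uE comp_lfunE addrC subrK.
Qed.

Lemma syz_sretract M M' K K' P P' (i : 'Hom(K, P)) (p : 'Hom(P, M))
    (i' : 'Hom(K', P')) (p' : 'Hom(P', M')) :
  projective P -> projective P' -> ses i p -> ses i' p' ->
  sretract M' M -> sretract K' K.
Proof.
move=> hP hP' s s' r.
have [u [v [w [u' [hu hv hw [_ _ e]]]]]] := sretract_syz hP hP' s s' r.
by exists u, v, P', i', w; split=> //; have [hi' _ _ _ _] := s'; split.
Qed.

Definition stable_closed (F : rmodule -> Prop) :=
  forall M M', sretract M' M -> F M -> F M'.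

Lemma syzall_stable F j : stable_closed F -> stable_closed (syzall F j).
Proof.
move=> hF; elim: j => // j IH M M' r h K' P' i' p' hP' s'.
have [K [P [i [p [hP s]]]]] := enough_proj_ses M.
exact: IH (syz_sretract hP hP' s s' r) (h _ _ _ _ hP s).
Qed.

Lemma syzallS F j K P M (i : 'Hom(K, P)) (p : 'Hom(P, M)) :
  stable_closed F -> projective P -> ses i p -> syzall F j K -> syzall F j.+1 M.
Proof.
move=> hF hP s h K' P' i' p' hP' s'.
apply: syzall_stable (hF) _ _ (syz_sretract hP hP' s s' _) h.
exact/retract_sretract/retract_refl.
Qed.

Lemma stable_proj : stable_closed (@projective k A).
Proof.
move=> M M' [u [v [R [s [t [hR hu hv [hs ht e]]]]]]] hM.
apply: (@retract_proj _ (rdsum M R)); last exact: proj_rdsum.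
exists (rpair u s), (rcopair v t); split; [exact: rhom_pair|exact: rhom_copair|].
by move=> x; rewrite rcopairE rpairE /= e.
Qed.

(** From [v u + w i' = 1] on [K'] one gets [g = (g v) u + (g w) i']. The second term visibly extends
    to [P']; the first does because [g v] extends to [P] and [i u = u' i']. *)
Lemma stable_ext1 N : stable_closed (ext1_eq0 N).
Proof.
move=> M M' r h K' P' i' p' hP' s' g hg.
have [K [P [i [p [hP s]]]]] := enough_proj_ses M.
have [u [v [w [u' [hu hv hw [hu' uE e]]]]]] := sretract_syz hP hP' s s' r.
have [h1 hh1 h1E] := h _ _ i p hP s (g \o v)%VF (rhom_comp hg hv).
exists ((h1 \o u') + (g \o w))%VF => [|x].
  by apply: rhomD; apply: rhom_comp.
by rewrite add_lfunE !comp_lfunE -uE h1E comp_lfunE -linearD /= e.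
Qed.

Lemma ext_eq0_stable j N : stable_closed (fun M => ext_eq0 j M N).
Proof. exact/syzall_stable/stable_ext1. Qed.

Lemma pd_le_stable r : stable_closed (pd_le r).
Proof. exact/syzall_stable/stable_proj. Qed.

Lemma ext_eq0_syz j K P M N (i : 'Hom(K, P)) (p : 'Hom(P, M)) :
  projective P -> ses i p -> ext_eq0 j.+1 M N <-> ext_eq0 j K N.
Proof.
move=> hP s; split=> [h|]; first exact: h hP s.
exact: syzallS (@stable_ext1 N) hP s.
Qed.

Lemma syzall_impl (F G : rmodule -> Prop) j M :
  (forall K, F K -> G K) -> syzall F j M -> syzall G j M.
Proof.
move=> FG; elim: j M => [|j IH] M; first exact: FG.
by move=> h K P i p hP s; apply/IH/(h _ _ _ _ hP s).
Qed.

Lemma ext_eq0_retractr j M N N' : retract N' N -> ext_eq0 j M N -> ext_eq0 j M N'.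
Proof.
move=> [a [b [ha hb e]]]; apply: syzall_impl => L h K P i p hP s g hg.
have [h1 hh1 h1E] := h _ _ i p hP s (a \o g)%VF (rhom_comp ha hg).
exists (b \o h1)%VF => [|x]; first exact: rhom_comp.
by rewrite comp_lfunE h1E comp_lfunE e.
Qed.

Lemma ext_eq0_retractl j M M' N : retract M' M -> ext_eq0 j M N -> ext_eq0 j M' N.
Proof. by move=> /retract_sretract; apply: ext_eq0_stable. Qed.

Lemma ext_eq0_inj j M N : injmod N -> ext_eq0 j M N.
Proof.
move=> iN; elim: j M => [|j IH] M K P i p hP s; last exact: IH.
by move=> g hg; have [hi _ ii _ _] := s; have [h hh e] := iN _ _ i g hi ii hg; exists h.
Qed.

Lemma ext_eq0_proj j M N : projective M -> ext_eq0 j M N.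
Proof.
move=> hM; elim: j M hM => [|j IH] M hM K P i p hP s.
  have [_ [i' [r [_ hr e]]]] := proj_ses_split s hM.
  move=> g hg; have [hi hp ii sp ex] := s.
  have [h hh hE] := projP hM hp sp (@rhom_id M).
  have [q hq qE] : exists2 q : 'Hom(P, K), rhom q & forall x, i (q x) = (\1 - (h \o p))%VF x.
    apply: fact_inj => //.
      by apply: rhomB; [exact: rhom_id|exact: rhom_comp].
    move=> x; apply/ex.
    by rewrite add_lfunE opp_lfunE id_lfunE comp_lfunE linearB /= hE id_lfunE subrr.
  exists (g \o q)%VF => [|x]; first exact: rhom_comp.
  rewrite comp_lfunE; congr (g _); apply: ii; rewrite qE.
  by rewrite add_lfunE opp_lfunE id_lfunE comp_lfunE (ses_comp0 _ s) linear0 subr0.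
by apply: IH; have [_ r] := proj_ses_split s hM; apply: retract_proj r hP.
Qed.

Lemma ext_eq0_rdsumr j M N N' : ext_eq0 j M N -> ext_eq0 j M N' -> ext_eq0 j M (rdsum N N').
Proof.
elim: j M => [|j IH] M h h' K P i p hP s; last first.
  exact: (IH _ (h _ _ _ _ hP s) (h' _ _ _ _ hP s)).
move=> g hg.
have [a ha aE] := h _ _ i p hP s _ (rhom_comp (@rhom_pr1 N N') hg).
have [b hb bE] := h' _ _ i p hP s _ (rhom_comp (@rhom_pr2 N N') hg).
exists (rpair a b) => [|x]; first exact: rhom_pair.
by rewrite rpairE aE bE !comp_lfunE rpr1E rpr2E -surjective_pairing.
Qed.

(* Dimension shift in the second argument along [0 -> N -> J -> N' -> 0] with [J] *)
(* injective; in degree one both sides say that maps from the syzygy of [M] to    *)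
(* [N'] lift to [J].                                                              *)
Lemma ext_eq0_cosyz j M N J N' (i : 'Hom(N, J)) (p : 'Hom(J, N')) :
  injmod J -> ses i p -> ext_eq0 j.+1 M N <-> ext_eq0 j M N'.
Proof.
move=> iJ s; elim: j M => [|j IH] M; last first.
  by split=> h K P i' p' hP s'; apply/IH; apply: h hP s'.
have [hi hp ii sp ex] := s; split=> h K P i1 p1 hP s1.
  have [hi1 hp1 ii1 sp1 ex1] := s1 => g hg.
  have [K2 [P2 [i2 [p2 [hP2 s2]]]]] := enough_proj_ses K.
  have [hi2 hp2 ii2 sp2 ex2] := s2.
  have [g1 hg1 g1E] := projP hP2 hp sp (rhom_comp hg hp2).
  have [g2 hg2 g2E] : exists2 u : 'Hom(K2, N), rhom u & forall x, i (u x) = (g1 \o i2)%VF x.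
    apply: fact_inj => // [|x]; first exact: rhom_comp.
    by apply/ex; rewrite comp_lfunE g1E comp_lfunE (ses_comp0 _ s2) linear0.
  have [g3 hg3 g3E] := h _ _ _ _ hP s1 _ _ _ _ hP2 s2 g2 hg2.
  have [l hl lE] : exists2 u : 'Hom(K, J), rhom u & forall x, u (p2 x) = (g1 - (i \o g3))%VF x.
    apply: fact_surj => // [|m /ex2[x ->]].
      by apply: rhomB => //; apply: rhom_comp.
    by rewrite add_lfunE opp_lfunE comp_lfunE g3E g2E comp_lfunE subrr.
  have [l' hl' l'E] := iJ _ _ i1 l hi1 ii1 hl.
  exists (p \o l')%VF => [|x]; first exact: rhom_comp.
  rewrite comp_lfunE l'E; have [y <-] := sp2 x.
  rewrite lE add_lfunE opp_lfunE comp_lfunE linearB /= g1E comp_lfunE.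
  by rewrite (ses_comp0 _ s) subr0.
move=> K2 P2 i2 p2 hP2 s2 g hg.
have [hi2 hp2 ii2 sp2 ex2] := s2.
have [g1 hg1 g1E] := iJ _ _ i2 (i \o g)%VF hi2 ii2 (rhom_comp hi hg).
have [g2 hg2 g2E] : exists2 u : 'Hom(K, N'), rhom u & forall x, u (p2 x) = (p \o g1)%VF x.
  apply: fact_surj => // [|m /ex2[x ->]]; first exact: rhom_comp.
  by rewrite comp_lfunE g1E comp_lfunE (ses_comp0 _ s).
have [g3 hg3 g3E] := h _ _ _ _ hP s1 g2 hg2.
have [g4 hg4 g4E] := projP hP hp sp hg3.
have [hi1 _ _ _ _] := s1.
have [r hr rE] : exists2 u : 'Hom(P2, N), rhom u
    & forall x, i (u x) = (g1 - (g4 \o (i1 \o p2)))%VF x.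
  apply: fact_inj => // [|x].
    by apply: rhomB => //; do 2![apply: rhom_comp => //].
  apply/ex; rewrite add_lfunE opp_lfunE !comp_lfunE linearB /= g4E g3E g2E.
  by rewrite comp_lfunE subrr.
exists r => // x; apply: ii; rewrite rE add_lfunE opp_lfunE !comp_lfunE.
by rewrite (ses_comp0 _ s2) !linear0 addr0 g1E comp_lfunE.
Qed.

(** * Resolutions and coresolutions *)

Section Resolutions.
Variables (P : nat -> rmodule) (d : forall i, 'Hom(P i.+1, P i)) (M : rmodule)
  (aug : 'Hom(P 0%N, M)).
Hypothesis res : projective_resolution d aug.

Lemma resolution_tail K (i : 'Hom(K, P 0%N)) : ses i aug ->
  exists2 aug' : 'Hom(P 1%N, K), forall x, i (aug' x) = d 0%N x &
    @projective_resolution k A K (fun j => P j.+1) (fun j => d j.+1) aug'.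
Proof.
move=> s; have [hP hd ha [sa e0 e]] := res; have [hi _ ii _ ex] := s.
have [aug' ha' aE] : exists2 u : 'Hom(P 1%N, K), rhom u & forall x, i (u x) = d 0%N x.
  by apply: fact_inj => // x; apply/ex/((limg_lkerP _ _).1 e0); exists x.
exists aug' => //; split=> //; split=> //.
  apply/limg_surj => y.
  have /((limg_lkerP _ _).1 e0)[x ex0] : aug (i y) = 0 by exact: ses_comp0 s.
  by exists x; apply: ii; rewrite aE.
apply/limg_lkerP => y; split=> [y0|/((limg_lkerP _ _).1 (e 0%N)) y0].
  by apply/((limg_lkerP _ _).1 (e 0%N)); rewrite -aE y0 linear0.
by apply: ii; rewrite aE y0 linear0.
Qed.

Lemma resolution_ses : exists K (i : 'Hom(K, P 0%N)), ses i aug.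
Proof. by have [_ _ ha [sa _ _]] := res; apply: ker_ses ha ((limg_surj _).1 sa). Qed.

End Resolutions.

(** Links Ext computed from a given resolution to [ext_eq0]. In degree one, a cocycle on [P 1] is
    the same as a map from the first syzygy; higher degrees follow by truncating the resolution. *)
Lemma resolution_ext M N (P : nat -> rmodule) (d : forall i, 'Hom(P i.+1, P i))
    (aug : 'Hom(P 0%N, M)) j : projective_resolution d aug ->
  (forall f : 'Hom(P j.+1, N), rhom f -> (f \o d j.+1)%VF = 0 ->
    exists2 g : 'Hom(P j, N), rhom g & f = (g \o d j)%VF) <-> ext_eq0 j M N.
Proof.
elim: j M P d aug => [|j IH] M P d aug res; have [K [i s]] := resolution_ses res;
  have [aug' aE res'] := resolution_tail res s; have [hP hd ha [sa e0 e]] := res;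
  have [hP' hd' ha' [sa' e0' e']] := res'.
  have [hi _ ii _ ex] := s.
  have sa1 := (limg_surj _).1 sa'.
  split=> [H|H f hf fd].
    suff E : forall g : 'Hom(K, N), rhom g -> exists2 h : 'Hom(P 0%N, N),
        rhom h & forall x, h (i x) = g x.
      move=> K2 P2 i2 p2 hP2 s2 g hg.
      have [u [v [w [u' [hu hv hw [hu' uE e2]]]]]] :=
        sretract_syz (hP 0%N) hP2 s s2 (retract_sretract (retract_refl M)).
      have [h1 hh1 h1E] := E (g \o v)%VF (rhom_comp hg hv).
      exists ((h1 \o u') + (g \o w))%VF => [|x].
        by apply: rhomD; apply: rhom_comp.
      by rewrite add_lfunE !comp_lfunE -uE h1E comp_lfunE -linearD /= e2.
    move=> g hg; have [] := H (g \o aug')%VF (rhom_comp hg ha').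
      apply/lfunP => x; rewrite zero_lfunE !comp_lfunE.
      have -> : aug' (d 1%N x) = 0 by apply/((limg_lkerP _ _).1 e0'); exists x.
      by rewrite linear0.
    move=> h hh hE; exists h => // x; have [y <-] := sa1 x.
    by rewrite aE -comp_lfunE -hE comp_lfunE.
  have [g hg gE] : exists2 u : 'Hom(K, N), rhom u & forall x, u (aug' x) = f x.
    apply: fact_surj => // m /((limg_lkerP _ _).1 e0')[x ->].
    by rewrite -comp_lfunE fd zero_lfunE.
  have [h hh hE] := H _ _ _ _ (hP 0%N) s g hg.
  by exists h => //; apply/lfunP => x; rewrite comp_lfunE -aE hE gE.
exact: iff_trans (IH _ _ _ _ res') (iff_sym (ext_eq0_syz _ _ (hP 0%N) s)).
Qed.

Lemma resolution_pd M (P : nat -> rmodule) (d : forall i, 'Hom(P i.+1, P i))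
    (aug : 'Hom(P 0%N, M)) r : projective_resolution d aug ->
  (forall i, (r < i)%N -> rnull (P i)) -> pd_le r M.
Proof.
elim: r M P d aug => [|r IH] M P d aug res nP; have [K [i s]] := resolution_ses res;
  have [aug' aE res'] := resolution_tail res s; have [hP hd ha [sa e0 e]] := res.
  have /rnullP n1 := nP 1%N isT.
  have ia : injective aug.
    by apply: injP0 => x /((limg_lkerP _ _).1 e0)[y ->]; rewrite (n1 y) linear0.
  apply: retract_proj (hP 0%N); apply/riso_retract/riso_sym/(riso_bij ha ia).
  exact/limg_surj.
apply: syzallS (hP 0%N) s _; first exact: stable_proj.
by apply: IH res' _ => j jr; apply: nP.
Qed.

Lemma finite_projdim_pd M : finite_projdim M -> exists r, pd_le r M.
Proof. by move=> [P [d [aug [r [res nP]]]]]; exists r; apply: resolution_pd res nP. Qed.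

Lemma finite_projdim_proj M : projective M -> finite_projdim M.
Proof.
move=> hM; pose P n := if n is _.+1 then rzero A else M.
exists P, (fun i => 0), \1%VF, 0%N; split; last by case=> // i _; exact: rnull_rzero.
split; [|by move=> i; exact: rhom0|exact: rhom_id|].
  by case=> // i; exact/proj_null/rnull_rzero.
split.
- by apply/limg_surj => x; exists x; rewrite id_lfunE.
- apply/limg_lkerP => x; rewrite id_lfunE; split=> [->|[y ->]].
    by exists 0; rewrite zero_lfunE.
  by rewrite zero_lfunE.
- move=> i; apply/limg_lkerP => x; split=> [_|_]; last by rewrite zero_lfunE.
  by exists 0; rewrite linear0 (rzero_eq0 x).
Qed.

Lemma finite_projdim_ses K P M (i : 'Hom(K, P)) (p : 'Hom(P, M)) :
  projective P -> ses i p -> finite_projdim K -> finite_projdim M.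
Proof.
move=> hP s [P' [d' [aug' [r [[pP' hd' ha' [sa e0 e]] nP']]]]].
have [hi hp ii sp ex] := s.
pose P2 n := if n is n'.+1 then P' n' else P.
pose d2 j : 'Hom(P2 j.+1, P2 j) :=
  match j return 'Hom(P2 j.+1, P2 j) with 0%N => (i \o aug')%VF | j'.+1 => d' j' end.
exists P2, d2, p, r.+1; split; last by case=> // j; exact: nP'.
split=> //; first by case.
  by case=> [|j]; [exact: rhom_comp | exact: hd'].
split; first exact/limg_surj.
  apply/limg_lkerP => y; rewrite ex; split=> [[x ->]|[x ->]].
    by have [z <-] := (limg_surj _).1 sa x; exists z; rewrite comp_lfunE.
  by exists (aug' x); rewrite comp_lfunE.
case=> [|j]; last exact: e.
apply/limg_lkerP => y; rewrite comp_lfunE -((limg_lkerP _ _).1 e0).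
by split=> [y0|->]; [apply: ii; rewrite y0|]; rewrite linear0.
Qed.

Lemma coresolution_riso T M M' : riso M M' ->
  finite_add_coresolution T M' -> finite_add_coresolution T M.
Proof.
move=> /riso_inv[f [g [hf hg gf fg]]] [C [d [c [r [h1 h2 h3 h4 [h5 h6 h7]]]]]].
exists C, d, (c \o f)%VF, r; split=> //; first exact: rhom_comp.
split=> //.
  apply/lker_inj => x y; rewrite !comp_lfunE => /((lker_inj _).1 h5) e.
  by rewrite -(gf x) e gf.
apply/limg_lkerP => y; rewrite ((limg_lkerP _ _).1 h6).
split=> -[x ->]; [exists (g x)|exists (f x)]; by rewrite comp_lfunE ?fg.
Qed.

Lemma coresolution_in_add T M : in_add T M -> finite_add_coresolution T M.
Proof.
move=> hM; pose C n := if n is _.+1 then rzero A else M.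
exists C, (fun i => 0), \1%VF, 0%N; split.
- by case.
- by case=> // i _; exact: rnull_rzero.
- by move=> i; exact: rhom0.
- exact: rhom_id.
split.
- by apply/lker_inj => x y; rewrite !id_lfunE.
- apply/limg_lkerP => y; rewrite zero_lfunE; split=> // _.
  by exists y; rewrite id_lfunE.
- move=> i; apply/limg_lkerP => y; split=> _; last by rewrite zero_lfunE.
  by exists 0; rewrite linear0 (rzero_eq0 y).
Qed.

Lemma coresolution_ses T M (C : rmodule) N (i : 'Hom(M, C)) (p : 'Hom(C, N)) :
  ses i p -> in_add T C -> finite_add_coresolution T N -> finite_add_coresolution T M.
Proof.
move=> [hi hp ii sp ex] hC [C' [d' [c' [r [h1 h2 h3 h4 [h5 h6 h7]]]]]].
pose C2 n := if n is n'.+1 then C' n' else C.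
pose d2 j : 'Hom(C2 j, C2 j.+1) :=
  match j return 'Hom(C2 j, C2 j.+1) with 0%N => (c' \o p)%VF | j'.+1 => d' j' end.
exists C2, d2, i, r.+1; split=> //.
- by case=> // j; exact: h1.
- by case=> // j; exact: h2.
- by case=> [|j]; [exact: rhom_comp|exact: h3].
split; first exact/lker_inj.
  apply/limg_lkerP => y; rewrite -ex comp_lfunE; split=> [y0|->]; last exact: linear0.
  by apply: ((lker_inj _).1 h5); rewrite y0 linear0.
case=> [|j]; last exact: h7.
apply/limg_lkerP => y; rewrite ((limg_lkerP _ _).1 h6).
split=> -[x ->]; last by exists (p x); rewrite comp_lfunE.
by have [z <-] := sp x; exists z; rewrite comp_lfunE.
Qed.

(** The sequence splits starting from its right end: by induction the image of [d 0] is a summand of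
    the projective [C 1], so the map from [C 0] onto it splits. *)
Lemma coresolution_split r M (C : nat -> rmodule) (d : forall i, 'Hom(C i, C i.+1))
    (c : 'Hom(M, C 0%N)) :
  (forall i, projective (C i)) -> (forall i, (r < i)%N -> rnull (C i)) ->
  (forall i, rhom (d i)) -> rhom c -> lker c = 0%VS -> limg c = lker (d 0%N) ->
  (forall i, limg (d i) = lker (d i.+1)) -> retract M (C 0%N).
Proof.
elim: r M C d c => [|r IH] M C d c pC nC hd hc kc e0 e.
  apply/riso_retract/(riso_bij hc); first exact/lker_inj.
  move=> y; have /((limg_lkerP _ _).1 e0)[x ->] : d 0%N y = 0.
    by rewrite [LHS]((rnullP _).1 (nC 1%N isT)).
  by exists x.
have [K [i [hi ii ki _]]] := ker_ex (hd 1%N).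
have [q hq qE] : exists2 u : 'Hom(C 0%N, K), rhom u & forall x, i (u x) = d 0%N x.
  apply: fact_inj => // x; apply/ki/((limg_lkerP _ _).1 (e 0%N)).
  by exists x.
have sq : surj q.
  move=> y; have /ki/((limg_lkerP _ _).1 (e 0%N))[x ex] : exists x, i y = i x by exists y.
  by exists x; apply: ii; rewrite qE.
have rK : retract K (C 1%N).
  apply: (IH K (fun j => C j.+1) (fun j => d j.+1) i) => //.
  - by move=> j jr; exact: nC.
  - exact/lker_inj.
  - exact/limg_lkerP.
have s : ses c q.
  split=> //; first exact/lker_inj.
  move=> z; rewrite -((limg_lkerP _ _).1 e0) -qE.
  by split=> [->|z0]; [|apply: ii; rewrite z0]; rewrite linear0.
exact: (proj_ses_split s (retract_proj rK (pC 1%N))).2.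
Qed.

Lemma riso_rdsum M N M' N' : riso M M' -> riso N N' -> riso (rdsum M N) (rdsum M' N').
Proof.
move=> /riso_inv[f [g [hf hg gf fg]]] /riso_inv[f' [g' [hf' hg' gf' fg']]].
apply: (@risoI _ _ (rpair (f \o rpr1 M N) (f' \o rpr2 M N))%VF
  (rpair (g \o rpr1 M' N') (g' \o rpr2 M' N'))%VF).
- by apply: rhom_pair; apply: rhom_comp => //; [exact: rhom_pr1|exact: rhom_pr2].
- by case=> x y; rewrite !rpairE !comp_lfunE !rpr1E !rpr2E /= gf gf'.
- by case=> x y; rewrite !rpairE !comp_lfunE !rpr1E !rpr2E /= fg fg'.
Qed.

(** * Finite direct sums and local modules *)

Section BigSums.
Local Notation "\bigrdsum_ ( i <- r | C ) F" := (\big[@rdsum k A/@rzero k A]_(i <- r | C) F)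
  (at level 34, i, r at level 50).

Lemma riso_bigrdsum (I : Type) (r : seq I) (C : pred I) (F G : I -> rmodule) :
  (forall i, C i -> riso (F i) (G i)) ->
  riso (\bigrdsum_(i <- r | C i) F i) (\bigrdsum_(i <- r | C i) G i).
Proof.
move=> h; elim/big_rec2: _ => [|i M N Ci]; first exact: riso_refl.
exact/riso_rdsum/h.
Qed.

Lemma proj_bigrdsum (I : Type) (r : seq I) (C : pred I) (F : I -> rmodule) :
  (forall i, C i -> projective (F i)) -> projective (\bigrdsum_(i <- r | C i) F i).
Proof.
by move=> h; elim/big_ind: _ => //; [exact/proj_null/rnull_rzero|exact: proj_rdsum].
Qed.

Lemma injmod_bigrdsum (I : Type) (r : seq I) (C : pred I) (F : I -> rmodule) :
  (forall i, C i -> injmod (F i)) -> injmod (\bigrdsum_(i <- r | C i) F i).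
Proof.
by move=> h; elim/big_ind: _ => //; [exact/injmod_null/rnull_rzero|exact: injmod_rdsum].
Qed.

Lemma retract_bigrdsum (I : eqType) (r : seq I) (C : pred I) (F : I -> rmodule) i :
  i \in r -> C i -> retract (F i) (\bigrdsum_(j <- r | C j) F j).
Proof.
move=> + Ci; elim: r => // j r IH; rewrite inE big_cons => /predU1P[<-|ir].
  by rewrite Ci; exact: retract_in1.
case: ifP => _; last exact: IH.
exact: retract_trans (IH ir) (@retract_in2 _ _).
Qed.

(** Stands in for a local endomorphism ring: this exchange property is all that the Krull-Schmidt
    arguments need. *)
Definition local M := ~ rnull M /\
  forall N N', retract M (rdsum N N') -> retract M N \/ retract M N'.

Lemma local_bigrdsum M (I : Type) (r : seq I) (C : pred I) (F : I -> rmodule) :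
  local M -> retract M (\bigrdsum_(i <- r | C i) F i) -> exists2 i, C i & retract M (F i).
Proof.
move=> [nM lM]; elim/big_rec: _ => [[i [p [_ _ e]]]|i N Ci IH /lM[h|/IH//]].
  by case: nM; apply/rnullP => x; rewrite -(e x) (rzero_eq0 (i x)) linear0.
by exists i.
Qed.

Lemma riso_rdsumC M N : riso (rdsum M N) (rdsum N M).
Proof.
apply: (@risoI _ _ (rpair (rpr2 M N) (rpr1 M N)) (rpair (rpr2 N M) (rpr1 N M))).
- by apply: rhom_pair; [exact: rhom_pr2|exact: rhom_pr1].
- by case=> x y; rewrite !rpairE !rpr1E !rpr2E.
- by case=> x y; rewrite !rpairE !rpr1E !rpr2E.
Qed.

Lemma riso_rdsumA M N X : riso (rdsum M (rdsum N X)) (rdsum (rdsum M N) X).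
Proof.
apply: (@risoI _ _ (rcopair (rin1 _ _ \o rin1 M N) (rcopair (rin1 _ _ \o rin2 M N) (rin2 _ _)))%VF
  (rcopair (rcopair (rin1 _ _) (rin2 _ _ \o rin1 N X)) (rin2 _ _ \o rin2 N X))%VF).
- by repeat apply: rhom_copair; repeat apply: rhom_comp;
    try exact: rhom_in1; try exact: rhom_in2.
- case=> x [y z].
  do 4![rewrite ?(rcopairE, comp_lfunE, rin1E, rin2E, pair_addE, linear0) /=].
  by rewrite ?addr0 ?add0r.
- case=> [[x y] z].
  do 4![rewrite ?(rcopairE, comp_lfunE, rin1E, rin2E, pair_addE, linear0) /=].
  by rewrite ?addr0 ?add0r.
Qed.

Lemma riso_rdsumCA M N X : riso (rdsum M (rdsum N X)) (rdsum N (rdsum M X)).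
Proof.
apply: riso_trans (riso_rdsumA M N X) _.
apply: riso_trans (riso_sym (riso_rdsumA N M X)).
exact: riso_rdsum (riso_rdsumC M N) (riso_refl X).
Qed.

Lemma riso_bigrdsum_perm (I : eqType) (r s : seq I) (F : I -> rmodule) :
  perm_eq r s -> riso (\bigrdsum_(i <- r | true) F i) (\bigrdsum_(i <- s | true) F i).
Proof.
elim: r s => [|i r IH] s; first by rewrite perm_sym => /perm_nilP ->; exact: riso_refl.
move=> pe; have si : i \in s by rewrite -(perm_mem pe) mem_head.
case/splitPr: si pe => s1 s2 pe; rewrite big_cons.
have {}pe : perm_eq r (s1 ++ s2).
  by rewrite -(perm_cons i) (perm_trans pe) // -cat1s perm_catCA.
apply: riso_trans (riso_rdsum (riso_refl (F i)) (IH _ pe)) _.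
elim: s1 {pe} => [|j s1 IHs]; first by rewrite big_cons; exact: riso_refl.
rewrite !cat_cons !big_cons; apply: riso_trans (riso_rdsumCA _ _ _) _.
exact: riso_rdsum (riso_refl _) IHs.
Qed.

Lemma riso_bigrdsum_reindex (I J : finType) (C : pred I) (D : pred J) (h : J -> I)
    (F : I -> rmodule) :
  {in D &, injective h} -> (forall i, reflect (exists2 j, D j & i = h j) (C i)) ->
  riso (\bigrdsum_(i <- index_enum I | C i) F i) (\bigrdsum_(j <- index_enum J | D j) F (h j)).
Proof.
move=> ih Ch; rewrite -big_filter -[X in riso _ X]big_filter -(big_map h xpredT).
apply/riso_bigrdsum_perm/uniq_perm.
- exact/filter_uniq/index_enum_uniq.
- rewrite map_inj_in_uniq; first exact/filter_uniq/index_enum_uniq.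
  by move=> x y; rewrite !mem_filter => /andP[Dx _] /andP[Dy _]; apply: ih.
move=> i; rewrite mem_filter mem_index_enum andbT.
apply/Ch/mapP => [[j Dj ->]|[j]]; first by exists j; rewrite // mem_filter Dj mem_index_enum.
by rewrite mem_filter => /andP[Dj _] ->; exists j.
Qed.

Lemma riso_bigrdsum_D1 (I : finType) (C : pred I) (F : I -> rmodule) i : C i ->
  riso (\bigrdsum_(j <- index_enum I | C j) F j)
       (rdsum (\bigrdsum_(j <- index_enum I | C j && (j != i)) F j) (F i)).
Proof.
move=> Ci; rewrite -big_filter -[in X in riso _ X]big_filter.
apply: riso_trans (riso_rdsumC _ _).
have := @big_cons _ (rzero A) (@rdsum k A) _ i [seq j <- index_enum I | C j && (j != i)] xpredT F.
move=> /= <-; apply/riso_bigrdsum_perm/uniq_perm.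
- exact/filter_uniq/index_enum_uniq.
- rewrite /= mem_filter eqxx andbF /=; exact/filter_uniq/index_enum_uniq.
move=> j; rewrite inE !mem_filter mem_index_enum !andbT.
by case: eqVneq => [->|]; rewrite ?andbT.
Qed.

Lemma riso_biproduct (I : eqType) (r : seq I) (F : I -> rmodule) M
    (a : forall i, 'Hom(F i, M)) (b : forall i, 'Hom(M, F i)) :
  uniq r -> (forall i, rhom (a i)) -> (forall i, rhom (b i)) ->
  (forall i x, b i (a i x) = x) -> (forall i j x, i != j -> b j (a i x) = 0) ->
  (forall x, \sum_(i <- r) a i (b i x) = x) ->
  riso M (\bigrdsum_(i <- r | true) F i).
Proof.
move=> ur ha hb ba ba0 ab; set S := \big[_/_]_(_ <- _ | _) _.
(* The induction runs over sublists of [r], where [f \o g] is only the partial sum of the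
   idempotents [a i (b i _)]; the last two clauses express that the other components are orthogonal
   to it. *)
suff [f [g [hf hg gf [fg _ _]]]] : exists (f : 'Hom(S, M)) (g : 'Hom(M, S)), [/\ rhom f, rhom g,
    forall y, g (f y) = y & [/\ forall x, f (g x) = \sum_(i <- r) a i (b i x),
    forall z, (forall i, i \in r -> b i z = 0) -> g z = 0
    & forall y j, j \notin r -> b j (f y) = 0]].
  by apply: (@risoI _ _ g f) => // x; rewrite fg ab.
rewrite {}/S {ab}; elim: r ur => [_|j r IH /= /andP[jr /IH [f [g [hf hg gf [fg g0 f0]]]]]].
  rewrite big_nil; exists 0, 0; split; try exact: rhom0.
    by move=> y; rewrite [RHS]rzero_eq0 zero_lfunE.
  split=> [x|z _|y i _]; rewrite ?big_nil zero_lfunE // linear0 //.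
rewrite big_cons; exists (rcopair (a j) f), (rpair (b j) g); split.
- exact: rhom_copair.
- exact: rhom_pair.
- case=> x y; rewrite rcopairE rpairE !linearD /= gf ba (f0 y j jr) addr0 (g0 (a j x)) ?add0r //.
  by move=> i ir; apply: ba0; apply: contraNneq jr => ->.
split.
- by move=> x; rewrite rcopairE rpairE /= fg big_cons.
- by move=> z hz; rewrite rpairE hz ?mem_head // g0 // => i ir; apply: hz; rewrite inE ir orbT.
- move=> [x y] i; rewrite inE negb_or => /andP[ij ir].
  by rewrite rcopairE linearD /= (f0 y i ir) addr0 ba0 // eq_sym.
Qed.

End BigSums.

Lemma in_add_retract T N (r : nat) : retract N (\big[@rdsum k A/@rzero k A]_(i < r) T) ->
  in_add T N.
Proof.
move=> [i [p [hi hp e]]]; have [K [j [_ rK _]]] := retract_split hi hp e.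
by exists K, r.
Qed.

Lemma in_add_retractE T N : in_add T N ->
  exists r, retract N (\big[@rdsum k A/@rzero k A]_(i < r) T).
Proof.
move=> [K [r /riso_retract h]]; exists r; exact: retract_trans (@retract_in1 _ _) h.
Qed.

Lemma in_add_retract1 T N : retract N T -> in_add T N.
Proof.
move=> h; apply: (@in_add_retract _ _ 1); rewrite big_ord_recl.
exact: retract_trans h (@retract_in1 _ _).
Qed.

Lemma in_add_rdsum T M N : retract M T -> retract N T -> in_add T (rdsum M N).
Proof.
move=> hM hN; apply: (@in_add_retract _ _ 2); rewrite !big_ord_recl.
exact/retract_rdsum/(retract_trans hN)/retract_in1.
Qed.

(** Passing to syzygies reduces Ext^{s+1} and projective dimension s + 1 to the case of degree one
    in [H]; thus the dimension bound drops by one until it reaches zero. *)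
Lemma pd_le_proj_of_ext r X M :
  (forall Y, pd_le 1 Y -> ext_eq0 0 Y X -> projective Y) ->
  pd_le r M -> (forall j, ext_eq0 j M X) -> projective M.
Proof.
move=> H.
have S s : forall Y, pd_le s.+1 Y -> ext_eq0 s Y X -> pd_le s Y.
  elim: s => [|s IH] Y; first exact: H.
  by move=> h e K P i p hP ss; apply: IH; [exact: h hP ss|exact: e hP ss].
elim: r => // r IH h e; apply: IH => //; exact: S.
Qed.

Lemma retract_dim M N : retract M N -> (\dim {:M} <= \dim {:N})%N.
Proof.
move=> [i [p [_ _ e]]]; rewrite -(limg_dim_eq (f := i) (U := fullv)) ?dimvS ?subvf //.
by rewrite (_ : lker i = 0%VS) ?capv0 //; apply/lker_inj => x y exy; rewrite -(e x) exy e.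
Qed.

Lemma rdsum_dim M N : \dim {:rdsum M N} = (\dim {:M} + \dim {:N})%N.
Proof.
apply: (@ses_dim _ _ _ (rin1 M N) (rpr2 M N)); split.
- exact: rhom_in1.
- exact: rhom_pr2.
- by move=> x y; rewrite !rin1E => -[].
- by move=> y; exists (0, y); rewrite rpr2E.
- case=> x y; rewrite rpr2E /=; split=> [->|[z]]; first by exists x; rewrite rin1E.
  by rewrite rin1E => -[].
Qed.

(** If [M] is a summand of [N] + [N'], the endomorphisms of [M] through [N] and through [N'] add up
    to the identity; a left inverse of one of them makes [M] a summand of the corresponding term. *)
Lemma local_of M : ~ rnull M ->
  (forall f : 'Hom(M, M), rhom f ->
    (exists2 h : 'Hom(M, M), rhom h & forall x, h (f x) = x) \/
    (exists2 h : 'Hom(M, M), rhom h & forall x, h (x - f x) = x)) -> local M.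
Proof.
move=> nM H; split=> // N N' [i [p [hi hp e]]].
pose f := (p \o (rin1 N N' \o (rpr1 N N' \o i)))%VF.
have hf : rhom f.
  by do 3?[apply: rhom_comp => //]; [exact: rhom_in1|exact: rhom_pr1].
have fE x : f x = p ((i x).1, 0) by rewrite !comp_lfunE rpr1E rin1E.
have fE' x : x - f x = p (0, (i x).2).
  rewrite fE -{1}(e x) -linearB /=; congr (p _); case: (i x) => a b.
  by congr (_, _); rewrite /= ?subrr ?subr0.
have [[h hh hE]|[h hh hE]] := H f hf; [left|right].
  exists (rpr1 N N' \o i)%VF, (h \o (p \o rin1 N N'))%VF; split.
  - by apply: rhom_comp => //; exact: rhom_pr1.
  - by do 2![apply: rhom_comp => //]; exact: rhom_in1.
  - by move=> x; rewrite !comp_lfunE rpr1E rin1E -fE hE.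
exists (rpr2 N N' \o i)%VF, (h \o (p \o rin2 N N'))%VF; split.
- by apply: rhom_comp => //; exact: rhom_pr2.
- by do 2![apply: rhom_comp => //]; exact: rhom_in2.
- by move=> x; rewrite !comp_lfunE rpr2E rin2E -fE' hE.
Qed.

Lemma local_indecomposable M : local M -> indecomposable M.
Proof.
move=> [nM lM]; split=> // N N' r.
have d := riso_dim r; rewrite rdsum_dim in d.
have [h|h] := lM _ _ (riso_retract r); have h0 := retract_dim h; [right|left].
  by move: h0; rewrite /rnull d -{2}[\dim {:N}]addn0 leq_add2l leqn0 => /eqP.
by move: h0; rewrite /rnull d -{2}[\dim {:N'}]add0n leq_add2r leqn0 => /eqP.
Qed.

(** The trace of the class [C] in [X]: since maps can be added on direct sums, an image of maximal
    dimension contains all others. *)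
Lemma max_image (C : rmodule -> Prop) X : C (rzero A) ->
  (forall M N, C M -> C N -> C (rdsum M N)) ->
  exists (F : rmodule) (f : 'Hom(F, X)), [/\ C F, rhom f &
    forall (G : rmodule) (g : 'Hom(G, X)) y, C G -> rhom g -> g y \in limg f].
Proof.
move=> C0 CD.
suff H m (F : rmodule) (f : 'Hom(F, X)) : C F -> rhom f -> (\dim {:X} <= \dim (limg f) + m)%N ->
    exists (F : rmodule) (f : 'Hom(F, X)), [/\ C F, rhom f &
    forall (G : rmodule) (g : 'Hom(G, X)) y, C G -> rhom g -> g y \in limg f].
  by apply: (H (\dim {:X}) _ 0 C0 (@rhom0 _ _)); rewrite leq_addl.
elim: m F f => [|m IH] F f CF hf dX.
  exists F, f; split=> // G g y _ _; suff -> : limg f = fullv by exact: memvf.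
  by apply/eqP; rewrite eqEdim subvf -[X in (_ <= X)%N]addn0.
have [|nex] := classic (exists (G : rmodule) (g : 'Hom(G, X)) y,
    [/\ C G, rhom g & g y \notin limg f]); last first.
  exists F, f; split=> // G g y CG hg; apply/negPn/negP => ny.
  by apply: nex; exists G, g, y.
move=> [G [g [y [CG hg ny]]]].
apply: (IH (rdsum F G) (rcopair f g)); [exact: CD|exact: rhom_copair|].
apply: leq_trans dX _; rewrite addnS -addSn leq_add2r.
have sub : (limg f <= limg (rcopair f g))%VS.
  apply/subvP => z /memv_imgP[x _ ->].
  have <- : rcopair f g (x, 0) = f x by rewrite rcopairE linear0 addr0.
  by rewrite memv_img ?memvf.
rewrite ltn_neqAle dimvS // andbT; apply: contraNneq ny => d.
have -> : limg f = limg (rcopair f g) by apply/eqP; rewrite eqEdim sub d leqnn.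
have <- : rcopair f g (0, y) = g y by rewrite rcopairE linear0 add0r.
by rewrite memv_img ?memvf.
Qed.

End ModuleTheory.

(** * The zigzag algebra *)

Section Zigzag.
Variables (k : fieldType) (n : nat) (B : falgType k).
Variable pi : {rmorphism path_alg k (zigzag n) -> B}.
Hypothesis hn : (2 <= n)%N.
Hypothesis hB : path_alg_quotient (@zigzag_rel k n) pi.
Local Notation kQ := (path_alg k (zigzag n)).
Local Notation qp := (qpath (zigzag n)).
Implicit Types (i j l v w : 'I_n).

Lemma pelt_mul_some (p q : qp) : pend p = pstart q ->
  exists2 r, (pelt k p : kQ) * pelt k q = pelt k r & val r = (pstart p, parrows p ++ parrows q).
Proof.
move=> /eqP /pcat_some[r er vr]; exists r => //.
by rewrite [LHS]path_alg_mul_pelt /pmul er.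
Qed.

Lemma pelt_mul_none (p q : qp) : pend p != pstart q -> (pelt k p : kQ) * pelt k q = 0.
Proof. by move=> h; rewrite [LHS]path_alg_mul_pelt /pmul /pcat (negbTE h). Qed.

Lemma pi_rel x : zigzag_rel x -> pi x = 0.
Proof.
move=> hx; have [_ _ h] := hB; apply/h.
by rewrite -[x]mulr1 -[x]mul1r; apply: ideal_genM.
Qed.

Lemma pi_scale c x : pi (c *: x) = c *: pi x.
Proof. by have [h _ _] := hB; apply: h. Qed.

Lemma pi_mul (x y : kQ) : pi (x * y) = pi x * pi y.
Proof. exact: rmorphM. Qed.

Definition velt i : B := pi (pelt k (vpath (i : vertex (zigzag n)))).

Definition adj i j := zigzag_adj (i, j).

(** Extended by 0 to non-adjacent pairs, so that sums and multiplication rules range over all pairs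
    of vertices. *)
Definition aelt i j : B :=
  if insub (i, j) is Some a then pi (pelt k (apath (a : arrow (zigzag n)))) else 0.

(** Any neighbour of [i] gives the same 2-cycle, by the relations ([aelt_celt_eq]); at the last
    vertex the relations make it zero. *)
Definition celt i : B :=
  if i.+1 == n then 0 else if [pick j | adj i j] is Some j then aelt i j * aelt j i else 0.

Lemma adj_sym i j : adj i j = adj j i.
Proof. by rewrite /adj /zigzag_adj /= orbC. Qed.

Lemma adj_neq i j : adj i j -> i != j.
Proof.
rewrite /adj /zigzag_adj /=; apply: contraTneq => ->.
by rewrite negb_or; apply/andP; split; rewrite neq_ltn ltnSn.
Qed.

Lemma aelt_nadj i j : ~~ adj i j -> aelt i j = 0.
Proof. by move=> h; rewrite /aelt insubN. Qed.

Lemma aeltE i j (h : zigzag_adj (i, j)) :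
  aelt i j = pi (pelt k (apath (Q := zigzag n) (exist _ (i, j) h))).
Proof. by rewrite /aelt insubT. Qed.

Lemma act_aelt0 (M : rmodule B) :
  (forall (m : M) (a : arrow (zigzag n)), act m (pi (pelt k (apath a))) = 0) ->
  forall (m : M) i j, act m (aelt i j) = 0.
Proof.
move=> h m i j; case: (boolP (adj i j)) => hj; first by rewrite (aeltE hj) h.
by rewrite aelt_nadj // actr0.
Qed.

Lemma velt_mul i j : velt i * velt j = if i == j then velt i else 0.
Proof.
rewrite /velt -rmorphM [_ * _ in LHS]path_alg_mul_pelt /pmul pcat_vl /=.
have -> : pstart (vpath (Q := zigzag n) j) = j by [].
by case: eqP => [->|_] //; rewrite rmorph0.
Qed.

Lemma velt_sum : \sum_i velt i = 1.
Proof. by rewrite -rmorph_sum -[RHS](rmorph1 pi). Qed.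

Lemma velt_aelt l i j : velt l * aelt i j = if l == i then aelt i j else 0.
Proof.
case: (boolP (adj i j)) => h; last by rewrite (aelt_nadj h) mulr0 if_same.
rewrite (aeltE h) /velt -rmorphM [_ * _ in LHS]path_alg_mul_pelt /pmul pcat_vl /=.
have -> : pstart (apath (Q := zigzag n) (exist _ (i, j) h)) = i by [].
by case: eqP => // _; rewrite rmorph0.
Qed.

Lemma aelt_velt l i j : aelt i j * velt l = if l == j then aelt i j else 0.
Proof.
case: (boolP (adj i j)) => h; last by rewrite (aelt_nadj h) mul0r if_same.
rewrite (aeltE h) /velt -rmorphM [_ * _ in LHS]path_alg_mul_pelt /pmul pcat_vr /=.
have -> : pend (apath (Q := zigzag n) (exist _ (i, j) h)) = j by [].
by case: eqP => // _; rewrite rmorph0.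
Qed.

Lemma adj_path i j l (h : zigzag_adj (i, j)) (h' : zigzag_adj (j, l)) :
  exists r : qp, [/\ aelt i j * aelt j l = pi (pelt k r), plen r = 2%N, pstart r = i & pend r = l].
Proof.
rewrite (aeltE h) (aeltE h') -rmorphM.
have [//|r -> er] := @pelt_mul_some (apath (Q := zigzag n) (exist _ (i, j) h))
  (apath (Q := zigzag n) (exist _ (j, l) h')).
by exists r; rewrite /plen /pend /pstart /parrows er.
Qed.

Lemma aelt_celt_eq i j : adj i j -> aelt i j * aelt j i = celt i.
Proof.
move=> h; have h' : adj j i by rewrite adj_sym.
have [r [-> r2 rs re]] := adj_path h h'.
rewrite /celt; case: eqP => [ei|_].
  have {}ei : nat_of_ord i = n.-1 by rewrite -[RHS](congr1 predn ei).
  by apply/pi_rel/zigzag_last; rewrite ?rs ?re.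
case: pickP => [w hw|/(_ j)]; last by rewrite h.
have hw' : adj w i by rewrite adj_sym.
have [s [-> s2 ss se]] := adj_path hw hw'.
by apply/eqP; rewrite -subr_eq0 -rmorphB; apply/eqP/pi_rel/zigzag_cycles; rewrite ?rs ?re ?ss ?se.
Qed.

Lemma aelt_mul i j j' l :
  aelt i j * aelt j' l = if [&& j == j', i == l & adj i j] then celt i else 0.
Proof.
case: (boolP (adj i j)) => h; last by rewrite (aelt_nadj h) mul0r !andbF.
rewrite andbT; case: (boolP (adj j' l)) => h'; last first.
  rewrite (aelt_nadj h') mulr0; case: ifP => // /andP[/eqP ej /eqP el].
  by move: h'; rewrite -ej -el adj_sym h.
case: (eqVneq j j') => [ej|nj] /=; last first.
  rewrite (aeltE h) (aeltE h') -rmorphM pelt_mul_none ?rmorph0 //.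
rewrite -ej in h' *; case: (eqVneq i l) => [<-|nl]; first exact: aelt_celt_eq.
have [r [-> r2 rs re]] := adj_path h h'.
by apply/pi_rel/zigzag_noncycle; rewrite ?rs ?re //; apply/eqP.
Qed.

Lemma aelt_celt i j l : aelt i j * celt l = 0.
Proof.
have h3 x y z w : aelt x y * aelt y z * aelt z w = 0.
  case: (boolP (adj x y)) => h1; last by rewrite (aelt_nadj h1) !mul0r.
  case: (boolP (adj y z)) => h2; last by rewrite (aelt_nadj h2) mulr0 mul0r.
  case: (boolP (adj z w)) => h; last by rewrite (aelt_nadj h) mulr0.
  have [r [-> r2 rs re]] := adj_path h1 h2; rewrite (aeltE h) -rmorphM.
  have [|r' -> er] := @pelt_mul_some r (apath (Q := zigzag n) (exist _ (z, w) h)).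
    by rewrite re.
  by apply/pi_rel/zigzag_len3; rewrite /plen /parrows er size_cat /= -/(parrows r) -/(plen r) r2.
rewrite /celt; case: ifP => _; first by rewrite mulr0.
case: pickP => [w hw|_]; last by rewrite mulr0.
rewrite mulrA aelt_mul; case: ifP => [/and3P[/eqP ej /eqP ei h]|]; last by rewrite mul0r.
by rewrite -(aelt_celt_eq h) ei ej h3.
Qed.

Lemma celt_aelt i j l : celt l * aelt i j = 0.
Proof.
rewrite /celt; case: ifP => cl; first by rewrite mul0r.
case: pickP => [w hw|_]; last by rewrite mul0r.
rewrite -mulrA aelt_mul; case: ifP => [/and3P[/eqP ej /eqP ei h]|]; last by rewrite mulr0.
by rewrite aelt_celt.
Qed.

Lemma celt_celt i j : celt i * celt j = 0.
Proof.
rewrite {2}/celt; case: ifP => cl; first by rewrite mulr0.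
by case: pickP => [w hw|_]; rewrite ?mulr0 // mulrA celt_aelt mul0r.
Qed.

Lemma velt_celt i j : velt i * celt j = if i == j then celt j else 0.
Proof.
rewrite /celt; case: ifP => cl; first by rewrite mulr0 if_same.
case: pickP => [w hw|_]; last by rewrite mulr0 if_same.
by rewrite mulrA velt_aelt; case: ifP => //; rewrite mul0r.
Qed.

Lemma celt_velt i j : celt j * velt i = if i == j then celt j else 0.
Proof.
rewrite /celt; case: ifP => cl; first by rewrite mul0r if_same.
case: pickP => [w hw|_]; last by rewrite mul0r if_same.
by rewrite -mulrA aelt_velt; case: ifP => //; rewrite mulr0.
Qed.

Lemma celt_last i : i.+1 = n -> celt i = 0.
Proof. by rewrite /celt => ->; rewrite eqxx. Qed.

Lemma celt_cases i : celt i = 0 \/ exists j, celt i = aelt i j * aelt j i.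
Proof.
rewrite /celt; case: ifP => _; first by left.
by case: pickP => [j _|_]; [right; exists j|left].
Qed.

Lemma pi_pelt_decomp (p : qp) : (exists i, pi (pelt k p) = velt i) \/
  exists i j (q : qp), pi (pelt k p) = aelt i j * pi (pelt k q).
Proof.
case: p => [[v s] ws]; case: s ws => [|a s] ws.
  by left; exists v; congr (pi (pelt k _)); apply/val_inj.
have ws0 : (src a == v) && walk (tgt a) s := ws.
have {ws0}[/eqP ea ws'] := andP ws0.
right; exists (val a).1, (val a).2, (@QPath _ (tgt a, s) ws').
have [//|r er vr] := @pelt_mul_some (apath a) (@QPath _ (tgt a, s) ws').
have -> : aelt (val a).1 (val a).2 = pi (pelt k (apath a)).
  case: a {ws ws' ea r er vr} => [[i j] h] /=; rewrite (aeltE h).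
  by congr (pi (pelt k (apath _))); apply/val_inj.
rewrite -pi_mul er.
by congr (pi (pelt k _)); apply/val_inj; rewrite vr /= -ea.
Qed.

(** Peeling arrows off a path from the left reaches zero, or a multiple of one of these elements,
    after at most three arrows. *)
Lemma velt_span (U : {vspace B}) : (forall i, velt i \in U) -> (forall i j, aelt i j \in U) ->
  (forall i, celt i \in U) -> U = fullv.
Proof.
move=> hE ha hc.
have H (p : qp) : pi (pelt k p) \in U.
  have [[i ->]|[i [j [q ->]]]] := pi_pelt_decomp p; first exact: hE.
  have [[l ->]|[l [m [r ->]]]] := pi_pelt_decomp q.
    by rewrite aelt_velt; case: ifP => _; rewrite ?ha ?mem0v.
  rewrite mulrA aelt_mul; case: ifP => _; last by rewrite mul0r mem0v.
  have [[v ->]|[v [w [s ->]]]] := pi_pelt_decomp r.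
    by rewrite celt_velt; case: ifP => _; rewrite ?hc ?mem0v.
  by rewrite mulrA celt_aelt mul0r mem0v.
apply/vspaceP => b; rewrite memvf; have [_ h _] := hB; have [x <-] := h b.
rewrite -(plinE x) /plin rmorph_sum memv_suml // => p _.
by rewrite pi_scale memvZ.
Qed.

(** * The 2-cycles at the other vertices are nonzero *)

Section Functional.
Variable v : 'I_n.
Hypothesis hv : v.+1 != n.

Definition cycle_at (p : qp) := [&& plen p == 2, pstart p == v & pend p == v].

(** The sum of the coefficients of the 2-cycles at [v], recorded as a multiple of the trivial path
    at [v] so that it is an instance of [plin]. *)
Definition cycle_coef (x : kQ) : kQ :=
  plin (fun p => if cycle_at p then pelt k (vpath (v : vertex (zigzag n))) else 0) x.

Lemma cycle_coef_mul (p q r : qp) : (2 <= plen q)%N ->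
  cycle_coef ((pelt k p : kQ) * pelt k q * pelt k r) =
  if [&& plen p == 0%N, plen r == 0%N, pend p == pstart q, pend q == pstart r & cycle_at q]
  then pelt k (vpath (v : vertex (zigzag n))) else 0.
Proof.
have c0 : cycle_coef 0 = 0 by rewrite /cycle_coef linear0.
move=> q2; case: (boolP (pend p == pstart q)) => [/eqP e1|n1]; last first.
  by rewrite pelt_mul_none // mul0r c0 !andbF.
have [s -> es] := pelt_mul_some e1.
have ss : pstart s = pstart p by rewrite /pstart es.
have sa : parrows s = parrows p ++ parrows q by rewrite /parrows es.
have se : pend s = pend q by rewrite /pend ss sa walk_end_cat -/(pend p) e1.
case: (boolP (pend q == pstart r)) => [/eqP e2|n2]; last first.
  by rewrite pelt_mul_none ?se // c0 !andbF.
have [|t -> et] := @pelt_mul_some s r; first by rewrite se.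
rewrite /cycle_coef plin_pelt; congr (if _ then _ else _).
have ts : pstart t = pstart p by rewrite /pstart et ss.
have ta : parrows t = parrows p ++ parrows q ++ parrows r by rewrite /parrows et sa catA.
rewrite /cycle_at {1}/plen ta !size_cat -/(plen p) -/(plen q) -/(plen r) ts /=.
have te : pend t = pend r by rewrite /pend ts ta !walk_end_cat -/(pend p) e1 -/(pend q) e2.
rewrite te; case: (posnP (plen p)) => p0 /=; last first.
  by rewrite gtn_eqF //; lia.
case: (posnP (plen r)) => r0 /=; last first.
  by rewrite gtn_eqF //; lia.
have ep : pend p = pstart p by move/size0nil: p0; rewrite /pend => ->.
have er : pend r = pstart r by move/size0nil: r0; rewrite /pend => ->.
by rewrite p0 r0 add0n addn0 -ep e1 er -e2.
Qed.

(** By linearity the outer factors may be taken to be paths, and then [cycle_coef_mul] applies: two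
    2-cycles at the same vertex count equally, and the relation at the last vertex does not concern
    [v]. *)
Lemma cycle_coef_ideal x : ideal_gen (@zigzag_rel k n) x -> cycle_coef x = 0.
Proof.
have lc : linear cycle_coef by exact: linearP.
elim=> [|y z _ ey _ ez|a r b hr]; first exact: linear0.
  by rewrite [LHS]linearD /= -/(cycle_coef y) -/(cycle_coef z) ey ez addr0.
have ml (y : kQ) c x1 x2 : (c *: x1 + x2 : kQ) * y = c *: (x1 * y) + x2 * y.
  exact: path_alg_mul_linl.
have mr (y : kQ) c x1 x2 : y * (c *: x1 + x2 : kQ) = c *: (y * x1) + y * x2.
  exact: path_alg_mul_linr.
apply: (@linear_eq_path k _ (fun a => cycle_coef (a * r * b)) (fun _ => 0)) => [c x1 x2|c x1 x2|p].
- by rewrite !ml lc.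
- by rewrite scaler0 addr0.
apply: (@linear_eq_path k _ (fun b => cycle_coef (pelt k p * r * b)) (fun _ => 0))
  => [c x1 x2|c x1 x2|q].
- by rewrite mr lc.
- by rewrite scaler0 addr0.
case: hr => [s s3|s s2 sn|s t s2 t2 sc tc st|s s2 sc sl].
- by rewrite cycle_coef_mul ?s3 // /cycle_at s3 !andbF.
- rewrite cycle_coef_mul ?s2 // /cycle_at s2 /=.
  case: ifP => // /and5P[_ _ _ _ /andP[/eqP e1 /eqP e2]].
  by case: sn; rewrite e1 e2.
- have es := @cycle_coef_mul p s q; have et := @cycle_coef_mul p t q.
  have {es et} est : cycle_coef ((pelt k p : kQ) * pelt k s * pelt k q) =
      cycle_coef ((pelt k p : kQ) * pelt k t * pelt k q).
    apply: etrans (es _) _; first by rewrite s2.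
    apply/esym; apply: etrans (et _) _; first by rewrite t2.
    by rewrite /cycle_at s2 t2 -sc -tc st.
  have e : (pelt k p : kQ) * (pelt k s - pelt k t) * pelt k q =
      (-1) *: ((pelt k p : kQ) * pelt k t * pelt k q) + (pelt k p : kQ) * pelt k s * pelt k q.
    by rewrite -ml -mr scaleN1r addrC.
  apply: etrans (congr1 cycle_coef e) _; apply: etrans (lc _ _ _) _.
  apply: etrans (congr1 (fun z => _ + z) est) _.
  by rewrite scaleN1r addNr.
- rewrite cycle_coef_mul ?s2 // /cycle_at s2 /=.
  case: ifP => // /and5P[_ _ _ _ /andP[/eqP e1 _]].
  by move: hv; rewrite -e1 sl prednK ?eqxx // (leq_trans _ hn).
Qed.

Lemma celt_functional : exists phi : 'Hom(B, k^o), [/\ forall i, phi (velt i) = 0,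
  forall i j, phi (aelt i j) = 0 & forall i, phi (celt i) = (i == v)%:R].
Proof.
have lc : linear cycle_coef by exact: linearP.
have [_ sp kp] := hB.
have sp' b : exists x, pi x == b by have [x <-] := sp b; exists x.
(* A preimage under [pi] is chosen; by [cycle_coef_ideal] the value does not depend on it. *)
pose f b : k^o := mcoeff (vpath (v : vertex (zigzag n))) (cycle_coef (xchoose (sp' b))).
have fE x : f (pi x) = mcoeff (vpath (v : vertex (zigzag n))) (cycle_coef x).
  have e := xchooseP (sp' (pi x)).
  have /kp/cycle_coef_ideal : pi (xchoose (sp' (pi x)) - x) = 0.
    by rewrite rmorphB; apply/eqP; rewrite subr_eq0.
  rewrite /f addrC -scaleN1r lc => /eqP.
  by rewrite scaleN1r addrC subr_eq0 => /eqP ->.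
have lf : linear f.
  move=> c x y; have [x' <-] := sp x; have [y' <-] := sp y.
  rewrite -pi_scale -rmorphD !fE lc mcoeffD mcoeffZ //.
have [phi phiE] := ex_lfun lf; exists phi.
have cE (p : qp) : f (pi (pelt k p)) = (cycle_at p)%:R.
  rewrite fE /cycle_coef plin_pelt; case: ifP => _; first by rewrite mcoeffUU.
  by rewrite mcoeff0.
have Ef : f 0 = 0 by rewrite -phiE linear0.
split=> [i|i j|i]; rewrite phiE.
- by rewrite /velt cE.
- case: (boolP (adj i j)) => h; last by rewrite (aelt_nadj h).
  by rewrite (aeltE h) cE.
case: (eqVneq i v) => [->|iv].
  have [j hj] : exists j, adj v j.
    have vn : (v.+1 < n)%N by rewrite ltn_neqAle hv ltn_ord.
    by exists (Ordinal vn); rewrite /adj /zigzag_adj /= eqxx.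
  rewrite -(aelt_celt_eq hj).
  have hj' : adj j v by rewrite adj_sym.
  have [r [-> r2 rs re]] := adj_path hj hj'.
  by rewrite cE /cycle_at r2 rs re eqxx.
rewrite /celt; case: ifP => [_|_]; first exact: Ef.
case: pickP => [j hj|_]; last exact: Ef.
have hj' : adj j i by rewrite adj_sym.
have [r [-> r2 rs re]] := adj_path hj hj'.
by apply: etrans (cE r) _; rewrite /cycle_at r2 rs re (negbTE iv).
Qed.

End Functional.

End Zigzag.

Arguments adj {n} i j.

(* [Ev i] is the idempotent of the vertex [i], [ar i j] the arrow from [i] to [j] *)
(* (0 if there is none), [cyc i] the common value of the 2-cycles at [i]; the     *)
(* functionals witness that [cyc i] is nonzero for [i] other than the last vertex. *)
Record zigzag_basis (k : fieldType) (n : nat) (B : falgType k) := ZigzagBasis {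
  Ev : 'I_n -> B;
  ar : 'I_n -> 'I_n -> B;
  cyc : 'I_n -> B;
  ar_nadj : forall i j, ~~ adj i j -> ar i j = 0;
  Ev_mul : forall i j, Ev i * Ev j = if i == j then Ev i else 0;
  Ev_sum : \sum_i Ev i = 1;
  Ev_ar : forall l i j, Ev l * ar i j = if l == i then ar i j else 0;
  ar_Ev : forall l i j, ar i j * Ev l = if l == j then ar i j else 0;
  ar_mul : forall i j j' l,
    ar i j * ar j' l = if [&& j == j', i == l & adj i j] then cyc i else 0;
  ar_cyc : forall i j l, ar i j * cyc l = 0;
  cyc_ar : forall i j l, cyc l * ar i j = 0;
  cyc_cyc : forall i j, cyc i * cyc j = 0;
  Ev_cyc : forall i j, Ev i * cyc j = if i == j then cyc j else 0;
  cyc_Ev : forall i j, cyc j * Ev i = if i == j then cyc j else 0;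
  cyc_last : forall i : 'I_n, i.+1 = n -> cyc i = 0;
  cyc_cases : forall i, cyc i = 0 \/ exists j, cyc i = ar i j * ar j i;
  B_span : forall U : {vspace B}, (forall i, Ev i \in U) -> (forall i j, ar i j \in U) ->
    (forall i, cyc i \in U) -> U = fullv;
  cycle_functional : forall v : 'I_n, v.+1 != n -> exists phi : 'Hom(B, k^o),
    [/\ forall i, phi (Ev i) = 0, forall i j, phi (ar i j) = 0
      & forall i, phi (cyc i) = (i == v)%:R]
}.

Definition zigzag_basis_of (k : fieldType) (n : nat) (B : falgType k)
    (pi : {rmorphism path_alg k (zigzag n) -> B}) (hn : (2 <= n)%N)
    (hB : path_alg_quotient (@zigzag_rel k n) pi) : zigzag_basis n B :=
  ZigzagBasis (aelt_nadj pi) (velt_mul pi) (velt_sum pi) (velt_aelt pi) (aelt_velt pi)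
    (aelt_mul hB) (aelt_celt hB) (celt_aelt hB) (celt_celt hB)
    (velt_celt pi) (celt_velt pi) (celt_last pi) (celt_cases pi)
    (velt_span hB) (celt_functional hn hB).

(** * Modules over the zigzag algebra *)

Section ZigzagModules.
Variables (k : fieldType) (n : nat) (B : falgType k) (Z : zigzag_basis n B).
Local Notation Ev := (Ev Z).
Local Notation ar := (ar Z).
Local Notation cyc := (cyc Z).
Local Notation cyc_cases := (cyc_cases Z).
Local Notation ar_nadj := (ar_nadj Z).
Local Notation cycle_functional := (cycle_functional Z).
Implicit Types (i j l v w : 'I_n).

Lemma B_ext (V : vectType k) (f g : 'Hom(B, V)) : (forall i, f (Ev i) = g (Ev i)) ->
  (forall i j, f (ar i j) = g (ar i j)) -> (forall i, f (cyc i) = g (cyc i)) -> f =1 g.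
Proof.
move=> hE ha hc b; have : b \in lker (f - g).
  by rewrite (B_span (z := Z) (U := lker (f - g))) ?memvf // => *; apply/eqlfunP.
by move/eqlfunP.
Qed.

Implicit Types M N X Y K Q : rmodule B.

Lemma rhom_gens M N (f : 'Hom(M, N)) : (forall m i, f (act m (Ev i)) = act (f m) (Ev i)) ->
  (forall m i j, f (act m (ar i j)) = act (f m) (ar i j)) -> rhom f.
Proof.
move=> hE ha m b.
have l1 : linear (fun b : B => f (act m b)) by move=> c x y; rewrite actDr actZr linearP.
have l2 : linear (fun b : B => act (f m) b) by move=> c x y; rewrite actDr actZr.
have [f1 f1E] := ex_lfun l1; have [f2 f2E] := ex_lfun l2.
rewrite -f1E -f2E; apply: B_ext => [i|i j|i]; rewrite f1E f2E ?hE ?ha //.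
by have [->|[j ->]] := cyc_cases i; rewrite ?actr0 ?linear0 // !actM !ha.
Qed.

Lemma Ev_form v (b : B) : exists a (d : 'I_n -> k) e,
  Ev v * b = a *: Ev v + \sum_w d w *: ar v w + e *: cyc v.
Proof.
have lm : linear (fun b : B => Ev v * b) by move=> c x y; rewrite mulrDr scalerAr.
have [f fE] := ex_lfun lm.
pose V := (<[Ev v]> + (\sum_w <[ar v w]>) + <[cyc v]>)%VS.
have : b \in (f @^-1: V)%VS.
  rewrite (B_span (z := Z) (U := (f @^-1: V)%VS)) ?memvf // => [i|i j|i]; rewrite -memv_preim fE.
  - rewrite Ev_mul; case: ifP => _; last exact: mem0v.
    by rewrite -[Ev v]addr0 -[X in X + _]addr0 !memv_add ?memv_line ?mem0v.
  - rewrite Ev_ar; case: eqP => [ev|_]; last exact: mem0v.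
    rewrite /V ev.
    rewrite -[X in X \in _]addr0 -[X in X + _]add0r !memv_add ?mem0v //.
    by apply/memv_sumP; exists (fun w => if w == j then ar i w else 0) => [w _|];
      [case: eqP => _; rewrite ?memv_line ?mem0v|rewrite -big_mkcond big_pred1_eq].
  - rewrite Ev_cyc; case: eqP => [ev|_]; last exact: mem0v.
    rewrite /V ev.
    by rewrite -[X in X \in _]add0r memv_add ?mem0v ?memv_line.
rewrite -memv_preim fE => /memv_addP[x /memv_addP[y /vlineP[a ->] [z zS ->]] [t /vlineP[e ->] ->]].
have [d hd ->] := memv_sumP zS.
have H w : exists c, d w = c *: ar v w by have /vlineP := hd w isT.
have [g gE] : exists g : 'I_n -> k, forall w, d w = g w *: ar v w.
  exact: (fin_all_exists H).
by exists a, g, e; congr (_ + _ + _); apply: eq_bigr.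
Qed.

(** There are no loops, so [e_v B e_v] is spanned by its identity and the element [cyc v] of square
    zero; it is a local ring. *)
Lemma Ev_form2 v (b : B) : exists a e, Ev v * b * Ev v = a *: Ev v + e *: cyc v.
Proof.
have [a [d [e ->]]] := Ev_form v b; exists a, e.
rewrite !mulrDl -!scalerAl Ev_mul eqxx cyc_Ev eqxx mulr_suml big1 ?addr0 // => w _.
rewrite -scalerAl ar_Ev; case: eqP => [<-|_]; last by rewrite scaler0.
by rewrite ar_nadj ?scaler0 //; apply/negP => /adj_neq; rewrite eqxx.
Qed.

Lemma exists_functional (V : vectType k) (U : {vspace V}) (x : V) : x \notin U ->
  exists2 f : 'Hom(V, k^o), f x != 0 & forall y, y \in U -> f y = 0.
Proof.
move=> xU; pose g := daddv_pi (U^C) U.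
have dU : (U^C :&: U = 0)%VS by rewrite capvC capv_compl.
have gU y : y \in U -> g y = 0.
  move=> yU; have := daddv_pi_add (w := y) dU; rewrite addvC addv_complf memvf => /(_ isT).
  by rewrite -/g (daddv_pi_id (U := U)) ?capv_compl // => e; apply: (addIr y); rewrite e add0r.
have gx : g x != 0.
  apply: contraNneq xU => g0.
  have := daddv_pi_add (w := x) dU; rewrite addvC addv_complf memvf => /(_ isT).
  by rewrite -/g g0 add0r => <-; exact: memv_pi.
have [q hq] : exists q, coord (vbasis {:V}) q (g x) != 0.
  apply/existsP; apply: contraNT gx; rewrite negb_exists => /forallP h.
  rewrite (coord_vbasis (memvf (g x))) big1 // => q _.
  by have := h q; rewrite negbK => /eqP ->; rewrite scale0r.
have lf : linear (fun y => coord (vbasis {:V}) q (g y) : k^o).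
  by move=> c y z; rewrite !linearP.
have [f fE] := ex_lfun lf; exists f; first by rewrite fE.
by move=> y yU; rewrite fE gU // linear0.
Qed.

(** * Simple modules and modules of length two *)

Section Simples.
Variables (L : 'I_n -> rmodule B).
Hypothesis L_dim : forall i, \dim {:L i} = 1%N.
Hypothesis L_Ev : forall i (m : L i), act m (Ev i) = m.
Hypothesis L_ar : forall i (m : L i) j l, act m (ar j l) = 0.

Lemma L_cyc i (m : L i) j : act m (cyc j) = 0.
Proof.
by have [->|[w ->]] := cyc_cases j; rewrite ?actr0 // actM !L_ar.
Qed.

Lemma L_Ev_neq i (m : L i) j : i != j -> act m (Ev j) = 0.
Proof. by move=> ij; rewrite -(L_Ev m) -actM Ev_mul (negbTE ij) actr0. Qed.

Lemma L_gen i : exists2 l : L i, l != 0 & forall x, exists c, x = c *: l.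
Proof.
have d1 := L_dim i.
have nz : ({:L i} != 0)%VS by rewrite -dimv_eq0 d1.
exists (vpick {:L i}); first by rewrite vpick0.
move=> x; apply/vlineP; suff -> : <[vpick {:L i}]>%VS = {:L i}%VS by exact: memvf.
by apply/eqP; rewrite eqEdim subvf dim_vline vpick0 nz d1.
Qed.

(** A functional that kills the images of all arrows becomes a homomorphism to [L i] after
    restriction to the vertex [i]. *)
Lemma hom_to_L X i (f : 'Hom(X, k^o)) : (forall x j l, f (act x (ar j l)) = 0) ->
  exists g : 'Hom(X, L i), rhom g /\ forall x, f (act x (Ev i)) != 0 -> g x != 0.
Proof.
move=> f0; have [l l0 _] := L_gen i.
have lg : linear (fun x : X => (f (act x (Ev i)) : k) *: l).
  by move=> c x y; rewrite actD actZ linearP /= scalerDl scalerA.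
have [g gE] := ex_lfun lg; exists g; split; last first.
  by move=> x hx; rewrite gE scaler_eq0 negb_or hx.
apply: rhom_gens => [m j|m j w]; rewrite !gE actZ.
  rewrite -actM Ev_mul; case: eqVneq => [->|ij]; first by rewrite L_Ev.
  by rewrite L_Ev_neq 1?eq_sym // actr0 linear0 scaler0 scale0r.
by rewrite L_ar scaler0 -actM ar_Ev; case: ifP => _; rewrite ?f0 ?actr0 ?linear0 scale0r.
Qed.

(** Let [U] be the sum of the images of all arrows. If [U] were all of [X], the cycles would act as
    zero because [ar * cyc = 0], then the arrows would too, and [X] would vanish. Otherwise a
    functional on [X] modulo [U] yields the map. *)
Lemma nakayama X : ~ rnull X ->
  exists i (g : 'Hom(X, L i)), rhom g /\ exists x, g x != 0.
Proof.
move=> nX.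
have la p : linear (fun x : X => act x (ar p.1 p.2)).
  by move=> c x y; rewrite actD actZ.
pose R (p : 'I_n * 'I_n) := limg (sval (ex_lfun (la p))).
pose U := (\sum_p R p)%VS.
have inU x i j : act x (ar i j) \in U.
  apply: (subvP (sumv_sup (i, j) isT (subvv _))).
  by rewrite -[act x _](svalP (ex_lfun (la (i, j)))) memv_img ?memvf.
have [e|/eqP ne] := classic (U = fullv).
  have H (b : B) : (forall i j, ar i j * b = 0) -> forall x : X, act x b = 0.
    move=> hb x; have : x \in U by rewrite e memvf.
    case/memv_sumP => y hy ->; rewrite act_suml big1 // => p _.
    have /memv_imgP[z _ ->] := hy p isT.
    by rewrite (svalP (ex_lfun (la p))) -actM hb actr0.
  have Hc i : forall x : X, act x (cyc i) = 0 by apply: H => *; exact: ar_cyc.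
  have Ha i j : forall x : X, act x (ar i j) = 0.
    move=> x; have : x \in U by rewrite e memvf.
    case/memv_sumP => y hy ->; rewrite act_suml big1 // => p _.
    have /memv_imgP[z _ ->] := hy p isT.
    by rewrite (svalP (ex_lfun (la p))) -actM ar_mul; case: ifP; rewrite ?Hc ?actr0.
  case: nX; apply/rnullP => x; have : x \in U by rewrite e memvf.
  case/memv_sumP => y hy ->; rewrite big1 // => p _.
  have /memv_imgP[z _ ->] := hy p isT.
  by rewrite (svalP (ex_lfun (la p))) Ha.
have [x xU] : exists x : X, x \notin U.
  have : ~~ (fullv <= U)%VS by apply: contra ne => h; rewrite eqEsubv subvf.
  by case/subvPn => x _ xU; exists x.
have [f fx fU] := exists_functional xU.
have [i hi] : exists i, f (act x (Ev i)) != 0.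
  apply/existsP; apply: contraNT fx; rewrite negb_exists => /forallP h.
  rewrite -(act1 x) -(Ev_sum Z) act_sumr linear_sum big1 // => i _.
  by have := h i; rewrite negbK => /eqP.
have [g [hg gx]] := @hom_to_L X i f (fun x j l => fU _ (inU x j l)).
by exists i, g; split=> //; exists x; apply: gx.
Qed.

(* [M] has top [t] generated by [u] and socle [s] spanned by [w]; it is simple if *)
(* [t = s] and uniserial of length two otherwise.                                 *)
Definition frame (t s : 'I_n) M (u w : M) :=
  [/\ act u (Ev t) = u, act w (Ev s) = w, w != 0,
      forall x : M, exists a b, x = a *: u + b *: w
    & [/\ forall x, act u (ar t x) = if (x == s) && adj t s then w else 0,
          forall x, act w (ar s x) = 0 & (t = s /\ u = w) \/ adj t s]].

Lemma frame_L i : exists u w : L i, frame i i u w.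
Proof.
have [l l0 lg] := L_gen i; exists l, l; split; rewrite ?L_Ev //.
  by move=> x; have [c ->] := lg x; exists c, 0; rewrite scale0r addr0.
split=> [x|x|]; rewrite ?L_ar //; last by left.
by rewrite (_ : adj i i = false) ?andbF //; apply/negP => /adj_neq; rewrite eqxx.
Qed.

(** The radical [R] and the socle [S] both equal the middle term [U 1] of the composition series.
    Some arrow must carry the top generator [u] into the socle, since otherwise the line of [u]
    would be a submodule incomparable with [S]. *)
Lemma uniserial2_frame M i j : i != j -> uniserial2 M (L i) (L j) ->
  exists u w : M, frame i j u w.
Proof.
move=> ij [uM [U [U0 U2 sU hU]] [f [hf sf radf]] [g [hg ig socg]]].
have sf' := (limg_surj f).1 sf.
have [li li0 lig] := L_gen i; have [lj lj0 ljg] := L_gen j.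
set R := lker f in radf; set S := limg g in socg.
have sR : submod R := lker_submod hf.
have sS : submod S := limg_submod hg.
have gi := (lker_inj g).1 ig.
have w0 : g lj != 0 by rewrite -(inj_eq gi) linear0 // in lj0 *.
have dS : \dim S = 1%N by rewrite limg_dim_eq ?ig ?capv0 ?L_dim.
have dM : (\dim R + 1)%N = \dim {:M}.
  by rewrite -(limg_ker_dim f fullv) capfv sf L_dim.
have [[U01 nU01 m01] [U12 nU12 m12]] := (hU 0%N isT, hU 1%N isT).
rewrite U0 in nU01 m01; rewrite U2 in nU12 m12.
have sU1 : submod (U 1%N) by apply: sU.
have dU1 : (0 < \dim (U 1%N))%N by rewrite lt0n dimv_eq0; apply/eqP => /esym.
have dU1M : (\dim (U 1%N) < \dim {:M})%N.
  rewrite ltn_neqAle dimvS ?subvf // andbT; apply/eqP => e; apply: nU12.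
  by apply/eqP; rewrite eqEdim subvf e leqnn.
have RU : R = U 1%N.
  have [RU|UR] := uM R (U 1%N) sR sU1.
    have [R0|//] := m01 R sR (sub0v _) RU.
    by move: dU1M; rewrite -dM R0 dimv0; case: (\dim _) dU1 => // -[].
  have [//|RM] := m12 R sR UR (subvf _).
  by move: dM; rewrite RM => /eqP; rewrite addn1 eqn_leq ltnn.
have SU : S = U 1%N.
  have [SU|US] := uM S (U 1%N) sS sU1.
    have [S0|//] := m01 S sS (sub0v _) SU.
    by move: dS; rewrite S0 dimv0.
  by apply/esym/eqP; rewrite eqEdim US dS.
have kerw x : f x = 0 -> exists c, x = c *: g lj.
  move=> fx; have : x \in S by rewrite SU -RU memv_ker fx.
  by case/memv_imgP => y _ ->; have [c ->] := ljg y; exists c; rewrite linearZ.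
have [m fm] := sf' li; pose u := act m (Ev i).
have fu : f u = li by rewrite hf fm L_Ev.
have uE : act u (Ev i) = u by rewrite -actM Ev_mul eqxx.
have wE : act (g lj) (Ev j) = g lj by rewrite -hg L_Ev.
have war x y : act (g lj) (ar x y) = 0 by rewrite -hg L_ar linear0.
have uar x : exists c, act u (ar i x) = c *: g lj by apply: kerw; rewrite hf L_ar.
have uar0 x : x != j -> act u (ar i x) = 0.
  move=> xj; have [c e] := uar x; have <- : act (act u (ar i x)) (Ev x) = act u (ar i x).
    by rewrite -actM ar_Ev eqxx.
  by rewrite e actZ -hg L_Ev_neq 1?eq_sym // linear0 scaler0.
have full x : exists a b, x = a *: u + b *: g lj.
  have [a ea] := lig (f x); have [|b eb] := kerw (x - a *: u).
    by rewrite linearB linearZ /= fu ea subrr.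
  by exists a, b; rewrite -eb addrC subrK.
have [c ec] := uar j.
have c0 : c != 0.
  apply/negP => /eqP c0; rewrite c0 scale0r in ec.
  have uar' x y : act u (ar x y) = 0.
    rewrite -uE -actM Ev_ar; case: eqP => [<-|_]; last exact: actr0.
    by case: (eqVneq y j) => [->//|]; exact: uar0.
  have su : submod <[u]>%VS.
    move=> x b /vlineP[a ->].
    have lb : linear (fun b : B => act (a *: u) b) by move=> d x1 x2; rewrite actDr actZr.
    have [h hE] := ex_lfun lb; rewrite -hE memv_preim.
    rewrite (B_span (z := Z) (U := (h @^-1: <[u]>)%VS)) ?memvf // => [v|v v'|v];
      rewrite -memv_preim hE actZ.
    + rewrite -uE -actM Ev_mul; case: ifP => _; rewrite ?actr0 ?scaler0 ?mem0v //.
      by rewrite uE memvZ ?memv_line.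
    + by rewrite uar' scaler0 mem0v.
    by have [->|[z ->]] := cyc_cases v; rewrite ?actr0 ?actM ?uar' ?act0 scaler0 mem0v.
  have [/subvP/(_ u (memv_line _))|/subvP/(_ (g lj))] := uM _ _ su sS.
    by rewrite SU -RU memv_ker fu (negbTE li0).
  rewrite memv_img ?memvf // => /(_ isT)/vlineP[a ea].
  move: w0; rewrite -wE ea actZ -uE -actM Ev_mul (negbTE ij) actr0 scaler0 eqxx //.
have aij : adj i j.
  apply/negPn/negP => na; move: ec; rewrite ar_nadj // actr0 => /esym/eqP.
  by rewrite scaler_eq0 (negbTE c0) (negbTE w0).
exists u, (c *: g lj); split.
- exact: uE.
- by rewrite actZ wE.
- by rewrite scaler_eq0 negb_or c0.
- move=> x; have [a [b ->]] := full x; exists a, (b / c).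
  by rewrite scalerA divfK.
split=> [x|x|]; last by right.
  by case: (eqVneq x j) => [->|/uar0//]; rewrite aij.
by rewrite actZ war scaler0.
Qed.

Lemma frame_End t s M (u w : M) (f : 'Hom(M, M)) : frame t s u w -> rhom f ->
  exists c, forall x, f x = c *: x.
Proof.
move=> [uE wE w0 full [uar war ts]] hf.
have [c hc] : exists c, f u = c *: u.
  have [a [b e]] := full (f u); case: ts => [[ets euw]|ats].
    by exists (a + b); rewrite e euw scalerDl.
  exists a; rewrite -uE hf e actD !actZ uE -wE -actM Ev_mul.
  by rewrite eq_sym (negbTE (adj_neq ats)) actr0 scaler0 addr0.
have hw : f w = c *: w.
  case: ts => [[_ <-]//|ats].
  by have := uar s; rewrite eqxx ats /= => <-; rewrite hf hc actZ.
exists c => x; have [a [b ->]] := full x.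
by rewrite linearP linearZ /= hc hw scalerDr !scalerA ![_ * c]mulrC.
Qed.

Lemma frame_ar t s M (u w : M) : frame t s u w -> forall i j,
  act u (ar i j) = if [&& i == t, j == s & adj t s] then w else 0.
Proof.
move=> [uE wE w0 full [uar war ts]] i j.
rewrite -uE -actM Ev_ar [t == i]eq_sym; case: eqP => [->|_] /=; last exact: actr0.
exact: uar.
Qed.

Lemma frame_arw t s M (u w : M) : frame t s u w -> forall i j, act w (ar i j) = 0.
Proof.
move=> [uE wE w0 full [uar war ts]] i j.
by rewrite -wE -actM Ev_ar; case: eqP => [<-|_]; rewrite ?actr0 ?war.
Qed.

Lemma frame_cyc t s M (u w : M) : frame t s u w -> forall (x : M) i, act x (cyc i) = 0.
Proof.
move=> F; have [uE wE w0 full _] := F => x i; have [a [b ->]] := full x.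
have [->|[z ->]] := cyc_cases i; first exact: actr0.
rewrite actM !(actD, actZ) (frame_arw F) act0 scaler0 addr0 (frame_ar F).
by case: ifP => _; rewrite ?(frame_arw F) ?act0 scaler0.
Qed.

Lemma frame_dim t s M (u w : M) : frame t s u w -> (0 < \dim {:M} <= 2)%N.
Proof.
move=> [uE wE w0 full _]; apply/andP; split.
  rewrite lt0n dimv_eq0; apply: contraNneq w0 => e.
  by rewrite -memv0 -e memvf.
have -> : fullv = <<[:: u; w]>>%VS :> {vspace M}.
  apply/vspaceP => x; rewrite memvf; apply/esym; have [a [b ->]] := full x.
  by rewrite memvD // memvZ // memv_span // !inE eqxx ?orbT.
exact: dim_span.
Qed.

Lemma frame_notnull t s M (u w : M) : frame t s u w -> ~ rnull M.
Proof. by move=> [_ _ /eqP w0 _ _] /rnullP h; case: w0. Qed.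

Lemma frame_dim2 t s M (u w : M) : frame t s u w -> t != s -> \dim {:M} = 2.
Proof.
move=> F ts; have [uE wE w0 full [_ _ [[e _]|ats]]] := F; first by rewrite e eqxx in ts.
apply/eqP; rewrite eqn_leq (andP (frame_dim F)).2 /= ltnNge; apply/negP => d1.
have e : <[w]>%VS = fullv.
  by apply/eqP; rewrite eqEdim subvf dim_vline w0.
have : u \in <[w]>%VS by rewrite e memvf.
case/vlineP => c ec; move: w0.
have := frame_ar F t s; rewrite !eqxx ats /= => <-.
by rewrite ec actZ (frame_arw F) scaler0 eqxx.
Qed.

(** * Indecomposable projective modules *)

Section Projectives.
Variables (P : 'I_n -> rmodule B).
Hypothesis hP : forall i, projective_cover (P i) (L i).

(** The first three clauses say that [b] -> [act p b] identifies [e_v B] with [P v]; the last one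
    that [p] is nonzero in the top. *)
Definition generator v (p : P v) := [/\ act p (Ev v) = p, forall x, exists b, x = act p b,
   forall b, act p b = 0 -> Ev v * b = 0
  & exists2 f : 'Hom(P v, L v), rhom f & f p != 0].

Lemma proj_P v : projective (P v).
Proof. by have [] := hP v. Qed.

Lemma generator_ex v : exists p : P v, generator p.
Proof.
have [pP [f [hf sf sup]]] := hP v; have [l l0 lg] := L_gen v.
have [x fx] := (limg_surj f).1 sf l.
pose p := act x (Ev v).
have fp : f p = l by rewrite hf fx L_Ev.
have pE : act p (Ev v) = p by rewrite -actM Ev_mul eqxx.
have [q hq qE] := rhom_gen p.
have sq : surj q.
  apply/limg_surj/sup; first exact: limg_submod.
  apply/vspaceP => y; rewrite memvf; have [c ec] := lg (f y).
  have -> : y = q (c *: 1 : B) + (y - c *: p) by rewrite qE actZr act1 addrC subrK.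
  apply: memv_add; first by rewrite memv_img ?memvf.
  by rewrite memv_ker linearB linearZ /= fp ec subrr.
have [s hs sE] := projP pP hq sq (@rhom_id _ _ (P v)).
have {}sE y : act p (s y) = y by rewrite -qE sE id_lfunE.
pose z : B := s p.
have zE : z * Ev v = z by rewrite -[LHS](hs p (Ev v)) pE.
have [a [e ez]] := Ev_form2 v z.
(* The coefficient [a] is read off in [L v], where [cyc v] acts as zero. Hence [e_v z] is
   [e_v + e cyc v], which is invertible in [e_v B e_v]. *)
have a1 : a = 1.
  have : f p = a *: f p.
    rewrite -{1}(sE p) -/z -zE -pE -actM mulrA ez hf actDr !actZr.
    by rewrite L_Ev L_cyc scaler0 addr0 hf L_Ev.
  rewrite fp => /eqP; rewrite -subr_eq0 -{1}[l]scale1r -scalerBl scaler_eq0 (negbTE l0) orbF.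
  by rewrite subr_eq0 => /eqP.
exists p; split=> //.
- by move=> y; have [b <-] := sq y; exists b; rewrite qE.
- move=> b pb0.
  have zb : z * b = 0 by rewrite -[LHS](hs p b) pb0 linear0.
  have inv : (Ev v - e *: cyc v) * (Ev v * z) = Ev v.
    rewrite -{1}zE [Ev v * _]mulrA ez a1 scale1r mulrDr !mulrBl -!scalerAl -!scalerAr Ev_mul eqxx.
    by rewrite cyc_Ev Ev_cyc eqxx cyc_cyc !scaler0 subr0 subrK.
  by rewrite -inv -2!mulrA zb !mulr0.
- by exists f; rewrite ?fp.
Qed.

Lemma Ev_inv v a e (y := a^-1 *: Ev v - (a^-1 * e * a^-1) *: cyc v) : a != 0 ->
  [/\ (a *: Ev v + e *: cyc v) * y = Ev v, y * (a *: Ev v + e *: cyc v) = Ev v & Ev v * y = y].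
Proof.
move=> a0; split; rewrite ?(mulrDl, mulrBr, mulrBl, mulrDr) -?scalerAl -?scalerAr
  Ev_mul ?Ev_cyc ?cyc_Ev ?cyc_cyc eqxx //.
  rewrite !scaler0 subr0 !scalerA divff // scale1r -addrA -scaleNr -scalerDl.
  by rewrite [X in X *: cyc v](_ : _ = 0) ?scale0r ?addr0 //; field.
rewrite !mulNr -!scalerAl cyc_Ev eqxx cyc_cyc !scaler0 oppr0 scaler0 addr0 scalerN.
rewrite !scalerA mulVf //.
rewrite scale1r -addrA -scaleNr -scalerDl.
by rewrite [X in X *: cyc v](_ : _ = 0) ?scale0r ?addr0 //; field.
Qed.

Section Generated.
Variables (v : 'I_n) (p : P v).
Hypothesis hp : generator p.

Lemma gen_hom M (m : M) : act m (Ev v) = m ->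
  exists2 f : 'Hom(P v, M), rhom f & f p = m.
Proof.
move=> mE; have [pE pg p0 _] := hp.
have [q hq qE] := rhom_gen p; have [r hr rE] := rhom_gen m.
have sq : surj q by move=> y; have [b ->] := pg y; exists b; rewrite qE.
have [h hh hE] : exists2 h : 'Hom(P v, M), rhom h & forall x, h (q x) = r x.
  apply: fact_surj => // b; rewrite qE rE => /p0 e.
  by rewrite -mE -actM e actr0.
by exists h => //; rewrite -[p]act1 -(qE (1 : B)) hE rE act1.
Qed.

(** The component of [y] at [v] is [p] times an element of [e_v B e_v] whose coefficient [a] is
    nonzero, that is, times a unit. *)
Lemma P_top (f : 'Hom(P v, L v)) (y : P v) : rhom f -> f y != 0 ->
  exists b, act y b = p.
Proof.
move=> hf fy; have [pE pg p0 _] := hp.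
have [b0 eb] := pg y; have [a [e ez]] := Ev_form2 v b0.
have yE : act y (Ev v) = act p (a *: Ev v + e *: cyc v).
  by rewrite eb -{1}pE -!actM mulrA ez.
have a0 : a != 0.
  apply: contraNneq fy => a0; rewrite -(L_Ev (f y)) -hf yE a0 hf scale0r add0r.
  by rewrite actZr L_cyc scaler0.
have [e1 e2 e3] := Ev_inv v e a0.
exists (Ev v * (a^-1 *: Ev v - (a^-1 * e * a^-1) *: cyc v)).
by rewrite actM yE -actM e1 pE.
Qed.

(* A map [M -> P v] is determined by its composite with the functional reading off *)
(* the coefficient of [cyc v]; the formula recovers the other coefficients by      *)
(* multiplying with the dual basis [cyc v], [ar w v], [Ev v].                      *)
Lemma P_cogen M (lam : 'Hom(M, k^o)) : exists2 G : 'Hom(M, P v), rhom G & forall m,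
  G m = act p ((lam (act m (cyc v)) : k) *: Ev v
    + \sum_w (lam (act m (ar w v)) : k) *: ar v w + (lam (act m (Ev v)) : k) *: cyc v).
Proof.
pose F (m : M) : B := (lam (act m (cyc v)) : k) *: Ev v
    + \sum_w (lam (act m (ar w v)) : k) *: ar v w + (lam (act m (Ev v)) : k) *: cyc v.
have lc (b : B) : linear (fun m : M => lam (act m b)).
  by move=> c x y; rewrite actD actZ linearP.
have lF : linear F.
  apply: linear_addf; last exact: linear_scalef.
  by apply: linear_addf; [exact: linear_scalef|apply: linear_sumf => w; exact: linear_scalef].
have lG : linear (fun m => act p (F m)).
  by move=> c x y; rewrite lF actDr actZr.
have [G GE] := ex_lfun lG; exists G => //.
have [pE pg p0 _] := hp.
apply: rhom_gens => [m i|m i j]; rewrite !GE -actM; congr (act p _).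
  rewrite /F -!actM Ev_cyc Ev_mul !mulrDl -!scalerAl Ev_mul mulr_suml cyc_Ev.
  rewrite [i == v]eq_sym; congr (_ + _ + _).
  - by case: eqP => [->|_]; rewrite ?actr0 ?linear0 ?scale0r ?scaler0.
  - rewrite (bigD1 i) //= [in RHS](bigD1 i) //= -!actM Ev_ar eqxx -scalerAl ar_Ev eqxx.
    congr (_ + _); rewrite !big1 // => w wi.
      by rewrite -scalerAl ar_Ev eq_sym (negbTE wi) scaler0.
    by rewrite -actM Ev_ar eq_sym (negbTE wi) actr0 linear0 scale0r.
  - by case: eqP => [->|_]; rewrite ?actr0 ?linear0 ?scale0r ?scaler0.
rewrite /F -!actM ar_cyc actr0 linear0 scale0r add0r !mulrDl -!scalerAl Ev_ar cyc_ar.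
rewrite scaler0 addr0 mulr_suml ar_Ev; congr (_ + _).
  rewrite (bigD1 j) //= big1 ?addr0 => [|w wj]; last first.
    by rewrite -actM ar_mul eq_sym (negbTE wj) actr0 linear0 scale0r.
  rewrite -actM ar_mul eqxx /=; case: (eqVneq v i) => [<-|vi]; last first.
    by rewrite /= actr0 linear0 scale0r scaler0.
  case: (boolP (adj v j)) => h; first by rewrite ?eqxx.
  by rewrite (ar_nadj h) !scaler0.
rewrite (bigD1 i) //= big1 ?addr0 => [|w wi]; last first.
  by rewrite -scalerAl ar_mul (negbTE wi) scaler0.
rewrite -scalerAl ar_mul eqxx /=; case: eqP => [<-|_]; last first.
  by rewrite actr0 linear0 scale0r scaler0.
case: (boolP (adj i v)) => h; first by rewrite adj_sym h.
by rewrite (ar_nadj h) actr0 linear0 !scale0r.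
Qed.

(** The functional [phP] sends [act p b] to the coefficient of [cyc v] in [e_v b]. Extend [phP \o f]
    linearly along [i], by the pseudo-inverse of [i], and let [P_cogen] turn the result into a
    homomorphism. It restricts to [f] because an element of [e_v B] is recovered from the values of
    [phi] on its products with [cyc v], the arrows into [v] and [Ev v]. *)
Lemma generator_injmod : v.+1 != n -> injmod (P v).
Proof.
move=> hv M N i f hi ii hf; have [pE pg p0 _] := hp.
have [phi [phE pha phc]] := cycle_functional hv.
have [q hq qE] := rhom_gen p.
have sq : surj q by move=> y; have [b ->] := pg y; exists b; rewrite qE.
have lr : linear (fun y : P v => phi (Ev v * (q^-1)%VF y)).
  by move=> c x y; rewrite linearP mulrDr -scalerAr linearP.
have [phP phPE] := ex_lfun lr.
have {}phPE b : phP (act p b) = phi (Ev v * b).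
  rewrite phPE; congr (phi _); apply/eqP; rewrite -subr_eq0 -mulrBr; apply/eqP/p0.
  by rewrite -qE linearB /= limg_lfunVK ?qE ?subrr // -qE memv_img ?memvf.
have [G hG GE] := P_cogen (phP \o f \o i^-1)%VF.
have iK m : (i^-1)%VF (i m) = m by rewrite lker0_lfunK //; apply/lker0P.
exists G => // m; rewrite GE -!hi !comp_lfunE !iK hf.
have [b eb] := pg (f m).
have -> : \sum_w ((phP \o f \o i^-1)%VF (act (i m) (ar w v)) : k) *: ar v w =
    \sum_w (phi (Ev v * (b * ar w v)) : k) *: ar v w.
  by apply: eq_bigr => w _; rewrite -hi !comp_lfunE iK hf eb -actM phPE.
rewrite hf eb -!actM !phPE.
have l1 : linear (fun b : B => Ev v * b) by move=> c x y; rewrite mulrDr scalerAr.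
have l2 : linear (fun b : B => (phi (Ev v * (b * cyc v)) : k) *: Ev v
    + \sum_w (phi (Ev v * (b * ar w v)) : k) *: ar v w
    + (phi (Ev v * (b * Ev v)) : k) *: cyc v).
  have lc (b' : B) : linear (fun b : B => phi (Ev v * (b * b'))).
    by move=> c x y; rewrite mulrDl mulrDr -!scalerAl -scalerAr linearP.
  apply: linear_addf; last exact: linear_scalef.
  by apply: linear_addf; [exact: linear_scalef|apply: linear_sumf => w; exact: linear_scalef].
have [f1 f1E] := ex_lfun l1; have [f2 f2E] := ex_lfun l2.
rewrite -f2E -[in RHS]pE -actM -f1E; congr (act p _); apply/esym.
apply: B_ext => [i0|i0 j|i0]; rewrite f1E f2E.
- rewrite Ev_cyc; case: (eqVneq i0 v) => [->|iv]; last first.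
    rewrite !mulr0 linear0 scale0r add0r Ev_mul eq_sym (negbTE iv).
    rewrite Ev_mul (negbTE iv) mulr0 linear0 scale0r addr0 big1 // => w _.
    by rewrite mulrA Ev_mul eq_sym (negbTE iv) mul0r linear0 scale0r.
  rewrite Ev_cyc eqxx phc eqxx scale1r !Ev_mul eqxx Ev_mul eqxx phE scale0r addr0.
  rewrite big1 ?addr0 // => w _; rewrite mulrA Ev_mul eqxx.
  by rewrite Ev_ar; case: ifP => _; rewrite ?pha ?linear0 scale0r.
- rewrite ar_cyc mulr0 linear0 scale0r add0r ar_Ev.
  have -> : Ev v * (if v == j then ar i0 j else 0) = if (v == j) && (v == i0) then ar i0 j else 0.
    by case: ifP => _; rewrite ?mulr0 // Ev_ar.
  rewrite (_ : phi (if _ then _ else _) = 0) ?scale0r ?addr0; last first.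
    by case: ifP => _; rewrite ?pha ?linear0.
  rewrite Ev_ar; case: (eqVneq v i0) => [<-|vi]; last first.
    rewrite big1 // => w _.
    by rewrite mulrA Ev_ar (negbTE vi) mul0r linear0 scale0r.
  rewrite (bigD1 j) //= big1 ?addr0 => [|w wj]; last first.
    by rewrite ar_mul eq_sym (negbTE wj) mulr0 linear0 scale0r.
  rewrite ar_mul !eqxx /=; case: (boolP (adj v j)) => h.
    by rewrite Ev_cyc eqxx phc eqxx scale1r.
  by rewrite (ar_nadj h) scaler0.
rewrite cyc_cyc mulr0 linear0 scale0r add0r big1 ?add0r => [|w _]; last first.
  by rewrite cyc_ar mulr0 linear0 scale0r.
rewrite Ev_cyc cyc_Ev; case: (eqVneq v i0) => [<-|vi]; last by rewrite mulr0 linear0 scale0r.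
by rewrite Ev_cyc eqxx phc eqxx scale1r.
Qed.

Lemma P_End (f : 'Hom(P v, P v)) : rhom f -> exists a e, f p = act p (a *: Ev v + e *: cyc v).
Proof.
move=> hf; have [pE pg p0 _] := hp; have [b eb] := pg (f p).
have [a [e ez]] := Ev_form2 v b; exists a, e.
by rewrite -{1}pE hf eb -{1}pE -!actM mulrA ez.
Qed.

Lemma P_End_inv (f : 'Hom(P v, P v)) a e : rhom f -> f p = act p (a *: Ev v + e *: cyc v) ->
  a != 0 -> exists2 h : 'Hom(P v, P v), rhom h & forall x, h (f x) = x.
Proof.
move=> hf fe a0; have [pE pg p0 _] := hp.
have [|h hh he] := @gen_hom (P v) (act p (a^-1 *: Ev v - (a^-1 * e * a^-1) *: cyc v)).
  by rewrite -actM mulrBl -!scalerAl Ev_mul cyc_Ev eqxx.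
have [e1 e2 e3] := Ev_inv v e a0.
exists h => // x; have [b ->] := pg x.
by rewrite hf hh fe hh he -[act (act _ _) (a *: _ + _)]actM e2 pE.
Qed.

Lemma P_notnull : ~ rnull (P v).
Proof.
move=> /rnullP h; have [_ _ _ [f _]] := hp.
by rewrite (h p) linear0 eqxx.
Qed.

End Generated.

Lemma P_local v : local (P v).
Proof.
have [p hp] := generator_ex v.
apply: local_of; first exact: P_notnull hp.
move=> f hf; have [a [e fe]] := P_End hp hf.
have [pE _ _ _] := hp.
case: (eqVneq a 0) => [a0|a0]; last by left; exact: P_End_inv hp _ _ _ hf fe a0.
right; have hg : rhom (\1 - f)%VF by apply: rhomB => //; exact: rhom_id.
have ge : (\1 - f)%VF p = act p (1 *: Ev v + (- e) *: cyc v).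
  rewrite add_lfunE opp_lfunE id_lfunE fe a0 scale0r add0r scale1r scaleNr.
  by rewrite actDr pE -[- (e *: cyc v)]scaleN1r [act p (- _ *: _)]actZr scaleN1r.
have [h hh hE] := P_End_inv hp hg ge (oner_neq0 _).
by exists h => // x; rewrite -[RHS]hE add_lfunE opp_lfunE id_lfunE.
Qed.

Lemma frame_local t s M (u w : M) : frame t s u w -> local M.
Proof.
move=> F; apply: local_of; first exact: frame_notnull F.
move=> f hf; have [c hc] := frame_End F hf.
case: (eqVneq c 0) => [c0|c0].
  by right; exists \1%VF => [|x]; [exact: rhom_id|rewrite id_lfunE hc c0 scale0r subr0].
left; exists (c^-1 *: \1)%VF => [|x]; first by apply: rhomZ; exact: rhom_id.
by rewrite scale_lfunE id_lfunE hc scalerA mulVf // scale1r.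
Qed.

Lemma L_surj X i (f : 'Hom(X, L i)) x : f x != 0 -> surj f.
Proof.
move=> fx y; have [l l0 lg] := L_gen i; have [c ec] := lg (f x); have [d ed] := lg y.
have c0 : c != 0 by apply: contraNneq fx => c0; rewrite ec c0 scale0r.
by exists ((d / c) *: x); rewrite linearZ /= ec ed scalerA divfK.
Qed.

(** Lifting [f] to [P i] sends [x] to a generator ([P_top]), so the lift is onto and splits. *)
Lemma proj_top X i (f : 'Hom(X, L i)) x : projective X -> rhom f -> f x != 0 ->
  retract (P i) X.
Proof.
move=> pX hf fx; have [p hp] := generator_ex i; have [pE pg p0 [r hr rp]] := hp.
have [g hg gE] := projP pX hr (L_surj rp) hf.
have [b eb] : exists b, act (g x) b = p by apply: (P_top hp hr); rewrite gE.
have sg : surj g by move=> y; have [c ->] := pg y; exists (act (act x b) c); rewrite !hg eb.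
have [s hs sE] := projP (@proj_P i) hg sg (@rhom_id _ _ (P i)).
by exists s, g; split=> // y; rewrite sE id_lfunE.
Qed.

Lemma proj_notnull_top X : projective X -> ~ rnull X -> exists i, retract (P i) X.
Proof.
move=> pX /nakayama[i [g [hg [x gx]]]]; exists i; exact: proj_top pX hg gx.
Qed.

Lemma P_injmod v : v.+1 != n -> injmod (P v).
Proof. by have [p hp] := generator_ex v; apply: generator_injmod hp. Qed.

(** * Projective-injective covers and Ext into modules with top L(n) *)

Section Classification.
Variable lst : 'I_n.
Hypothesis lstE : lst.+1 = n.

Lemma succ_neq_lst v : (v.+1 != n) = (v != lst).
Proof.
apply/idP/idP; apply: contraNneq; first by move=> ->; exact/eqP.
by move=> e; apply/eqP/val_inj/eq_add_S; rewrite lstE.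
Qed.

(** The last clause replaces an explicit decomposition into modules [P v] with [v] different from
    [lst]. *)
Definition projinj F := [/\ projective F, injmod F &
  forall M, local M -> retract M F -> exists2 v : 'I_n, v.+1 != n & retract M (P v)].

Lemma projinj0 : projinj (rzero B).
Proof.
split; [exact/proj_null/rnull_rzero|exact/injmod_null/rnull_rzero|].
move=> M [nM _] [i [p [_ _ e]]]; case: nM; apply/rnullP => x.
by rewrite -(e x) (rzero_eq0 (i x)) linear0.
Qed.

Lemma projinjD M N : projinj M -> projinj N -> projinj (rdsum M N).
Proof.
move=> [pM iM rM] [pN iN rN]; split; [exact: proj_rdsum|exact: injmod_rdsum|].
move=> X lX rX; have [h|h] := lX.2 _ _ rX; [exact: rM h|exact: rN h].
Qed.

Lemma projinjP v : v.+1 != n -> projinj (P v).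
Proof. by move=> hv; split; [exact: proj_P|exact: P_injmod|move=> M lM rM; exists v]. Qed.

(** The largest image of such modules contains the component of [X] at every vertex other than
    [lst]. It then contains the images of all arrows, because an arrow starts or ends at such a
    vertex. What is missing lies in the top at [lst] and would give a nonzero map to [L lst]. *)
Lemma projinj_cover X : (forall g : 'Hom(X, L lst), rhom g -> forall x, g x = 0) ->
  exists (F : rmodule B) (f : 'Hom(F, X)), [/\ projinj F, rhom f & surj f].
Proof.
move=> noL; have [F [f [pF hf mf]]] := max_image X projinj0 projinjD.
exists F, f; split=> //; apply/limg_surj/eqP; apply/negPn/negP => ne.
have [x xU] : exists x : X, x \notin limg f.
  have : ~~ (fullv <= limg f)%VS by apply: contra ne => h; rewrite eqEsubv subvf.
  by case/subvPn => x _ xU; exists x.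
have sU := limg_submod hf.
have EU y v : v != lst -> act y (Ev v) \in limg f.
  move=> vl; have [p hp] := generator_ex v.
  have [|g hg <-] := gen_hom hp (m := act y (Ev v)); first by rewrite -actM Ev_mul eqxx.
  by apply: mf => //; apply: projinjP; rewrite succ_neq_lst.
have aU y i j : act y (ar i j) \in limg f.
  case: (eqVneq i lst) => [->|il].
    case: (boolP (adj lst j)) => [h|h]; last by rewrite ar_nadj // actr0 mem0v.
    rewrite -[act y _](_ : act (act y (ar lst j)) (Ev j) = _) ?EU //.
      by rewrite eq_sym adj_neq.
    by rewrite -actM ar_Ev eqxx.
  rewrite -[act y _](_ : act (act y (Ev i)) (ar i j) = _); first exact/sU/EU.
  by rewrite -actM Ev_ar eqxx.
have [lam lx lU] := exists_functional xU.
have [g [hg gx]] := @hom_to_L X lst lam (fun x j l => lU _ (aU x j l)).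
have /gx/eqP[] : lam (act x (Ev lst)) != 0; last exact: noL.
apply: contraNneq lx => l0.
rewrite -(act1 x) -(Ev_sum Z) act_sumr linear_sum big1 // => i _.
by case: (eqVneq i lst) => [->|il]; [exact: l0|exact: lU (EU _ _ il)].
Qed.

(* Ext^1(Y, X) = 0 passes to the quotient [L lst] of [X] because [Y] has projective *)
(* dimension one. In a presentation of [Y] of minimal dimension, maps from the      *)
(* projective module to [L lst] kill the kernel, which hence is injective.          *)
Lemma pd1_top_split X Y (q : 'Hom(X, L lst)) : rhom q -> (exists x, q x != 0) ->
  pd_le 1 Y -> ext_eq0 0 Y X -> projective Y.
Proof.
move=> hq [x0 qx0] pY eY; have sq := L_surj qx0.
suff H m (K Q : rmodule B) (i : 'Hom(K, Q)) (p : 'Hom(Q, Y)) : projective Q -> ses i p ->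
    (\dim {:Q} <= m)%N -> projective Y.
  by have [K [Q [i [p [pQ s]]]]] := enough_proj_ses Y; apply: H pQ s (leqnn _).
elim: m K Q i p => [|m IH] K Q i p pQ s dQ; have [hi hp ii sp ex] := s.
  have /rnullP Q0 : rnull Q by apply/eqP; rewrite -leqn0.
  apply/proj_null/rnullP => y; have [x <-] := sp y.
  by rewrite (Q0 x) linear0.
have pK : projective K := pY _ _ _ _ pQ s.
have extL (g : 'Hom(K, L lst)) : rhom g ->
    exists2 h : 'Hom(Q, L lst), rhom h & forall x, h (i x) = g x.
  move=> hg; have [g' hg' g'E] := projP pK hq sq hg.
  have [h hh hE] := eY _ _ _ _ pQ s g' hg'.
  by exists (q \o h)%VF => [|x]; [exact: rhom_comp|rewrite comp_lfunE hE g'E].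
have [|nex] := classic (exists (h : 'Hom(Q, L lst)) x, rhom h /\ h (i x) != 0); last first.
  have K0 (g : 'Hom(K, L lst)) : rhom g -> forall x, g x = 0.
    move=> hg x; have [h hh hE] := extL g hg; rewrite -hE.
    by apply/eqP/negPn/negP => ne; apply: nex; exists h, x.
  have [F [f [[pF iF _] hf sf]]] := projinj_cover K0.
  have r : retract K F.
    have [s' hs' sE] := projP pK hf sf (@rhom_id _ _ K).
    by exists s', f; split=> // x; rewrite sE id_lfunE.
  have [rY _] := injmod_ses_split s (retract_injmod r iF).
  exact: retract_proj rY pQ.
(* A map [h] that does not kill [K] lifts to [h' : Q -> P lst] with a section through [K]. Thus
   [P lst] splits off both [K] and [Q], and [Y] is already covered by the smaller projective [K'],
   the kernel of [h']. *)
move=> [h [x [hh hx]]].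
have [p0 hp0] := generator_ex lst; have [pE pg pn [r hr rp]] := hp0.
have [h' hh' hE'] := projP pQ hr (L_surj rp) hh.
have [b eb] : exists b, act (h' (i x)) b = p0 by apply: (P_top hp0 hr); rewrite hE'.
have [|g hg gE] := gen_hom hp0 (m := act (act x b) (Ev lst)).
  by rewrite -actM Ev_mul eqxx.
have hgK y : h' (i (g y)) = y.
  have [c ->] := pg y; rewrite hg gE !hi !hh' eb.
  by rewrite pE.
have [K' [j [hj ij kj dj]]] := ker_ex hh'.
pose t := (\1 - (i \o (g \o h')))%VF : 'Hom(Q, Q).
have tE y : t y = y - i (g (h' y)) by rewrite add_lfunE opp_lfunE id_lfunE !comp_lfunE.
have ht : rhom t by apply: rhomB; [exact: rhom_id|do 2![apply: rhom_comp => //]].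
have [t' ht' t'E] : exists2 t' : 'Hom(Q, K'), rhom t' & forall y, j (t' y) = t y.
  by apply: fact_inj => // y; apply/kj; rewrite tE linearB /= hgK subrr.
have pK' : projective K'.
  apply: retract_proj pQ; exists j, t'; split=> // y; apply: ij.
  have jk : h' (j y) = 0 by apply/kj; exists y.
  by rewrite t'E tE jk !linear0 addr0.
have spj : surj (p \o j)%VF.
  move=> y; have [z <-] := sp y; exists (t' z).
  by rewrite comp_lfunE t'E tE linearB /= (ses_comp0 _ s) subr0.
have [K2 [i2 s2]] := ker_ses (rhom_comp hp hj) spj.
apply: IH pK' s2 _; rewrite -ltnS; apply: leq_trans dQ.
rewrite -dj -[X in (X < _)%N]addn0 ltn_add2l lt0n dimv_eq0.
apply: contraNneq hx => l0; rewrite -hE'.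
have : h' (i x) \in limg h' by rewrite memv_img ?memvf.
by rewrite l0 memv0 => /eqP ->; rewrite linear0.
Qed.


(** * Exact sequences linking modules of length at most two *)

Lemma frame_functional t s M (u w : M) : frame t s u w ->
  exists2 lam : 'Hom(M, k^o), lam w = 1 & (t != s -> lam u = 0).
Proof.
move=> [uE wE w0 full _].
have [|f fw _] := exists_functional (U := 0%VS) (x := w); first by rewrite memv0.
have lf : linear (fun x : M => (f w)^-1 * f (act x (Ev s)) : k^o).
  by move=> c x y; rewrite actD actZ linearP mulrDr -scalerAr.
have [lam lamE] := ex_lfun lf; exists lam; first by rewrite lamE wE mulVf.
by move=> ts; rewrite lamE -uE -actM Ev_mul (negbTE ts) actr0 linear0 mulr0.
Qed.

Lemma act_cyc_neq0 s (p : P s) : generator p -> s.+1 != n -> act p (cyc s) != 0.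
Proof.
move=> [_ _ p0 _] hs; have [phi [_ _ phc]] := cycle_functional hs.
apply/eqP => /p0; rewrite Ev_cyc eqxx => c0.
by have := phc s; rewrite c0 linear0 eqxx => /esym/eqP; rewrite oner_eq0.
Qed.

(** Feeding [P_cogen] a functional with value 1 on the socle vector [w] gives a map that sends [w]
    to the nonzero [act p (cyc s)]. *)
Lemma frame_emb t s M (u w : M) (p : P s) : generator p -> s.+1 != n -> frame t s u w ->
  exists G : 'Hom(M, P s), [/\ rhom G, injective G, G w = act p (cyc s)
    & (t != s -> G u = act p (ar s t))].
Proof.
move=> hp hs F; have [lam lw lu] := frame_functional F.
have [G hG GE] := P_cogen hp lam; have [uE wE w0 full [uar war ts]] := F.
have Gw : G w = act p (cyc s).
  rewrite GE (frame_cyc F) linear0 scale0r add0r wE lw scale1r big1 ?add0r // => i _.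
  by rewrite (frame_arw F) linear0 scale0r.
have Gu : t != s -> G u = act p (ar s t).
  move=> nts; case: ts => [[e _]|ats]; first by rewrite e eqxx in nts.
  rewrite GE (frame_cyc F) linear0 scale0r add0r -{2}uE -actM Ev_mul (negbTE nts).
  rewrite actr0 linear0 scale0r addr0 (bigD1 t) //= big1 ?addr0 => [|i it].
    by rewrite (frame_ar F) !eqxx ats /= lw scale1r.
  by rewrite (frame_ar F) (negbTE it) linear0 scale0r.
have pc := act_cyc_neq0 hp hs.
exists G; split=> //; apply: injP0 => x; have [a [b ->]] := full x.
rewrite linearD !linearZ /= Gw; case: ts => [[_ euw]|ats].
  rewrite euw Gw -!scalerDl => /eqP; rewrite scaler_eq0 (negbTE pc) orbF => /eqP ->.
  by rewrite scale0r.
rewrite Gu ?adj_neq // => e.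
have a0 : a = 0.
  have := congr1 (fun y => act y (ar t s)) e.
  rewrite actD !actZ -!actM cyc_ar actr0 scaler0 addr0 act0 ar_mul !eqxx adj_sym ats /=.
  by move=> /eqP; rewrite scaler_eq0 (negbTE pc) orbF => /eqP.
move: e; rewrite a0 scale0r add0r => /eqP; rewrite scaler_eq0 (negbTE pc) orbF => /eqP ->.
by rewrite !scale0r addr0.
Qed.

(** [P s] is spanned by [p] and its products with the arrows to [t] and [s'] and with [cyc s]. The
    image of [M] is spanned by the products with the arrow to [t] and with [cyc s]; [M'] is what
    remains. The cases [t = s] and [s = s'] serve the simple module L(1) in the middle of the
    chain. *)
Lemma frame_ses t s s' M M' (u w : M) (u' w' : M') : frame t s u w -> frame s s' u' w' ->
  s.+1 != n -> t != s' -> (forall x, adj s x -> x = t \/ x = s') ->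
  exists (i : 'Hom(M, P s)) (q : 'Hom(P s, M')), ses i q.
Proof.
move=> F F' hs ts' nb; have [p hp] := generator_ex s.
have [G [hG iG Gw Gu]] := frame_emb hp hs F.
have [uE wE w0 full [uar war ts]] := F.
have [uE' wE' w0' full' [uar' war' ss']] := F'.
have [q hq qp] := gen_hom hp uE'; have [pE pg _ _] := hp.
exists G, q; split=> //.
  move=> y; have [a [b ->]] := full' y; case: ss' => [[_ <-]|ass].
    by exists ((a + b) *: p); rewrite linearZ /= qp scalerDl.
  exists (act p (a *: 1 + b *: ar s s')).
  by rewrite hq qp actDr !actZr act1 uar' eqxx ass.
move=> y; split=> [|[x ->]]; last first.
  have qw : q (G w) = 0 by rewrite Gw hq qp (frame_cyc F').
  have [a [b ->]] := full x; rewrite !linearD !linearZ /= qw scaler0 addr0.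
  case: ts => [[_ ->]|ats]; first by rewrite qw scaler0.
  by rewrite Gu ?adj_neq // hq qp uar' (negbTE ts') scaler0.
have [b ->] := pg y; have [a [d [e eb]]] := Ev_form s b.
rewrite hq qp -{1}uE' -actM eb !actDr !actZr uE' (frame_cyc F') scaler0 addr0 act_sumr.
have -> : \sum_w0 act u' (d w0 *: ar s w0) = if adj s s' then d s' *: w' else 0.
  rewrite (bigD1 s') //= big1 ?addr0 => [|x xs]; last first.
    by rewrite actZr uar' (negbTE xs) scaler0.
  by rewrite actZr uar' eqxx /=; case: ifP => _; rewrite ?scaler0.
move=> q0.
have [a0 d0] : a = 0 /\ (adj s s' -> d s' = 0).
  case: ss' q0 => [[es eu]|ass] q0.
    have nss : adj s s' = false by apply/negP => /adj_neq; rewrite es eqxx.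
    rewrite nss addr0 in q0 *; split=> //.
    by apply/eqP; move/eqP: q0; rewrite scaler_eq0 eu (negbTE w0') orbF.
  rewrite ass in q0.
  have a0 : a = 0.
    have := congr1 (fun y => act y (ar s s')) q0.
    rewrite act0 actD !actZ (frame_arw F') scaler0 addr0 uar' eqxx ass /=.
    by move=> /eqP; rewrite scaler_eq0 (negbTE w0') orbF => /eqP.
  split=> // _; move: q0; rewrite a0 scale0r add0r => /eqP.
  by rewrite scaler_eq0 (negbTE w0') orbF => /eqP.
have -> : act p b = act p (d t *: ar s t + e *: cyc s).
  rewrite -{1}pE -actM eb a0 scale0r add0r; congr (act p (_ + _)).
  rewrite (bigD1 t) //= big1 ?addr0 // => x xt.
  case: (boolP (adj s x)) => h; last by rewrite ar_nadj // scaler0.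
  by have [e1|e1] := nb x h; [rewrite e1 eqxx in xt|rewrite e1 d0 ?scale0r // -e1].
case: (eqVneq t s) => [e1|nts].
  exists (e *: w); rewrite linearZ /= Gw e1 actDr !actZr (_ : ar s s = 0) ?actr0 ?scaler0 ?add0r //.
  by apply: ar_nadj; apply/negP => /adj_neq; rewrite eqxx.
exists (d t *: u + e *: w); rewrite linearD !linearZ /= Gw Gu // actDr !actZr //.
Qed.

(** Meant for nabla(n). As for [P v], the coordinates of an element [y] of [M] are values of the
    single functional [lam] on multiples of [y], so extending a homomorphism reduces to extending a
    functional; the extension is equivariant because [cyc lst = 0]. *)
Lemma frame_lst_injmod t M (u w : M) : frame t lst u w -> adj t lst ->
  (forall x, adj x lst -> x = t) -> injmod M.
Proof.
move=> F atl nb; have [uE wE w0 full [uar war _]] := F.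
have [lam lw lu] := frame_functional F; have {}lu := lu (adj_neq atl).
have clst : cyc lst = 0 := cyc_last Z lstE.
have coord y : y = (lam (act y (ar t lst)) : k) *: u + (lam (act y (Ev lst)) : k) *: w.
  have uEl : act u (Ev lst) = 0.
    by rewrite -uE -actM Ev_mul (negbTE (adj_neq atl)) actr0.
  have [a [b ->]] := full y; rewrite !actD !actZ uar eqxx atl (frame_arw F) scaler0 addr0 /=.
  by rewrite uEl scaler0 add0r wE !linearZ /= lw ![_ *: 1]mulr1.
move=> X Y i f hi ii hf.
have iK m : (i^-1)%VF (i m) = m by rewrite lker0_lfunK //; apply/lker0P.
pose mu := (lam \o (f \o i^-1))%VF.
have lG : linear (fun m : Y => (mu (act m (ar t lst)) : k) *: u + (mu (act m (Ev lst)) : k) *: w).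
  have lc (b : B) : linear (fun m : Y => mu (act m b)).
    by move=> c x y; rewrite actD actZ linearP.
  by apply: linear_addf; exact: linear_scalef.
have [G GE] := ex_lfun lG; exists G => [|m]; last first.
  by rewrite GE -!hi !comp_lfunE iK iK !hf -coord.
have u_Ev j : act u (Ev j) = if t == j then u else 0.
  by rewrite -uE -actM Ev_mul; case: ifP => _; rewrite ?actr0.
have w_Ev j : act w (Ev j) = if lst == j then w else 0.
  by rewrite -wE -actM Ev_mul; case: ifP => _; rewrite ?actr0.
apply: rhom_gens => [m j|m x y]; rewrite !GE -!actM actD !actZ.
  rewrite Ev_ar Ev_mul u_Ev w_Ev [j == t]eq_sym; congr (_ + _).
    by case: ifP => _; rewrite ?actr0 ?linear0 ?scale0r ?scaler0.
  rewrite [j == lst]eq_sym; case: eqP => [->|_] //.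
  by rewrite actr0 linear0 scale0r scaler0.
rewrite ar_mul (frame_arw F) scaler0 addr0 (frame_ar F) ar_Ev.
have -> : (if [&& y == t, x == lst & adj x y] then cyc x else 0) = 0.
  by case: ifP => // /and3P[_ /eqP -> _].
rewrite actr0 linear0 scale0r add0r atl andbT [lst == y]eq_sym.
case: (eqVneq y lst) => [->|_]; last first.
  by rewrite actr0 linear0 scale0r andbF scaler0.
rewrite andbT; case: (eqVneq x t) => [->//|xt].
rewrite (_ : ar x lst = 0) ?actr0 ?linear0 ?scale0r ?scaler0 //.
by apply: ar_nadj; apply: contraNN xt => /nb ->.
Qed.

(** * The chain of standard and costandard modules *)

Section Sequence.
Hypothesis hn : (2 <= n)%N.
Variables (Delta nabla : 'I_n -> rmodule B).
Hypothesis hDelta0 : forall i, val i = 0%N -> Delta i = L i.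
Hypothesis hDelta : forall i j, val i = (val j).+1 -> exists u w : Delta i, frame i j u w.
Hypothesis hnabla : forall i j, val i = (val j).+1 -> exists u w : nabla i, frame j i u w.

Definition vtx (x : nat) : 'I_n := insubd lst x.

Lemma vtxE x : (x < n)%N -> vtx x = x :> nat.
Proof. by move=> h; rewrite [LHS]val_insubd h. Qed.

(* The set D listed as Delta(n), ..., Delta(1) = nabla(1), ..., nabla(n) and *)
(* indexed by 0, ..., 2n - 2; [DK x] has top [topK x] and socle [socK x].     *)
Definition DK x := if (x < n)%N then Delta (vtx (n.-1 - x)) else nabla (vtx (x - n.-1)).
Definition topK x := if (x < n)%N then vtx (n.-1 - x) else vtx (x - n).
Definition socK x := if (x < n.-1)%N then vtx (n.-2 - x) else vtx (x - n.-1).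

Lemma frame_DK x : (x <= n.-1.*2)%N -> exists u w : DK x, frame (topK x) (socK x) u w.
Proof.
move=> hx; rewrite /DK /topK /socK; case: ifP => xn; case: ifP => xn1; try lia.
- apply: hDelta; rewrite /= !vtxE; lia.
- have -> : (n.-1 - x = 0)%N by lia.
  have -> : (x - n.-1 = 0)%N by lia.
  have e0 : val (vtx 0) = 0%N by rewrite /= vtxE //; lia.
  rewrite (hDelta0 e0); exact: frame_L.
- apply: hnabla; rewrite /= !vtxE; lia.
Qed.

Lemma socK_neq x : (x < n.-1.*2)%N -> (socK x).+1 != n.
Proof.
by move=> hx; rewrite /socK; case: ifP => xn; apply/eqP; rewrite vtxE; lia.
Qed.

Lemma DK_ses x : (x < n.-1.*2)%N ->
  exists (i : 'Hom(DK x, P (socK x))) (q : 'Hom(P (socK x), DK x.+1)), ses i q.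
Proof.
move=> hx; have [|u [w F]] := @frame_DK x; first exact: ltnW.
have [u' [w' F']] := frame_DK hx.
have e : topK x.+1 = socK x.
  by rewrite /topK /socK; case: ifP => h1; case: ifP => h2; try lia; congr vtx; lia.
rewrite e in F'; apply: (frame_ses F F' (socK_neq hx)).
  by apply/eqP => /(congr1 (@nat_of_ord n)); rewrite /topK /socK;
    do 2!case: ifP => ?; rewrite !vtxE; lia.
move=> y; rewrite /adj /zigzag_adj /= => h.
suff : y = topK x :> nat \/ y = socK x.+1 :> nat.
  by move=> [/ord_inj ->|/ord_inj ->]; [left|right].
have := ltn_ord y; move: h; rewrite /socK /topK.
by do 3!case: ifP => ?; rewrite !vtxE; lia.
Qed.

Lemma DK_local x : (x <= n.-1.*2)%N -> local (DK x).
Proof. by move=> /frame_DK[u [w F]]; exact: frame_local F. Qed.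

Lemma DK_dim x : (x <= n.-1.*2)%N -> (0 < \dim {:DK x} <= 2)%N.
Proof. by move=> /frame_DK[u [w F]]; exact: frame_dim F. Qed.

Lemma P_dim v : v.+1 != n -> (2 < \dim {:P v})%N.
Proof.
(* For this [x] the middle term of [DK_ses] is [P v], and its quotient [DK x.+1] is a costandard
   module of dimension two. *)
move=> hv; have vn := ltn_ord v; pose x := (n.-1 + v)%N.
have hx : (x < n.-1.*2)%N by rewrite /x; lia.
have e : socK x = v by apply/ord_inj; rewrite /socK /x; case: ifP => ?; rewrite vtxE; lia.
have [i [q s]] := DK_ses hx; rewrite -e (ses_dim s).
have [|d _] := andP (@DK_dim x _); first exact: ltnW.
have [u [w F]] := frame_DK hx.
rewrite (frame_dim2 F) ?addn2 ?ltnS //.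
by apply/eqP => /(congr1 (@nat_of_ord n)); rewrite /topK /socK /x;
  do 2!case: ifP => ?; rewrite !vtxE; lia.
Qed.

Lemma DK_retract_P x v : (x <= n.-1.*2)%N -> v.+1 != n -> ~ retract (DK x) (P v).
Proof.
move=> hx hv r; have [nn _] := DK_local hx.
have /riso_dim e := retract_indecomposable (local_indecomposable (P_local v)) r nn.
by have := P_dim hv; rewrite -e; have := DK_dim hx; lia.
Qed.

(** At the last vertex the 2-cycle is zero and there is only one neighbour, so [P lst] has the same
    two basis vectors as Delta(n). *)
Lemma DK0_riso : riso (P lst) (DK 0).
Proof.
have [p hp] := generator_ex lst; have [pE pg p0 _] := hp.
have [//|u [w F]] := @frame_DK 0.
have et : topK 0 = lst by apply/ord_inj; rewrite /topK; case: ifP => ?; rewrite vtxE; lia.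
have as' : adj lst (socK 0).
  by rewrite /adj /zigzag_adj /= /socK; case: ifP => ?; rewrite vtxE; lia.
rewrite et in F; have [uE wE w0 full [uar war _]] := F.
have [q hq qp] := gen_hom hp uE.
apply: (riso_bij hq).
  apply: injP0 => y; have [b ->] := pg y; have [a [d [e eb]]] := Ev_form lst b.
  rewrite (cyc_last Z lstE) scaler0 addr0 in eb.
  have eS : \sum_w1 d w1 *: ar lst w1 = d (socK 0) *: ar lst (socK 0).
    rewrite (bigD1 (socK 0)) //= big1 ?addr0 // => x xs.
    rewrite ar_nadj ?scaler0 //; apply: contraNN xs => h; apply/eqP/ord_inj.
    have := ltn_ord x; move: h; rewrite /adj /zigzag_adj /=.
    by rewrite /socK; case: ifP => ?; rewrite vtxE; lia.
  rewrite -{1 2}pE -!actM eb eS hq qp !actDr !actZr uE uar eqxx as' /=.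
  move=> e0; have a0 : a = 0.
    have := congr1 (fun y => act y (ar lst (socK 0))) e0.
    rewrite act0 actD !actZ (frame_arw F) scaler0 addr0 uar eqxx as' /=.
    by move=> /eqP; rewrite scaler_eq0 (negbTE w0) orbF => /eqP.
  move: e0; rewrite a0 !scale0r !add0r => /eqP; rewrite scaler_eq0 (negbTE w0) orbF => /eqP ->.
  by rewrite scale0r.
move=> y; have [a [b ->]] := full y.
exists (act p (a *: 1 + b *: ar lst (socK 0))).
by rewrite hq qp actDr !actZr act1 uar eqxx as'.
Qed.

Lemma DK_last_injmod : injmod (DK n.-1.*2).
Proof.
have [u [w F]] := frame_DK (leqnn _).
have es : socK n.-1.*2 = lst.
  by apply/ord_inj; rewrite /socK; case: ifP => ?; rewrite vtxE; lia.
rewrite es in F; apply: (frame_lst_injmod F).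
  by rewrite /adj /zigzag_adj /= /topK; case: ifP => ?; rewrite vtxE; lia.
move=> x; rewrite /adj /zigzag_adj /= => h; apply/ord_inj.
have := ltn_ord x; move: h; rewrite /topK.
by case: ifP => ?; rewrite vtxE; lia.
Qed.

Implicit Types F T : rmodule B.

Lemma not_injmod_DK x : (x < n.-1.*2)%N -> ~ injmod (DK x).
Proof.
move=> hx iD; have [i [q [hi _ ii _ _]]] := DK_ses hx.
by apply: (DK_retract_P (ltnW hx) (socK_neq hx)); exact: injmod_retract hi ii iD.
Qed.

(* The maps [DK x -> K -> DK x] extend to [P -> F -> P] and induce an endomorphism *)
(* of [DK x.+1]; it is a scalar, which is nonzero as [P -> DK x.+1] does not split. *)
Lemma DK_step x X K F (j : 'Hom(K, F)) (g : 'Hom(F, X)) : (x < n.-1.*2)%N ->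
  injmod F -> ses j g -> retract (DK x) K -> retract (DK x.+1) X.
Proof.
move=> hx iF s [a [b [ha hb ba]]].
have [i [q sD]] := DK_ses hx; have [hi hq ii sq exq] := sD; have [hj hg ij sg exg] := s.
have iP := P_injmod (socK_neq hx).
have [f1 hf1 f1E] := iF _ _ i (j \o a)%VF hi ii (rhom_comp hj ha).
have [f2 hf2 f2E] := iP _ _ j (i \o b)%VF hj ij (rhom_comp hi hb).
have [g1 hg1 g1E] : exists2 g1 : 'Hom(DK x.+1, X), rhom g1 & forall y, g1 (q y) = (g \o f1)%VF y.
  apply: fact_surj => // [|y /exq[z ->]]; first exact: rhom_comp.
  by rewrite comp_lfunE f1E comp_lfunE (ses_comp0 _ s).
have [g2 hg2 g2E] : exists2 g2 : 'Hom(X, DK x.+1), rhom g2 & forall y, g2 (g y) = (q \o f2)%VF y.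
  apply: fact_surj => // [|y /exg[z ->]]; first exact: rhom_comp.
  by rewrite comp_lfunE f2E comp_lfunE (ses_comp0 _ sD).
have [u [w Fr]] := frame_DK hx.
have [c hc] := frame_End Fr (rhom_comp hg2 hg1).
have hcE y : g2 (g1 y) = c *: y by rewrite -comp_lfunE hc.
case: (eqVneq c 0) => [c0|c0]; last first.
  exists g1, (c^-1 *: g2); split=> //; first exact: rhomZ.
  by move=> y; rewrite scale_lfunE hcE scalerA mulVf // scale1r.
have [h hh hE] : exists2 h : 'Hom(DK x.+1, P (socK x)), rhom h &
    forall y, h (q y) = (\1 - (f2 \o f1))%VF y.
  apply: fact_surj => // [|y /exq[z ->]].
    by apply: rhomB; [exact: rhom_id|exact: rhom_comp].
  rewrite add_lfunE opp_lfunE id_lfunE comp_lfunE f1E comp_lfunE f2E comp_lfunE ba.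
  by rewrite subrr.
case: (DK_retract_P hx (socK_neq hx)); exists h, q; split=> // y.
have [z <-] := sq y; rewrite hE add_lfunE opp_lfunE id_lfunE comp_lfunE linearB /=.
have -> : q (f2 (f1 z)) = g2 (g1 (q z)) by rewrite g1E comp_lfunE g2E comp_lfunE.
by rewrite hcE c0 scale0r subr0.
Qed.

(** * Self-orthogonal modules *)

Definition self_orthogonal X := forall j : nat, ext_eq0 j X X.

Lemma self_orthogonal_syz X K F (i : 'Hom(K, F)) (p : 'Hom(F, X)) :
  projective F -> injmod F -> ses i p -> self_orthogonal X -> self_orthogonal K.
Proof.
by move=> pF iF s h j; apply/(ext_eq0_syz _ _ pF s)/(ext_eq0_cosyz _ _ iF s).
Qed.

Lemma self_orthogonal_cosyz X K F (i : 'Hom(K, F)) (p : 'Hom(F, X)) :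
  projective F -> injmod F -> ses i p -> self_orthogonal K -> self_orthogonal X.
Proof.
by move=> pF iF s h j; apply/(ext_eq0_cosyz _ _ iF s)/(ext_eq0_syz _ _ pF s).
Qed.

(** Induction on the projective dimension. If [X] maps onto [L lst], then [pd1_top_split] makes [X]
    projective, so P(n) = [DK 0] is a summand. Otherwise [X] has a projective-injective cover whose
    kernel is again self-orthogonal, of smaller dimension bound, and [DK_step] moves a summand of
    the kernel one place along the chain. *)
Lemma self_orthogonal_summand r X : pd_le r X -> self_orthogonal X ->
  (projective X /\ injmod X) \/ exists2 x, (x <= n.-1.*2)%N & retract (DK x) X.
Proof.
elim: r X => [|r IH] X pX eX;
  have [[g [hg [x gx]]]|nog] := classic (exists g : 'Hom(X, L lst), rhom g /\ exists x, g x != 0).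
- right; exists 0%N => //.
  apply: retract_trans (proj_top pX hg gx); exact/riso_retract/riso_sym/DK0_riso.
- left; have [|F [f [[pF iF _] hf sf]]] := @projinj_cover X.
    by move=> g hg x; apply/eqP/negPn/negP => gx; apply: nog; exists g; split=> //; exists x.
  have [s hs sE] := projP pX hf sf (@rhom_id _ _ X).
  split=> //; apply: retract_injmod iF; exists s, f; split=> // x.
  by rewrite sE id_lfunE.
- right; exists 0%N => //.
  have pX0 : projective X.
    apply: (@pd_le_proj_of_ext _ _ r.+1 X X _ pX eX) => Y.
    by apply: (pd1_top_split hg); exists x.
  apply: retract_trans (proj_top pX0 hg gx); exact/riso_retract/riso_sym/DK0_riso.
have [|F [f [pjF hf sf]]] := @projinj_cover X.
  by move=> g hg x; apply/eqP/negPn/negP => gx; apply: nog; exists g; split=> //; exists x.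
have [pF iF rF] := pjF; have [K [i s]] := ker_ses hf sf.
have [[pK iK]|[x hx rK]] := IH K (pX _ _ _ _ pF s) (self_orthogonal_syz pF iF s eX).
  by left; have [rX _] := injmod_ses_split s iK; split;
    [exact: retract_proj rX pF|exact: retract_injmod rX iF].
right; have [xN|xN] := ltnP x n.-1.*2; first by exists x.+1 => //; exact: DK_step iF s rK.
(* The end of the chain cannot occur in the kernel: being injective it would split off the cover
   [F], hence be a summand of some [P v]. *)
have ex : x = n.-1.*2 by apply/eqP; rewrite eqn_leq hx.
have iD : injmod (DK x) by rewrite ex; exact: DK_last_injmod.
have [hi _ ii _ _] := s; have [a [b [ha _ ba]]] := rK.
have rDF : retract (DK x) F.
  apply: (injmod_retract (i := (i \o a)%VF)) iD; first exact: rhom_comp.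
  by apply: inj_comp => // y z e; rewrite -(ba y) e ba.
have [v hv rv] := rF _ (DK_local hx) rDF.
by case: (DK_retract_P hx hv rv).
Qed.

(** In degree one, extending the identity of [DK x] over [P (socK x)] would split it off an
    indecomposable module of larger dimension. Higher degrees follow by taking syzygies along the
    chain. *)
Lemma DK_ext x (j : nat) : (x + j.+1 <= n.-1.*2)%N -> ~ ext_eq0 j (DK (x + j.+1)) (DK x).
Proof.
elim: j => [|j IH] hj.
  rewrite addn1 => e; rewrite addn1 in hj.
  have [i [q s]] := DK_ses hj; have [hi _ _ _ _] := s.
  have [h hh hE] := e _ _ _ _ (@proj_P _) s \1%VF (@rhom_id _ _ _).
  apply: (DK_retract_P (ltnW hj) (socK_neq hj)); exists i, h; split=> // y.
  by rewrite hE id_lfunE.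
rewrite addnS in hj *; have [i [q s]] := DK_ses hj.
move=> /(ext_eq0_syz _ _ (@proj_P _) s); exact/IH/ltnW.
Qed.

Lemma DK_unique T x y : (x <= n.-1.*2)%N -> (y <= n.-1.*2)%N -> self_orthogonal T ->
  retract (DK x) T -> retract (DK y) T -> x = y.
Proof.
wlog xy : x y / (x <= y)%N => [H|] hx hy eT rx ry.
  by have [|/ltnW] := leqP x y => h; [exact: H|apply/esym; exact: H].
apply/eqP; rewrite eqn_leq xy leqNgt; apply/negP => lt.
have ey : y = (x + (y - x).-1.+1)%N by lia.
apply: (@DK_ext x (y - x).-1); rewrite -ey //.
exact/(ext_eq0_retractl ry)/(ext_eq0_retractr rx).
Qed.

Lemma DK_self_orthogonal x : (x <= n.-1.*2)%N -> self_orthogonal (DK x).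
Proof.
elim: x => [_ j|x IH hx].
  exact/ext_eq0_proj/(retract_proj (riso_retract (riso_sym DK0_riso)))/proj_P.
have [i [q s]] := DK_ses hx.
exact: self_orthogonal_cosyz (@proj_P _) (P_injmod (socK_neq hx)) s (IH (ltnW hx)).
Qed.

Lemma DK_finite_projdim x : (x <= n.-1.*2)%N -> finite_projdim (DK x).
Proof.
elim: x => [_|x IH hx].
  exact/finite_projdim_proj/(retract_proj (riso_retract (riso_sym DK0_riso)))/proj_P.
have [i [q s]] := DK_ses hx.
exact: finite_projdim_ses (@proj_P _) s (IH (ltnW hx)).
Qed.

Lemma P_riso_inj v v' : riso (P v) (P v') -> v = v'.
Proof.
move=> /riso_inv[f [g [hf hg gf fg]]].
have [p hp] := generator_ex v; have [p' hp'] := generator_ex v'.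
have [_ _ _ [r hr rp]] := hp'; have [pE pg _ _] := hp.
apply/eqP; apply: contraNT rp => vv'; rewrite -(fg p').
have [b ->] := pg (g p'); rewrite hf hr -{1}pE hf hr.
by rewrite L_Ev_neq 1?eq_sym // act0.
Qed.

Lemma lt_pred_lst v : (v < n.-1)%N = (v != lst).
Proof.
rewrite -succ_neq_lst; have := ltn_ord v; case: eqP => h; lia.
Qed.

(** * Tilting modules *)

Local Notation sumP := (\big[@rdsum k B/@rzero k B]_(i < n | (i < n.-1)%N) P i).

Lemma sumP_projective : projective sumP.
Proof. by apply: proj_bigrdsum => v _; exact: proj_P. Qed.

Lemma sumP_injmod : injmod sumP.
Proof. by apply: injmod_bigrdsum => v hv; apply: P_injmod; rewrite succ_neq_lst -lt_pred_lst. Qed.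

Lemma retract_sumP v : v.+1 != n -> retract (P v) sumP.
Proof.
by move=> hv; apply: retract_bigrdsum; rewrite ?mem_index_enum // lt_pred_lst -succ_neq_lst.
Qed.

Lemma basic_sum x T : (x <= n.-1.*2)%N -> riso T (rdsum sumP (DK x)) -> basic T.
Proof.
move=> hx rT; pose G (v : 'I_n) := if (v < n.-1)%N then P v else DK x.
have Glst : G lst = DK x by rewrite /G lt_pred_lst eqxx.
have nPD v : (v < n.-1)%N -> ~ riso (P v) (DK x).
  rewrite lt_pred_lst -succ_neq_lst => hv /riso_sym/riso_retract; exact: DK_retract_P.
exists n, G; split.
- move=> v; rewrite /G; case: ifP => _; apply: local_indecomposable;
    [exact: P_local|exact: DK_local].
- move=> v v' nv; rewrite /G; case: ifP => hv; case: ifP => hv'.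
  + by move/P_riso_inj.
  + exact: nPD.
  + by move/riso_sym; exact: nPD.
  + by case: nv; move: hv hv'; rewrite !lt_pred_lst => /negbFE/eqP -> /negbFE/eqP ->.
apply: riso_trans rT _; apply: riso_sym.
apply: riso_trans (@riso_bigrdsum_D1 _ _ _ xpredT G lst isT) _.
rewrite Glst; apply: riso_rdsum (riso_refl _).
rewrite (eq_bigl (fun v : 'I_n => (v < n.-1)%N)) => [|v]; last by rewrite lt_pred_lst.
by apply: riso_bigrdsum => v hv; rewrite /G hv; exact: riso_refl.
Qed.

Lemma riso_regular : riso (regular B) (rdsum sumP (P lst)).
Proof.
have [p hp] := fin_all_exists generator_ex.
have [b hb bE] := fin_all_exists2 (fun v => rhom_gen (p v)).
have Ha v : exists2 a : 'Hom(P v, regular B), rhom a & a (p v) = Ev v.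
  by apply: gen_hom => //; rewrite [LHS]Ev_mul eqxx.
have [a ha aE] := fin_all_exists2 Ha.
have ap v c : a v (act (p v) c) = Ev v * c by rewrite ha aE.
apply: riso_trans (_ : riso _ (\big[@rdsum k B/@rzero k B]_(i < n) P i)) _.
  apply: (riso_biproduct (a := a) (b := b)) => //.
  - exact: index_enum_uniq.
  - move=> v x; have [pE pg _ _] := hp v; have [c ->] := pg x.
    by rewrite ap bE actM pE.
  - move=> v w x vw; have [pE pg _ _] := hp v; have [c ->] := pg x.
    have [pE' _ _ _] := hp w.
    have e : act (p w) (Ev v) = 0.
      by rewrite -pE' -actM Ev_mul eq_sym (negbTE vw) actr0.
    by rewrite ap bE actM e act0.
  - move=> x; rewrite -[RHS]mul1r -(Ev_sum Z) mulr_suml; apply: eq_bigr => v _.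
    by rewrite bE ap.
apply: riso_trans (@riso_bigrdsum_D1 _ _ _ xpredT P lst isT) _.
apply: riso_rdsum (riso_refl _).
rewrite (eq_bigl (fun v : 'I_n => (v < n.-1)%N)) => [|v]; last by rewrite lt_pred_lst.
exact: riso_refl.
Qed.

Lemma tilting_sum x T : (x <= n.-1.*2)%N -> riso T (rdsum sumP (DK x)) ->
  generalized_tilting T.
Proof.
move=> hx rT; have rT' := riso_sym rT.
have rD : retract (DK x) T.
  exact: retract_trans (@retract_in2 _ _ _ _) (riso_retract rT').
have rS : retract sumP T.
  exact: retract_trans (@retract_in1 _ _ _ _) (riso_retract rT').
have rP v : v.+1 != n -> retract (P v) T.
  by move=> hv; exact: retract_trans (retract_sumP hv) rS.
split.
- case: x hx rT rT' rD => [|x] hx rT rT' rD.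
    apply: finite_projdim_proj; apply: retract_proj (riso_retract rT) _.
    apply: proj_rdsum sumP_projective _.
    exact/(retract_proj (riso_retract (riso_sym DK0_riso)))/proj_P.
  have [i [q s]] := DK_ses hx; have [hi hq ii sq exq] := s.
  have [f [g [hf hg gf fg]]] := riso_inv rT'.
  apply: (@finite_projdim_ses _ _ (DK x) (rdsum sumP (P (socK x))) T
    (rin2 _ _ \o i)%VF (f \o rcopair (rin1 _ _) (rin2 _ _ \o q))%VF).
  + exact: proj_rdsum sumP_projective (@proj_P _).
  + split.
    * by apply: rhom_comp => //; exact: rhom_in2.
    * apply: rhom_comp => //; apply: rhom_copair; first exact: rhom_in1.
      by apply: rhom_comp => //; exact: rhom_in2.
    * by apply: inj_comp => // y z; rewrite !rin2E => -[].
    * move=> y; have [z ez] := sq (g y).2.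
      exists ((g y).1, z); rewrite comp_lfunE rcopairE comp_lfunE /= ez rin1E rin2E.
      by rewrite pair_addE /= addr0 add0r -surjective_pairing fg.
    * move=> [y z]; rewrite comp_lfunE rcopairE comp_lfunE /= rin1E rin2E pair_addE /=.
      rewrite addr0 add0r; split=> [e|[w]].
        have := congr1 g e; rewrite gf linear0 => -[-> /exq[w ->]].
        by exists w; rewrite comp_lfunE rin2E.
      by rewrite comp_lfunE rin2E => -[-> ->]; rewrite (ses_comp0 _ s) linear0.
  + exact: DK_finite_projdim (ltnW hx).
- have sT : sretract T (DK x).
    have [f [g [hf hg gf fg]]] := riso_inv rT.
    exists (rpr2 _ _ \o f)%VF, (g \o rin2 _ _)%VF, sumP, (rpr1 _ _ \o f)%VF, (g \o rin1 _ _)%VF.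
    split; first exact: sumP_projective.
    + by apply: rhom_comp => //; exact: rhom_pr2.
    + by apply: rhom_comp => //; exact: rhom_in2.
    split.
    + by apply: rhom_comp => //; exact: rhom_pr1.
    + by apply: rhom_comp => //; exact: rhom_in1.
    move=> y; rewrite !comp_lfunE rpr1E rpr2E rin1E rin2E -linearD /= pair_addE /=.
    by rewrite add0r addr0 -surjective_pairing gf.
  move=> j P0 d aug res; apply/(resolution_ext T j res).
  apply: (ext_eq0_stable sT); apply: (ext_eq0_retractr (riso_retract rT)).
  apply: ext_eq0_rdsumr (DK_self_orthogonal hx j).
  exact: ext_eq0_inj sumP_injmod.
(* Downward induction from [y = x], on the difference [m]; when [x <= m] truncated subtraction
   leaves the index at 0. *)
have fac y : (y <= x)%N -> finite_add_coresolution T (DK y).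
  move=> yx; rewrite -(subKn yx); elim: (x - y)%N => [|m IH].
    by rewrite subn0; apply/coresolution_in_add/in_add_retract1.
  have [xm|mx] := leqP x m.
    have e : (x - m.+1 = x - m)%N by lia.
    by rewrite e; exact: IH.
  have e : (x - m = (x - m.+1).+1)%N by lia.
  have hm : (x - m.+1 < n.-1.*2)%N by lia.
  have [i [q s]] := DK_ses hm.
  apply: coresolution_ses s _ _; first exact/in_add_retract1/rP/socK_neq.
  by rewrite -e; exact: IH.
apply: coresolution_riso riso_regular _.
apply: (coresolution_riso (M' := rdsum sumP (DK 0))).
  exact: riso_rdsum (riso_refl _) DK0_riso.
(* For [x = 0] the regular module is isomorphic to [T]; otherwise the sequence from [DK 0] to [DK 1]
   is enlarged by the identity of [sumP]. *)
case: x hx rT rT' rD fac => [|x] hx rT rT' rD fac.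
  by apply: coresolution_in_add; exact/in_add_retract1/riso_retract.
have h0 : (0 < n.-1.*2)%N by lia.
have [i [q s]] := DK_ses h0; have [hi hq ii sq exq] := s.
apply: (@coresolution_ses _ _ T (rdsum sumP (DK 0)) (rdsum sumP (P (socK 0))) (DK 1)
  (rcopair (rin1 _ _) (rin2 _ _ \o i))%VF (q \o rpr2 _ _)%VF).
- split.
  + by apply: rhom_copair; [exact: rhom_in1|apply: rhom_comp => //; exact: rhom_in2].
  + by apply: rhom_comp => //; exact: rhom_pr2.
  + apply: injP0 => -[y z]; rewrite rcopairE comp_lfunE /= rin1E rin2E pair_addE /=.
    by rewrite addr0 add0r => -[-> e]; rewrite (ii z 0) ?linear0.
  + by move=> y; have [z <-] := sq y; exists (0, z); rewrite comp_lfunE rpr2E.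
  + move=> [y z]; have -> : (q \o rpr2 sumP (P (socK 0)))%VF (y, z) = q z.
      by rewrite comp_lfunE rpr2E.
    rewrite exq; split=> [[w ->]|[[w w']]].
      by exists (y, w); rewrite rcopairE comp_lfunE /= rin1E rin2E pair_addE /= addr0 add0r.
    rewrite rcopairE comp_lfunE /= rin1E rin2E pair_addE /= add0r => -[_ ->].
    by exists w'.
- exact/in_add_rdsum/rP/socK_neq.
- exact: fac.
Qed.

Lemma tilting_classified T : basic T -> generalized_tilting T ->
  exists2 x, (x <= n.-1.*2)%N & riso T (rdsum sumP (DK x)).
Proof.
move=> [r [X [iX nX rT]]] [fpd ext cores].
have [s pdT] := finite_projdim_pd fpd.
have eT : self_orthogonal T.
  move=> j; have [Q [d [aug [_ [res _]]]]] := fpd.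
  exact/(resolution_ext T j res)/(ext j _ _ _ res).
have rX (i : 'I_r) : retract (X i) T.
  apply: retract_trans (riso_retract (riso_sym rT)).
  by apply: retract_bigrdsum; rewrite ?mem_index_enum.
have eX (i : 'I_r) : self_orthogonal (X i).
  by move=> j; exact/(ext_eq0_retractl (rX i))/(ext_eq0_retractr (rX i)).
have pdX (i : 'I_r) : pd_le s (X i) := pd_le_stable (retract_sretract (rX i)) pdT.
have inX (M : rmodule B) (i : 'I_r) : local M -> retract M (X i) -> riso M (X i).
  by move=> [nM _] rM; exact: retract_indecomposable (iX i) rM nM.
have clX (i : 'I_r) : (exists2 v : 'I_n, v.+1 != n & riso (P v) (X i)) \/
    (exists2 x, (x <= n.-1.*2)%N & riso (DK x) (X i)).
  have [[pX _]|[x hx rx]] := self_orthogonal_summand (pdX i) (eX i); last first.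
    by right; exists x => //; apply: inX rx; exact: DK_local.
  have [v rv] := proj_notnull_top pX (iX i).1.
  have rv' := inX _ _ (P_local v) rv.
  (* The projective [P lst] is counted as [DK 0]. *)
  case: (eqVneq v lst) => [ev|vl]; last by left; exists v; rewrite ?succ_neq_lst.
  by right; exists 0%N => //; apply: riso_trans rv'; rewrite ev; exact/riso_sym/DK0_riso.
have localX M : local M -> retract M T -> exists i : 'I_r, riso M (X i).
  move=> lM rM; have [i _ ri] := local_bigrdsum lM (retract_trans rM (riso_retract rT)).
  by exists i; exact: inX ri.
have [C [d [c [m [hC nC hd hc [kc e0 e]]]]]] := cores.
(* [P v] is injective and embeds in the regular module, hence in [C 0]. It therefore splits off
   [C 0] and, being local, off a copy of [T]. *)
have hPX v : v.+1 != n -> exists i : 'I_r, riso (P v) (X i).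
  move=> hv; apply: localX; first exact: P_local.
  have [p hp] := generator_ex v; have [pE pg _ _] := hp.
  have [q hq qE] := rhom_gen p.
  have sq : surj q by move=> y; have [b ->] := pg y; exists b; rewrite qE.
  have [a ha aE] := projP (@proj_P v) hq sq (@rhom_id _ _ (P v)).
  have ia : injective a by move=> y z eyz; rewrite -[y]id_lfunE -aE eyz aE id_lfunE.
  have rC : retract (P v) (C 0%N).
    apply: (injmod_retract (rhom_comp hc ha)) (P_injmod hv).
    by apply: inj_comp => //; exact/lker_inj.
  have [l rl] := in_add_retractE (hC 0%N isT).
  by have [_ _ ?] := local_bigrdsum (P_local v) (retract_trans rC rl).
(* Without such a summand [T] would be projective and injective, so the coresolution would split and
   make the regular module injective, against [not_injmod_DK] for its summand [DK 0]. *)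
have [i0 [x hx rx]] : exists i : 'I_r, exists2 x, (x <= n.-1.*2)%N & riso (DK x) (X i).
  apply: NNPP => nD.
  have piX (i : 'I_r) : projective (X i) /\ injmod (X i).
    have [[v hv rv]|h] := clX i; last by case: nD; exists i.
    split; first exact: retract_proj (riso_retract (riso_sym rv)) (@proj_P v).
    exact: retract_injmod (riso_retract (riso_sym rv)) (P_injmod hv).
  have pT : projective T.
    by apply: retract_proj (riso_retract rT) _; apply: proj_bigrdsum => i _; have [] := piX i.
  have iT : injmod T.
    by apply: retract_injmod (riso_retract rT) _; apply: injmod_bigrdsum => i _; have [] := piX i.
  have pC y : projective (C y).
    have [ym|my] := leqP y m; last exact/proj_null/nC.
    have [l rl] := in_add_retractE (hC y ym).
    by apply: retract_proj rl _; exact: proj_bigrdsum.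
  have rB : retract (regular B) (C 0%N) := coresolution_split pC nC hd hc kc e0 e.
  have [l rl] := in_add_retractE (hC 0%N isT).
  have iB : injmod (regular B).
    by apply: retract_injmod (retract_trans rB rl) _; exact: injmod_bigrdsum.
  have h0 : (0 < n.-1.*2)%N by lia.
  apply: (not_injmod_DK h0); apply: retract_injmod iB.
  apply: retract_trans (riso_retract (riso_sym riso_regular)).
  apply: retract_trans (@retract_in2 _ _ _ _).
  exact/riso_retract/riso_sym/DK0_riso.
have nPD v y (i : 'I_r) : v.+1 != n -> (y <= n.-1.*2)%N -> riso (P v) (X i) -> ~ riso (DK y) (X i).
  move=> hv hy rP rD; apply: (DK_retract_P hy hv).
  exact/riso_retract/(riso_trans rD)/riso_sym.
have uniq_i (i : 'I_r) y : (y <= n.-1.*2)%N -> riso (DK y) (X i) -> i = i0.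
  move=> hy ry; apply: NNPP => ni; apply: (nX _ _ ni).
  have exy : y = x.
    apply: (DK_unique hy hx eT).
      exact: retract_trans (riso_retract ry) (rX i).
    exact: retract_trans (riso_retract rx) (rX i0).
  by rewrite exy in ry; exact: riso_trans (riso_sym ry) rx.
(* The value of [h] at [lst] is the dummy [i0]; only the other vertices index the remaining
   summands. *)
have [h hh] : exists h : 'I_n -> 'I_r, forall v, v != lst -> riso (P v) (X (h v)).
  apply: (@fin_all_exists _ (fun _ => 'I_r)
    (fun v (i : 'I_r) => v != lst -> riso (P v) (X i))) => v.
  case: (eqVneq v lst) => [_|vl]; first by exists i0.
  by have [|i ri] := hPX v; [rewrite succ_neq_lst|exists i].
exists x => //; apply: riso_trans rT _.
apply: riso_trans (@riso_bigrdsum_D1 _ _ _ xpredT X i0 isT) _.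
apply: riso_rdsum (riso_sym rx).
apply: (riso_trans (N := \big[@rdsum k B/@rzero k B]_(v < n | (v < n.-1)%N) X (h v)));
  last by apply: riso_bigrdsum => v; rewrite lt_pred_lst => hv; exact/riso_sym/hh.
apply: riso_bigrdsum_reindex.
- move=> v v'; rewrite /in_mem /= !lt_pred_lst => hv hv' ehv.
  by apply: P_riso_inj; apply: riso_trans (hh _ hv) _; rewrite ehv; exact/riso_sym/hh.
- move=> i; apply: (iffP idP) => /= [ii0|[v hv ->]].
    have [[v hv rv]|[y hy ry]] := clX i; last by rewrite (uniq_i _ _ hy ry) eqxx in ii0.
    rewrite succ_neq_lst in hv; exists v; first by rewrite lt_pred_lst.
    apply: NNPP => ni; apply: (nX _ _ ni).
    exact: riso_trans (riso_sym rv) (hh _ hv).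
  rewrite lt_pred_lst in hv; apply/eqP => ehv; apply: (nPD v x i0) => //.
    by rewrite succ_neq_lst.
  by rewrite -ehv; exact: hh.
Qed.

End Sequence.
End Classification.
End Projectives.
End Simples.
End ZigzagModules.

Theorem theorem2 (k : closedFieldType) (n : nat) (hn : (2 <= n)%N)
    (B : falgType k) (pi : {rmorphism path_alg k (zigzag n) -> B})
    (hB : path_alg_quotient (@zigzag_rel k n) pi)
    (L P Delta nabla : 'I_n -> rmodule B)
    (hL : forall i, vertex_simple pi i (L i))
    (hP : forall i, projective_cover (P i) (L i))
    (hDelta1 : forall i : 'I_n, val i = 0%N -> Delta i = L i)
    (hnabla1 : forall i : 'I_n, val i = 0%N -> nabla i = L i)
    (hDelta : forall i j : 'I_n, val i = (val j).+1 ->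
      uniserial2 (Delta i) (L i) (L j))
    (hnabla : forall i j : 'I_n, val i = (val j).+1 ->
      uniserial2 (nabla i) (L j) (L i))
    (T : rmodule B) :
  (basic T /\ generalized_tilting T) <->
  exists X : rmodule B,
    (exists i, X = Delta i \/ X = nabla i) /\
    riso T (rdsum (\big[@rdsum k B/@rzero k B]_(i < n | (i < n.-1)%N) P i) X).
Proof.
pose Z := zigzag_basis_of hn hB.
have L_dim i : \dim {:L i} = 1%N by have [] := hL i.
have L_Ev i (m : L i) : act m (Ev Z i) = m by have [_ h _] := hL i; exact: h.
have L_ar i (m : L i) j l : act m (ar Z j l) = 0.
  by have [_ _ h] := hL i; exact: act_aelt0 h m j l.
have hn1 : (n.-1 < n)%N by lia.
pose lst := Ordinal hn1.
have lstE : lst.+1 = n by rewrite /=; lia.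
have fD i j : val i = (val j).+1 -> exists u w : Delta i, frame Z i j u w.
  move=> e; apply: (uniserial2_frame L_dim L_Ev L_ar) (hDelta _ _ e).
  by apply/eqP => e'; rewrite e' in e; lia.
have fN i j : val i = (val j).+1 -> exists u w : nabla i, frame Z j i u w.
  move=> e; apply: (uniserial2_frame L_dim L_Ev L_ar) (hnabla _ _ e).
  by apply/eqP => e'; rewrite e' in e; lia.
split=> [[bT gT]|[X [[i hX] rT]]].
  have [x hx rT] := tilting_classified L_dim L_Ev L_ar hP lstE hn hDelta1 fD fN bT gT.
  exists (DK lst Delta nabla x); split=> //; rewrite /DK; case: ifP => _.
    by exists (vtx lst (n.-1 - x)); left.
  by exists (vtx lst (x - n.-1)); right.
(* In 0-based labels Delta(i) sits at position n - 1 - i and nabla(i) at n - 1 + i; the two simple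
   modules for i = 0 share position n - 1. *)
have [x hx eX] : exists2 x, (x <= n.-1.*2)%N & X = DK lst Delta nabla x.
  have vi (y : nat) : y = i :> nat -> vtx lst y = i.
    by move=> e; apply: ord_inj; rewrite vtxE // e ltn_ord.
  have := ltn_ord i => ltin.
  have hD : exists2 x, (x <= n.-1.*2)%N & Delta i = DK lst Delta nabla x.
    exists (n.-1 - i)%N; first lia.
    by rewrite /DK; case: ifP => h; [rewrite vi //; lia|lia].
  case: hX => -> //; have [i0|i0] := posnP i.
    by rewrite hnabla1 // -hDelta1.
  exists (n.-1 + i)%N; first lia.
  by rewrite /DK; case: ifP => h; [lia|rewrite vi //; lia].
rewrite eX in rT; split.
  exact: (basic_sum L_dim L_Ev L_ar hP lstE hn hDelta1 fD fN hx rT).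
exact: (tilting_sum L_dim L_Ev L_ar hP lstE hn hDelta1 fD fN hx rT).
Qed.
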